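(* Let $\frac12\le H<1$, $\alpha>0$, $\mu=(\mu_1,\dots,\mu_p)\in\mathbb{R}^p$, and let $X$ be the solution of $X_0=0$, $dX_t=(L(t)+\alpha X_t)\,dt+dB^H_t$, $t\ge 0$, with $L=\sum_{i=1}^p\mu_i\phi_i$, where $\phi_1,\dots,\phi_p$ are bounded, $1$-periodic and orthonormal in $L^2([0,1])$, and $B^H$ is a fractional Brownian motion with Hurst index $H$. Let $\hat\theta_n=(\hat\mu_n,\hat\alpha_n)$ be the estimator of $\theta=(\mu,\alpha)$ defined in the context. Then, almost surely, as $n\to\infty$, $$\hat\theta_n=(\hat\mu_n,\hat\alpha_n)\longrightarrow\theta=(\mu,\alpha).$$
   Context: $n$ denotes a positive integer, and $B^H=\{B^H_t,t\ge0\}$ is a fractional Brownian motion with Hurst index $H$ (standard Brownian motion if $H=\frac12$). Integrals: for $H=\frac12$ the stochastic integrals below are understood in the It\^o sense, and $\int_0^nX_s\,dX_s=\frac12(X_n^2-n)$. For $\frac12<H<1$ they are understood in the Young sense, and $\int_0^nX_s\,dX_s=\frac12X_n^2$. (Young integral: for $f$ $a$-H\''older and $g$ $b$-H\''older on $[0,T]$ with $a+b>1$, $\int_0^\cdot f\,dg$ is the extension by continuity, in the H\''older norm of $g$, of $g\mapsto\int_0^\cdot f(u)g'(u)\,du$ from continuously differentiable $g$.) Estimator: set $$\Lambda_{n,i}:=\frac1n\int_0^n\phi_i(s)X_s\,ds\quad(i=1,\dots,p),\qquad \gamma_n:=\Big(\frac1n\int_0^nX_s^2\,ds-\sum_{i=1}^p\Lambda_{n,i}^2\Big)^{-1},$$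 $$\hat\alpha_n:=\frac{\gamma_n}{n}\Big(\int_0^nX_s\,dX_s-\sum_{k=1}^p\Lambda_{n,k}\int_0^n\phi_k(s)\,dX_s\Big),$$ and $\hat\mu_n:=(\hat\mu_{n,1},\dots,\hat\mu_{n,p})$ with $$\hat\mu_{n,i}:=\frac1n\Big(\int_0^n\phi_i(s)\,dX_s+\gamma_n\Lambda_{n,i}\sum_{k=1}^p\Lambda_{n,k}\int_0^n\phi_k(s)\,dX_s-\gamma_n\Lambda_{n,i}\int_0^nX_s\,dX_s\Big).$$ *)

(* Defs.v *)
From HB Require Import structures.
From mathcomp Require Import all_boot all_order all_algebra.
From mathcomp Require Import all_classical all_reals all_analysis.

Set Implicit Arguments.
Unset Strict Implicit.
Unset Printing Implicit Defensive.

Import Order.TTheory GRing.Theory Num.Theory.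
Import numFieldNormedType.Exports.

Local Open Scope classical_set_scope.
Local Open Scope ring_scope.

(* Time runs over the nonnegative reals: a process is a function of t : R,
   of which only the values at t >= 0 are ever constrained or used. *)

(* Degenerate Gaussian variables are treated apart, because normal_prob m s is
   not a Dirac mass when s = 0. *)
Definition gaussian_variable (R : realType) (d : measure_display)
    (Omega : measurableType d) (P : probability Omega R) (Z : Omega -> R) : Prop :=
  exists m s : R,
    (s != 0 /\ forall A : set R, measurable A -> P (Z @^-1` A) = normal_prob m s A)
    \/ {ae P, forall w, Z w = m}.

Definition gaussian_process (R : realType) (d : measure_display)
    (Omega : measurableType d) (P : probability Omega R)
    (B : R -> {RV P >-> R}) : Prop :=
  forall (m : nat) (t c : 'I_m -> R), (forall i, 0 <= t i) ->
    gaussian_variable P (fun w => \sum_(i < m) c i * B (t i) w).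

Definition fbm_cov (R : realType) (H s t : R) : R :=
  2^-1 * (t `^ (2 * H) + s `^ (2 * H) - `|t - s| `^ (2 * H)).

Record fractional_brownian_motion (R : realType) (d : measure_display)
    (Omega : measurableType d) (P : probability Omega R) (H : R)
    (B : R -> {RV P >-> R}) : Prop := {
  fbm_gaussian : gaussian_process B;
  fbm_centered : forall t : R, 0 <= t -> ('E_P[B t] = 0)%E;
  fbm_covariance : forall s t : R, 0 <= s -> 0 <= t ->
    covariance P (B s) (B t) = (fbm_cov H s t)%:E;
  fbm_continuous : {ae P, forall w, {within `[0, +oo[, continuous (fun t => B t w)}}
}.

(* F is a filtration with respect to which B is a Brownian motion: B is adapted
   and B t - B s is independent of F s.  The natural filtration of a Brownian
   motion, augmented by null events or not, is an example. *)
Record brownian_filtration (R : realType) (d : measure_display)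
    (Omega : measurableType d) (P : probability Omega R)
    (B : R -> {RV P >-> R}) (F : R -> set (set Omega)) : Prop := {
  bf_sigma_algebra : forall t : R, 0 <= t -> sigma_algebra [set: Omega] (F t);
  bf_measurable : forall t : R, 0 <= t -> F t `<=` measurable;
  bf_nondecreasing : forall s t : R, 0 <= s -> s <= t -> F s `<=` F t;
  bf_adapted : forall (t : R) (A : set R), 0 <= t -> measurable A ->
    F t (B t @^-1` A);
  bf_independent : forall (s t : R) (E : set Omega) (A : set R),
    0 <= s -> s <= t -> F s E -> measurable A ->
    P (E `&` [set w | A (B t w - B s w)%R]) =
    (P E * P [set w | A (B t w - B s w)%R])%E
}.

Record simple_process (R : realType) (Omega : Type)
    (F : R -> set (set Omega)) (T : R) := SimpleProcess {
  sp_size : nat;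
  sp_time : nat -> R;
  sp_coef : nat -> Omega -> R;
  sp_time_ge0 : 0 <= sp_time 0%N;
  sp_time_le : forall i, (i < sp_size)%N -> sp_time i <= sp_time i.+1;
  sp_time_leT : sp_time sp_size <= T;
  sp_coef_adapted : forall i (A : set R), (i < sp_size)%N -> measurable A ->
    F (sp_time i) (sp_coef i @^-1` A);
  sp_coef_bounded : forall i, (i < sp_size)%N ->
    exists M : R, forall w, `|sp_coef i w| <= M
}.

Definition sp_eval (R : realType) (Omega : Type) (F : R -> set (set Omega))
    (T : R) (S : simple_process F T) (s : R) (w : Omega) : R :=
  \sum_(i < sp_size S) sp_coef S i w * \1_(`]sp_time S i, sp_time S i.+1]) s.

Definition sp_integral (R : realType) (Omega : Type) (F : R -> set (set Omega))
    (T : R) (B : R -> Omega -> R) (S : simple_process F T) (w : Omega) : R :=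
  \sum_(i < sp_size S) sp_coef S i w * (B (sp_time S i.+1) w - B (sp_time S i) w).

(* J = int_0^T Y dB in the Ito sense: J is the L^2(P) limit of the integrals of
   simple adapted processes converging to Y in L^2(ds x P) on [0, T].  Such an
   integral is determined up to a null event. *)
Definition is_ito_integral (R : realType) (d : measure_display)
    (Omega : measurableType d) (P : probability Omega R)
    (F : R -> set (set Omega)) (B : R -> {RV P >-> R}) (T : R)
    (Y : R -> Omega -> R) (J : {RV P >-> R}) : Prop :=
  exists S : nat -> simple_process F T,
    ((fun k => \int[P]_w \int[lebesgue_measure]_(s in `[0%R, T])
        ((sp_eval (S k) s w - Y s w) ^+ 2)%:E)%E @ \oo --> 0%E) /\
    ((fun k => \int[P]_w
        ((sp_integral (fun t => B t : Omega -> R) (S k) w - J w) ^+ 2)%:E)%E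
      @ \oo --> 0%E).

(* The b-Hoelder norm of f on [0, T] is at most C. *)
Definition holder_norm_le (R : realType) (b T : R) (f : R -> R) (C : R) : Prop :=
  (forall t : R, 0 <= t <= T -> `|f t| <= C) /\
  (forall s t : R, 0 <= s <= T -> 0 <= t <= T -> `|f t - f s| <= C * `|t - s| `^ b).

Definition holder (R : realType) (b T : R) (f : R -> R) : Prop :=
  exists C : R, holder_norm_le b T f C.

(* I = int_0^T f dg in the Young sense.  A b-Hoelder function is a limit of C^1
   functions in the b'-Hoelder norm for every b' < b; the existentially
   quantified exponents can always be lowered so, keeping 1 < a + b. *)
Definition is_young_integral (R : realType) (T : R) (f g : R -> R) (I : R) : Prop :=
  exists a b : R,
    [/\ 0 < a <= 1, 0 < b <= 1, 1 < a + b, holder a T f & holder b T g] /\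
    exists g_ : nat -> R -> R,
      [/\ forall k t, derivable (g_ k) t 1,
          forall k, continuous (derive1 (g_ k)),
          forall e : R, 0 < e ->
            \forall k \near \oo, holder_norm_le b T (fun t => g_ k t - g t) e
        & (fun k => \int[lebesgue_measure]_(s in `[0, T]) (f s * derive1 (g_ k) s))
            @ \oo --> I].

Section Model.
Variables (R : realType) (p : nat).

Definition orthonormal_family (phi : 'I_p -> R -> R) : Prop :=
  forall i j, \int[lebesgue_measure]_(s in `[0, 1]) (phi i s * phi j s) = (i == j)%:R.

Definition mean_fun (mu : 'rV[R]_p) (phi : 'I_p -> R -> R) (t : R) : R :=
  \sum_(i < p) mu ord0 i * phi i t.

Definition drift (mu : 'rV[R]_p) (alpha : R) (phi : 'I_p -> R -> R)
    (x : R -> R) (t : R) : R :=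
  mean_fun mu phi t + alpha * x t.

Definition is_solution (d : measure_display) (Omega : measurableType d)
    (P : probability Omega R) (mu : 'rV[R]_p) (alpha : R) (phi : 'I_p -> R -> R)
    (B X : R -> {RV P >-> R}) : Prop :=
  {ae P, forall w,
    [/\ X 0 w = 0,
        {within `[0, +oo[, continuous (fun t => X t w)} &
        forall t : R, 0 <= t ->
          X t w = \int[lebesgue_measure]_(s in `[0, t])
                    drift mu alpha phi (fun u => X u w) s + B t w]}.

(* I = int_0^T Y dX.  In the Ito case, dX = (L + alpha X) dt + dB. *)
Definition is_integral_dX (d : measure_display) (Omega : measurableType d)
    (P : probability Omega R) (H : R) (mu : 'rV[R]_p) (alpha : R)
    (phi : 'I_p -> R -> R) (F : R -> set (set Omega)) (B X : R -> {RV P >-> R})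
    (T : R) (Y : R -> Omega -> R) (I : Omega -> R) : Prop :=
  if H == 2^-1 then
    exists2 J : {RV P >-> R}, is_ito_integral F B T Y J &
      {ae P, forall w,
        I w = \int[lebesgue_measure]_(s in `[0%R, T])
                (Y s w * drift mu alpha phi (fun u => X u w) s) + J w}
  else
    {ae P, forall w, is_young_integral T (fun t => Y t w) (fun t => X t w) (I w)}.

(* Below, x is the observed path, Iphi k stands for int_0^n phi_k dX and IX for
   int_0^n X dX. *)

Definition Lambda (phi : 'I_p -> R -> R) (n : nat) (x : R -> R) (i : 'I_p) : R :=
  n%:R^-1 * \int[lebesgue_measure]_(s in `[0, n%:R]) (phi i s * x s).

Definition gamma (phi : 'I_p -> R -> R) (n : nat) (x : R -> R) : R :=
  (n%:R^-1 * \int[lebesgue_measure]_(s in `[0, n%:R]) (x s ^+ 2)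
   - \sum_(i < p) Lambda phi n x i ^+ 2)^-1.

Definition alpha_hat (phi : 'I_p -> R -> R) (n : nat) (x : R -> R)
    (Iphi : 'I_p -> R) (IX : R) : R :=
  gamma phi n x / n%:R * (IX - \sum_(k < p) Lambda phi n x k * Iphi k).

Definition mu_hat (phi : 'I_p -> R -> R) (n : nat) (x : R -> R)
    (Iphi : 'I_p -> R) (IX : R) : 'rV[R]_p :=
  \row_(i < p) (n%:R^-1 *
    (Iphi i
     + gamma phi n x * Lambda phi n x i * (\sum_(k < p) Lambda phi n x k * Iphi k)
     - gamma phi n x * Lambda phi n x i * IX)).

Definition theta_hat (phi : 'I_p -> R -> R) (n : nat) (x : R -> R)
    (Iphi : 'I_p -> R) (IX : R) : 'rV[R]_p * R :=
  (mu_hat phi n x Iphi IX, alpha_hat phi n x Iphi IX).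

End Model.

(* Main.v *)
Require Import Defs.
From HB Require Import structures.
From mathcomp Require Import all_boot all_order all_algebra.
From mathcomp Require Import all_classical all_reals all_analysis.
From mathcomp Require Import measurable_realfun ring lra.

Set Implicit Arguments.
Unset Strict Implicit.
Unset Printing Implicit Defensive.

Import Order.TTheory GRing.Theory Num.Theory.
Import numFieldNormedType.Exports.

Local Open Scope classical_set_scope.
Local Open Scope ring_scope.

(** Consistency of the least squares estimator, for an explosive equation
dX = (L + alpha X) dt + dB with alpha > 0.

Writing the noise parts of the observed integrals as
N_k(n) = int_0^n phi_k dX - int_0^n phi_k (L + alpha X) ds and
M(n) = int_0^n X dX - int_0^n X (L + alpha X) ds, orthonormality of the phi_k
gives the exact identities
  alpha_hat - alpha = (M(n) - sum_k Lambda_k N_k(n)) / D(n),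
  mu_hat_i - mu_i = N_i(n) / n - Lambda_i (alpha_hat - alpha),
with D(n) = int_0^n X^2 ds - n sum_k Lambda_k^2.  Hence everything reduces to
orders of magnitude.  The equation has the solution
X_t = c(t) + alpha e^(alpha t) eta(t), where c(t) = B_t + int_0^t L is the
forcing and eta(t) = int_0^t e^(-alpha s) c(s) ds.  The path of B grows
polynomially, so eta converges, to eta_oo say, and X explodes like
e^(alpha t) times eta_oo.  Thus n Lambda_k(n) = O(e^(alpha n)) and, as soon as
eta_oo <> 0, D(n) is at least a positive multiple of e^(2 alpha n).  The
estimator is then consistent if N_k(n) = o(n) and M(n) = o(n e^(alpha n)):
this deterministic statement about one path is [estimator_cvg].  The
probabilistic part has three inputs.

Nondegeneracy ([eta_limit_neq0]).  Up to a deterministic shift, eta(T) is a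
limit of Gaussian sums whose variances are bounded below uniformly in T, because
the covariance of B is nonnegative and at least 1/2 on [1, 2]^2.  Such sums
put mass O(e) on every ball of radius e, uniformly, and this survives both
passages to the limit by Fatou's lemma, so eta_oo = 0 has probability 0.

The noise N_k.  For H > 1/2 the Young integral is a limit of dyadic
Riemann-Stieltjes sums ([young_stieltjes_sum]); increments of B over equal
intervals are nonnegatively correlated, so replacing the bounded weights by
constants bounds the second moment by M^2 n^(2H) ([weighted_incr]).  For
H = 1/2 the Ito isometry gives a bound linear in n.  In both cases the
increments N_k(n + 1) - N_k(n) are bounded in mean square, and a strong law for
sequences with E S_n^2 = O(n^r), r < 2, concludes ([strong_law]).

The noise M.  For H > 1/2 the integral of X against itself is X_n^2 / 2, and
M(n) has a closed form in which every term is o(n e^(alpha n)) along a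
path ([young_self_noise], [path_remainder]).  For H = 1/2 the Ito isometry and
the path bound on int X^2 give E M(n)^2 = O(e^(2 alpha n)), and the series
of E (M(n) / (n e^(alpha n)))^2 converges.

Integrals along paths need not be measurable functions of the outcome, since a
process is only assumed measurable at each time and continuous almost surely.
As upper bounds suffice, expectations are bounded through [Ele P f C]: some
measurable g that dominates f almost surely has expectation at most C. *)

Local Notation "'\I_[' a , b ] f" := (Rintegral lebesgue_measure `[a, b]%classic f)
  (at level 36, a, b at level 50, f at level 36, format "'\I_[' a ,  b ]  f").

(** * Integrals over bounded time intervals *)

Section LocallyBounded.
Variable R : realType.
Implicit Types (f g h : R -> R) (a b t s T : R).

(** Locally bounded measurable functions of time: a class of integrands that is
    stable under the algebraic operations, contains the continuous paths and the
    bounded phi_i, and is integrable on every [a, b] with 0 <= a. *)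
Definition lbm f : Prop :=
  measurable_fun (`[0, +oo[%classic : set R) f /\ forall T, exists M : R, forall t, 0 <= t <= T -> `|f t| <= M.

Lemma lbm_measurable f a b : 0 <= a -> lbm f -> measurable_fun (`[a, b]%classic : set R) f.
Proof.
move=> a0 [mf _]; apply: (measurable_funS _ _ mf) => //.
by move=> x /=; rewrite !in_itv/= andbT => /andP[/(le_trans a0)].
Qed.

Lemma lbm_integrable f a b : 0 <= a -> lbm f ->
  lebesgue_measure.-integrable `[a, b] (EFin \o f).
Proof.
move=> a0 lf; apply: measurable_bounded_integrable => //.
- by rewrite /= lebesgue_measure_itv/=; case: ifP => _ //; rewrite -EFinB ltry.
- exact: lbm_measurable.
- have [M HM] := lf.2 b; exists M; split; rewrite ?num_real // => y My x /=.
  rewrite in_itv/= => /andP[ax xb]; apply: le_trans (ltW My).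
  by apply: HM; rewrite xb (le_trans a0 ax).
Qed.

Lemma lbm_cst c : lbm (fun _ => c).
Proof. by split=> [|T]; [exact: measurable_cst | exists `|c|]. Qed.

Lemma lbmD f g : lbm f -> lbm g -> lbm (fun s => f s + g s).
Proof.
move=> [mf bf] [mg bg]; split=> [|T]; first exact: measurable_funD.
have [M HM] := bf T; have [N HN] := bg T; exists (M + N) => t tT.
by rewrite (le_trans (ler_normD _ _))// lerD ?HM ?HN.
Qed.

Lemma lbmM f g : lbm f -> lbm g -> lbm (fun s => f s * g s).
Proof.
move=> [mf bf] [mg bg]; split=> [|T]; first exact: measurable_funM.
have [M HM] := bf T; have [N HN] := bg T; exists (M * N) => t tT.
by rewrite normrM ler_pM ?HM ?HN.
Qed.

Lemma lbmZ c f : lbm f -> lbm (fun s => c * f s).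
Proof. by move=> lf; apply: lbmM => //; exact: lbm_cst. Qed.

Lemma lbmN f : lbm f -> lbm (fun s => - f s).
Proof.
move=> lf; have -> : (fun s => - f s) = (fun s => -1 * f s).
  by apply/funext => s; rewrite mulN1r.
exact: lbmZ.
Qed.

Lemma lbmB f g : lbm f -> lbm g -> lbm (fun s => f s - g s).
Proof. by move=> lf lg; apply: lbmD => //; exact: lbmN. Qed.

Lemma lbmX2 f : lbm f -> lbm (fun s => f s ^+ 2).
Proof. by move=> lf; have := lbmM lf lf; under eq_fun do rewrite -expr2. Qed.

Lemma lbm_norm f : lbm f -> lbm (fun s => `|f s|).
Proof.
move=> [mf bf]; split=> [|T]; first exact: measurableT_comp.
by have [M HM] := bf T; exists M => t tT; rewrite normr_id HM.
Qed.

Lemma lbm_sum (I : Type) (r : seq I) (F : I -> R -> R) :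
  (forall i, lbm (F i)) -> lbm (fun s => \sum_(i <- r) F i s).
Proof.
move=> lF; elim: r => [|i r IH].
  by under eq_fun do rewrite big_nil; exact: lbm_cst.
by under eq_fun do rewrite big_cons; exact: lbmD.
Qed.

Lemma lbm_bounded f M : measurable_fun [set: R] f -> (forall t, `|f t| <= M) -> lbm f.
Proof.
move=> mf bf; split; first exact: measurable_funTS.
by move=> T; exists M => t _.
Qed.

Definition cont0 f : Prop := {within `[0, +oo[, continuous f}.

Lemma cont0_sub f a b : 0 <= a -> cont0 f -> {within `[a, b], continuous f}.
Proof.
move=> a0; apply: continuous_subspaceW => x /=.
by rewrite !in_itv/= andbT => /andP[/(le_trans a0)].
Qed.

(** The explicit form avoids the subspace topology in continuity proofs. *)
Lemma cont0P f : cont0 f <-> (forall s, 0 <= s -> forall e : R, 0 < e ->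
  exists2 d : R, 0 < d & forall t, 0 <= t -> `|t - s| < d -> `|f t - f s| < e).
Proof.
split=> [/subspace_continuousP cf s s0 e e0|cf].
  have /cvgrPdist_lt/(_ e e0) := cf s (ltac:(by rewrite /= in_itv/= s0)).
  rewrite near_withinE => /nbhs_ballP[d /= d0 H].
  exists d => // t t0 ts; rewrite distrC; apply: H; rewrite /ball/= ?(distrC s)//.
  by rewrite in_itv/= t0.
apply/subspace_continuousP => s /=; rewrite in_itv/= andbT => s0.
apply/cvgrPdist_lt => e e0; have [d d0 H] := cf s s0 e e0.
rewrite near_withinE; apply/nbhs_ballP; exists d => //= t; rewrite /ball/= => ts.
by rewrite in_itv/= andbT => t0; rewrite distrC H// distrC.
Qed.

Lemma continuous_cont0 f : continuous f -> cont0 f.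
Proof. exact: continuous_subspaceT. Qed.

Lemma cont0D f g : cont0 f -> cont0 g -> cont0 (fun s => f s + g s).
Proof. by move=> cf cg x; apply: cvgD; [exact: cf|exact: cg]. Qed.

Lemma cont0M f g : cont0 f -> cont0 g -> cont0 (fun s => f s * g s).
Proof. by move=> cf cg x; apply: cvgM; [exact: cf|exact: cg]. Qed.

Lemma cont0_cst c : cont0 (fun _ => c).
Proof. by move=> x; exact: cvg_cst. Qed.

Lemma cont0Z c f : cont0 f -> cont0 (fun s => c * f s).
Proof. by move=> cf; apply: cont0M => //; exact: cont0_cst. Qed.

Lemma cont0B f g : cont0 f -> cont0 g -> cont0 (fun s => f s - g s).
Proof. by move=> cf cg x; apply: cvgB; [exact: cf|exact: cg]. Qed.

Lemma cont0_expR (c : R) : cont0 (fun s => expR (c * s)).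
Proof.
apply: continuous_cont0 => x; apply: (@continuous_comp _ _ _ (fun s : R => c * s) expR).
  by apply: cvgM; [exact: cvg_cst | exact: cvg_id].
exact: continuous_expR.
Qed.

Lemma cont0_lbm f : cont0 f -> lbm f.
Proof.
move=> cf; split; first exact: subspace_continuous_measurable_fun.
move=> T; have [T0|T0] := leP 0 T; last first.
  by exists 0 => t /andP[t0 tT]; move: (le_lt_trans (le_trans t0 tT) T0); rewrite ltxx.
have /compact_bounded[M [_ HM]] :=
  continuous_compact (cont0_sub (b := T) (lexx 0) cf) (@segment_compact _ 0 T).
exists (M + 1) => t tT; apply: (HM (M + 1)); first by rewrite ltrDl.
by exists t.
Qed.

Lemma cont0_uniform f T : cont0 f -> forall e : R, 0 < e -> exists2 d : R, 0 < d &
  forall s t, 0 <= s <= T -> 0 <= t <= T -> `|t - s| < d -> `|f t - f s| < e.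
Proof.
move=> /cont0P cf e e0.
have /compact_near_coveringP/(_ R (0^'+)
  (fun d s => s \in `[0, T]%R -> forall t, 0 <= t <= T -> `|t - s| < d -> `|f t - f s| < e)) :=
  @segment_compact R 0 T.
case.
  move=> x /=; rewrite in_itv/= => /andP[x0 xT].
  have [d d0 Hd] := cf x x0 (e / 2) (ltac:(by rewrite divr_gt0)).
  near=> s r => /= sT t /andP[t0 tT] ts.
  have sx : `|s - x| < d / 2.
    by near: s; exists (d / 2); [rewrite /= divr_gt0 | move=> s /=; rewrite distrC].
  have rd : r < d / 2.
    by near: r; apply: nbhs_right_lt; rewrite divr_gt0.
  have s0 : 0 <= s by move: sT; rewrite in_itv/= => /andP[].
  have -> : f t - f s = (f t - f x) - (f s - f x) by ring.
  have H1 : `|f s - f x| < e / 2 by apply: Hd => //; lra.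
  have H2 : `|f t - f x| < e / 2.
    apply: Hd => //; have -> : t - x = (t - s) + (s - x) by ring.
    by apply: le_lt_trans (ler_normD _ _) _; lra.
  by apply: le_lt_trans (ler_normB _ _) _; lra.
move=> d /= d0 Hd.
exists (d / 2) => [|s t sT tT ts]; first by rewrite divr_gt0.
apply: (Hd (d / 2)) => //=.
  rewrite sub0r normrN gtr0_norm ?divr_gt0//; lra.
  by rewrite divr_gt0.
Unshelve. all: by end_near. Qed.

Lemma IID a b f g : 0 <= a -> lbm f -> lbm g ->
  \I_[a, b] (fun s => f s + g s) = \I_[a, b] f + \I_[a, b] g.
Proof. by move=> a0 lf lg; rewrite RintegralD//; exact: lbm_integrable. Qed.

Lemma IIB a b f g : 0 <= a -> lbm f -> lbm g ->
  \I_[a, b] (fun s => f s - g s) = \I_[a, b] f - \I_[a, b] g.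
Proof. by move=> a0 lf lg; rewrite RintegralB//; exact: lbm_integrable. Qed.

Lemma IIZ a b c f : 0 <= a -> lbm f ->
  \I_[a, b] (fun s => c * f s) = c * \I_[a, b] f.
Proof. by move=> a0 lf; rewrite RintegralZl//; exact: lbm_integrable. Qed.

Lemma II_cst a b c : a <= b -> \I_[a, b] (fun _ => c) = c * (b - a).
Proof.
move=> ab; rewrite Rintegral_cst//= lebesgue_measure_itv/= lte_fin.
by case: ltgtP ab => // -> _ /=; rewrite subrr.
Qed.

Lemma II_le a b f g : 0 <= a -> lbm f -> lbm g ->
  (forall t, a <= t <= b -> f t <= g t) -> \I_[a, b] f <= \I_[a, b] g.
Proof.
move=> a0 lf lg fg; by apply: le_Rintegral => //; exact: lbm_integrable.
Qed.

Lemma II_eq a b f g : (forall t, a <= t <= b -> f t = g t) ->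
  \I_[a, b] f = \I_[a, b] g.
Proof.
by move=> fg; apply: eq_Rintegral => x; rewrite inE/= in_itv/= => /fg.
Qed.

Lemma II_ge0 a b f : (forall t, a <= t <= b -> 0 <= f t) -> 0 <= \I_[a, b] f.
Proof. by move=> f0; apply: Rintegral_ge0 => x /=; rewrite in_itv/= => /f0. Qed.

Lemma II_norm a b f : 0 <= a -> lbm f ->
  `|\I_[a, b] f| <= \I_[a, b] (fun s => `|f s|).
Proof. by move=> a0 lf; apply: le_normr_Rintegral => //; exact: lbm_integrable. Qed.

Lemma II_bound a b f M : 0 <= a -> a <= b -> lbm f ->
  (forall t, a <= t <= b -> `|f t| <= M) -> `|\I_[a, b] f| <= M * (b - a).
Proof.
move=> a0 ab lf fM; apply: le_trans (II_norm _ a0 lf) _.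
rewrite -II_cst//; apply: II_le => //; [exact: lbm_norm|exact: lbm_cst].
Qed.

Lemma II_same a f : \I_[a, a] f = 0.
Proof. by rewrite set_itv1 Rintegral_set1. Qed.

Lemma II_split a b c f : 0 <= a -> a <= b -> b <= c -> lbm f ->
  \I_[a, c] f = \I_[a, b] f + \I_[b, c] f.
Proof.
move=> a0 ab bc lf.
have := @Rintegral_itvB R f (BLeft a) (BRight c) b (lbm_integrable c a0 lf).
rewrite !bnd_simp => /(_ ab bc) H.
rewrite -(@Rintegral_itv_obnd_cbnd R b (BRight c) f); last first.
  apply: integrableS (lbm_integrable c (le_trans a0 ab) lf) => //.
  by apply: subset_itvr; rewrite bnd_simp.
by rewrite -H addrC subrK.
Qed.

Lemma II_nat (j k : nat) f : (j <= k)%N -> lbm f ->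
  \I_[j%:R, k%:R] f = \sum_(j <= i < k) \I_[i%:R, i.+1%:R] f.
Proof.
move=> jk lf; elim: k jk => [|k IH].
  by rewrite leqn0 => /eqP ->; rewrite II_same big_geq.
rewrite leq_eqVlt => /predU1P[->|jk]; first by rewrite II_same big_geq.
rewrite big_nat_recr//= -IH//; apply: II_split => //; by rewrite ler_nat.
Qed.

(** Weighted Cauchy-Schwarz: the quadratic polynomial l |-> int w (f - l)^2 is
    nonnegative, so its discriminant is not positive. *)
Lemma II_CS a b w f : 0 <= a -> lbm w -> lbm f ->
  (forall t, a <= t <= b -> 0 <= w t) ->
  (\I_[a, b] (fun s => w s * f s)) ^+ 2 <=
  \I_[a, b] w * \I_[a, b] (fun s => w s * f s ^+ 2).
Proof.
move=> a0 lw lf w0.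
set A := \I_[a, b] w; set S := \I_[a, b] _; set Q := \I_[a, b] _.
have lwf := lbmM lw lf; have lwf2 := lbmM lw (lbmX2 lf).
have key l : 0 <= Q - 2 * l * S + l ^+ 2 * A.
  have -> : Q - 2 * l * S + l ^+ 2 * A = \I_[a, b] (fun s => w s * (f s - l) ^+ 2).
    rewrite /Q /S /A -!IIZ// -IIB//; last exact: lbmZ.
    rewrite -IID//; [|by apply: lbmB => //; exact: lbmZ|exact: lbmZ].
    by apply: II_eq => t _; ring.
  by apply: II_ge0 => t tab; rewrite mulr_ge0 ?w0 ?sqr_ge0.
have A0 : 0 <= A by apply: II_ge0.
have [A00|A0'] := eqVneq A 0; last first.
  (* the minimum over l is reached at S / A *)
  have := key (S / A); have AP : 0 < A by rewrite lt_neqAle eq_sym A0'.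
  have -> : Q - 2 * (S / A) * S + (S / A) ^+ 2 * A = (A * Q - S ^+ 2) / A.
    by field.
  by rewrite pmulr_lge0 ?invr_gt0// subr_ge0.
rewrite A00 mul0r.
have [->|S0] := eqVneq S 0; first by rewrite expr0n.
(* the polynomial is affine when A = 0, hence constant: this value of l would make it negative *)
have := key ((Q + 1) / S); rewrite A00 mulr0 addr0.
have -> : Q - 2 * ((Q + 1) / S) * S = - Q - 2 by field.
have Q0 : 0 <= Q by apply: II_ge0 => t tab; rewrite mulr_ge0 ?w0 ?sqr_ge0.
lra.
Qed.

End LocallyBounded.

(** * Dyadic sums and the linear integral equation *)

Section Dyadic.
Variable R : realType.
Implicit Types (f g h : R -> R) (a b t s T : R) (m i j k : nat).

Definition dy m i : R := i%:R / 2 ^+ m.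

Lemma pow2_gt0 m : 0 < (2 : R) ^+ m.
Proof. by rewrite exprn_gt0. Qed.

Lemma dy_ge0 m i : 0 <= dy m i.
Proof. by rewrite divr_ge0// ltW// pow2_gt0. Qed.

Lemma dyS m i : dy m i.+1 = dy m i + (2 ^+ m)^-1.
Proof. by rewrite /dy -natr1 mulrDl mul1r. Qed.

Lemma dy_leS m i : dy m i <= dy m i.+1.
Proof. by rewrite dyS lerDl invr_ge0 ltW// pow2_gt0. Qed.

Lemma dy_le m i j : (i <= j)%N -> dy m i <= dy m j.
Proof. by move=> ij; rewrite ler_pM2r ?invr_gt0 ?pow2_gt0// ler_nat. Qed.

Lemma dy_nat m j : dy m (j * 2 ^ m)%N = j%:R.
Proof. by rewrite /dy natrM natrX mulfK// gt_eqF// pow2_gt0. Qed.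

Lemma dy_double m i : dy m.+1 (i.*2)%N = dy m i.
Proof. by rewrite /dy -muln2 natrM exprS invfM; field; rewrite gt_eqF ?pow2_gt0. Qed.

Lemma dy_itv m j k i : (j * 2 ^ m <= i < k * 2 ^ m)%N ->
  j%:R <= dy m i /\ dy m i.+1 <= k%:R.
Proof. by move=> /andP[ji ik]; rewrite -(dy_nat m j) -(dy_nat m k) !dy_le. Qed.

Lemma II_dy m (p q : nat) f : (p <= q)%N -> lbm f ->
  \I_[dy m p, dy m q] f = \sum_(p <= i < q) \I_[dy m i, dy m i.+1] f.
Proof.
move=> pq lf; elim: q pq => [|q IH].
  by rewrite leqn0 => /eqP ->; rewrite II_same big_geq.
rewrite leq_eqVlt => /predU1P[->|pq]; first by rewrite II_same big_geq.
rewrite big_nat_recr//= -IH//; apply: II_split => //; rewrite ?dy_ge0 ?dy_leS//.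
by rewrite dy_le.
Qed.

Lemma pow2_inv_cvg0 : (fun m => ((2 : R) ^+ m)^-1) @ \oo --> (0 : R).
Proof.
under eq_fun do rewrite -exprVn.
by apply: cvg_expr; rewrite gtr0_norm ?invf_lt1// ?ltr1n// invr_gt0.
Qed.

(** The f-values are frozen at the left ends of the cells; by uniform continuity
    of f the error is at most a small multiple of int |h|. *)
Lemma stieltjes_cvg f h j k : (j <= k)%N -> cont0 f -> lbm h ->
  (fun m => \sum_(j * 2 ^ m <= i < k * 2 ^ m)
              f (dy m i) * \I_[dy m i, dy m i.+1] h) @ \oo
  --> \I_[j%:R, k%:R] (fun s => f s * h s).
Proof.
move=> jk cf lh; have lf := cont0_lbm cf.
apply/cvgrPdist_le => e e0.
pose C := 1 + \I_[j%:R, k%:R] (fun s => `|h s|).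
have C0 : 0 < C by rewrite ltr_pwDl// II_ge0.
have [d d0 Hd] := cont0_uniform k%:R cf (divr_gt0 e0 C0).
have /cvgrPdist_lt/(_ d d0) := pow2_inv_cvg0; apply: filterS => m.
rewrite sub0r normrN gtr0_norm ?invr_gt0 ?pow2_gt0// => md.
have jk2 : (j * 2 ^ m <= k * 2 ^ m)%N by rewrite leq_mul2r jk orbT.
rewrite -(dy_nat m j) -(dy_nat m k) II_dy//; last exact: lbmM.
rewrite -sumrB; apply: le_trans (ler_norm_sum _ _ _) _.
apply: (@le_trans _ _ (\sum_(j * 2 ^ m <= i < k * 2 ^ m)
   e / C * \I_[dy m i, dy m i.+1] (fun s => `|h s|))).
  apply: ler_sum_nat => i ijk; have [ji ik] := dy_itv ijk.
  have i0 := dy_ge0 m i.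
  rewrite -IIZ// -IIB//; [|exact: lbmM|exact: lbmZ].
  rewrite -IIZ//; last exact: lbm_norm.
  apply: le_trans (II_norm _ i0 _) _.
    by apply: lbmB; [exact: lbmM|exact: lbmZ].
  apply: II_le => //; [apply: lbm_norm; apply: lbmB; [exact: lbmM|exact: lbmZ]|
    by apply: lbmZ; exact: lbm_norm|].
  move=> s /andP[is_ si]; rewrite -mulrBl normrM ler_wpM2r//.
  rewrite ltW// Hd//.
  - by rewrite i0 (le_trans (dy_leS m i) ik).
  - by rewrite (le_trans i0 is_) (le_trans si ik).
  - by rewrite ger0_norm ?subr_ge0//; move: si; rewrite dyS; lra.
rewrite -mulr_sumr -II_dy//; last exact: lbm_norm.
rewrite !dy_nat; set S := \I_[_, _] _.
have SC : C^-1 * S <= 1 by rewrite mulrC ler_pdivrMr// mul1r /C lerDr.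
by rewrite -mulrA ler_piMr// ltW.
Qed.

Lemma riemann_cvg f j k : (j <= k)%N -> cont0 f ->
  (fun m => \sum_(j * 2 ^ m <= i < k * 2 ^ m) f (dy m i) / 2 ^+ m) @ \oo
  --> \I_[j%:R, k%:R] f.
Proof.
move=> jk cf; have := stieltjes_cvg jk cf (lbm_cst 1).
rewrite (_ : \I_[_, _] (fun s => f s * 1) = \I_[j%:R, k%:R] f); last first.
  by apply: II_eq => t _; rewrite mulr1.
under [X in X @ _ --> _ -> _]eq_fun do
  under eq_bigr do rewrite II_cst ?dy_leS// dyS addrC addKr mul1r.
by [].
Qed.

Lemma II_cont h : lbm h -> cont0 (fun t => \I_[0, t] h).
Proof.
move=> lh; apply/cont0P => s s0 e e0.
have [M HM] := lh.2 (s + 1).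
have M0 : 0 <= M by apply: le_trans (HM 0 _); rewrite ?lexx ?addr_ge0.
exists (Num.min 1 (e / (M + 1))).
  by rewrite lt_min ltr01 divr_gt0// ltr_wpDl.
move=> t t0; rewrite lt_min => /andP[ts1 tse].
have Me : M * `|t - s| < e.
  apply: le_lt_trans (_ : (M + 1) * `|t - s| < e).
    by rewrite ler_wpM2r// lerDl.
  by rewrite mulrC -ltr_pdivlMr// ltr_wpDl.
apply: le_lt_trans Me.
have [st|ts] := leP s t.
  rewrite (II_split (lexx 0) s0 st lh) addrC addKr.
  rewrite [X in _ <= _ * X]ger0_norm ?subr_ge0//; apply: II_bound => // u /andP[su ut].
  by apply: HM; rewrite (le_trans s0 su)/=; move: ts1; rewrite ltr_norml => /andP[]; lra.
rewrite (II_split (lexx 0) t0 (ltW ts) lh) opprD addrA subrr sub0r normrN.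
rewrite (distrC t) [X in _ <= _ * X]ger0_norm; last by rewrite subr_ge0 ltW.
apply: II_bound => //; first exact: ltW.
move=> u /andP[tu us]; apply: HM; rewrite (le_trans t0 tu)/=; lra.
Qed.

End Dyadic.

Lemma derive1_expRM (R : realType) (c t : R) :
  derivable (fun s : R => expR (c * s)) t 1 /\
  derive1 (fun s : R => expR (c * s)) t = c * expR (c * t).
Proof.
have dc : is_derive t (1 : R) (fun s : R => c * s) c.
  have : is_derive t (1 : R) (c \*: @id R) (c *: 1) by exact: is_deriveZ.
  by rewrite [c *: 1]mulr1.
split.
  apply/derivable1_diffP.
  apply: (@differentiable_comp _ _ _ _ (fun s : R => c * s) expR).
    by apply/derivable1_diffP.
  by apply/derivable1_diffP; exact: derivable_expR.
rewrite (_ : (fun s => _) = expR \o (fun s : R => c * s))// derive1_comp//.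
  by rewrite !derive1E !derive_val mulrC.
Qed.

Section LinearODE.
Variable R : realType.
Variables (alpha : R) (L x b : R -> R).
Hypotheses (lL : lbm L) (cx : cont0 x) (cb : cont0 b).
Hypothesis eqn : forall t : R, 0 <= t ->
  x t = \I_[0, t] (fun s => L s + alpha * x s) + b t.

(** The part c of the equation x = c + alpha int x that does not involve x. *)
Definition forcing (t : R) : R := b t + \I_[0, t] L.

Lemma forcing_cont0 : cont0 forcing.
Proof. by apply: cont0D => //; exact: II_cont. Qed.

Lemma ode_forcing (t : R) : 0 <= t -> x t = forcing t + alpha * \I_[0, t] x.
Proof.
move=> t0; rewrite eqn// IID//; last by apply: lbmZ; exact: cont0_lbm.
by rewrite IIZ//; [rewrite /forcing; ring|exact: cont0_lbm].
Qed.

(** Integration by parts of e^(-alpha s) against y(s) = int_0^s x, with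
    forcing = y' - alpha y. Only the integral y of x is differentiated, so the forcing
    may be a Brownian path. *)
Lemma ode_integral (T : R) : 0 <= T ->
  \I_[0, T] (fun s => expR (- alpha * s) * forcing s) = expR (- alpha * T) * \I_[0, T] x.
Proof.
rewrite le_eqVlt => /predU1P[<-|T0]; first by rewrite !II_same mulr0.
have lx := cont0_lbm cx; have cF := @cont0_expR R (- alpha).
pose y (t : R) : R := \I_[0, t] x.
have cy : cont0 y := II_cont lx.
have dE := derive1_expRM (- alpha).
have dy t : t \in `]0, T[ -> derivable y t 1 /\ derive1 y t = x t.
  rewrite in_itv/= => /andP[t0 tT].
  apply: (continuous_FTC1_closed tT (lbm_integrable T (lexx 0) lx) t0).
  have t1 : 0 < t + 1 by exact: addr_gt0.
  apply: (within_continuous_continuous t1 (cont0_sub (lexx 0) cx)).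
  by rewrite in_itv/= t0 ltrDl ltr01.
have cdF : cont0 (fun s => - alpha * expR (- alpha * s)) by exact: cont0Z.
have LR f : cont0 f -> {in `]0, T[, forall t, derivable f t 1} ->
    derivable_oo_LRcontinuous f 0 T.
  move=> cf df; have /(continuous_within_itvP _ T0)[_ f0 fT] := cont0_sub (b := T) (lexx 0) cf.
  by split.
have := Rintegration_by_parts T0 (cont0_sub (lexx 0) cdF)
  (LR _ cF (fun t _ => (dE t).1)) (fun t _ => (dE t).2)
  (cont0_sub (lexx 0) cx) (LR _ cy (fun t tT => (dy t tT).1)) (fun t tT => (dy t tT).2).
rewrite {2}/y II_same mulr0 subr0 => /esym/eqP; rewrite subr_eq => /eqP ->.
rewrite -IID//; [|by apply: cont0_lbm; exact: cont0M|by apply: cont0_lbm; exact: cont0M].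
apply: II_eq => t /andP[t0 _]; rewrite (_ : forcing t = x t - alpha * y t).
  by ring.
by rewrite ode_forcing// addrK.
Qed.

(** The explicit solution of x = c + alpha int x; the growth of x is thus carried by
    the factor e^(alpha t) in front of a weighted integral of the forcing. *)
Lemma ode_solution (t : R) : 0 <= t ->
  x t = forcing t + alpha * expR (alpha * t) *
        \I_[0, t] (fun s => expR (- alpha * s) * forcing s).
Proof.
move=> t0; rewrite ode_forcing// ode_integral// !mulrA -[alpha * _ * _]mulrA -expRD.
by rewrite mulNr subrr expR0 mulr1.
Qed.

End LinearODE.

(** * Upper expectations *)

Section UpperExpectation.
Context (R : realType) (d : measure_display) (Omega : measurableType d).
Variable P : probability Omega R.
Implicit Types (f g : Omega -> R) (C : R).

(** The expectation of f is at most C, for f that need not be measurable: this is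
    a bound on the upper expectation of f. Read as a predicate in f and C it
    is monotone, additive, homogeneous and satisfies Fatou's lemma. *)
Definition Ele f C : Prop := exists g : Omega -> \bar R,
  [/\ measurable_fun [set: Omega] g, forall w, (0 <= g w)%E,
      (\int[P]_w g w <= C%:E)%E & {ae P, forall w, ((f w)%:E <= g w)%E}].

Lemma Ele_ge0 f C : Ele f C -> 0 <= C.
Proof.
by move=> [g [_ g0 gC _]]; rewrite -lee_fin (le_trans _ gC)// integral_ge0.
Qed.

Lemma Ele_le f f' C C' : {ae P, forall w, f w <= f' w} -> C' <= C ->
  Ele f' C' -> Ele f C.
Proof.
move=> ff' CC' [g [mg g0 gC fg]]; exists g; split => //.
  by rewrite (le_trans gC)// lee_fin.
by apply: filterS2 ff' fg => w H; apply: le_trans; rewrite lee_fin.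
Qed.

Lemma Ele_integral f C : measurable_fun [set: Omega] f -> (forall w, 0 <= f w) ->
  (\int[P]_w (f w)%:E <= C%:E)%E -> Ele f C.
Proof.
move=> mf f0 fC; exists (EFin \o f); split => //.
- exact/measurable_EFinP.
- exact: aeW.
Qed.

Lemma Ele_cst C : 0 <= C -> Ele (fun _ => C) C.
Proof.
move=> C0; apply: Ele_integral => //.
by have := integral_cst P measurableT C%:E; rewrite /cst/= probability_setT mule1 => ->.
Qed.

Lemma EleD f f' C C' : Ele f C -> Ele f' C' -> Ele (fun w => f w + f' w) (C + C').
Proof.
move=> [g [mg g0 gC fg]] [g' [mg' g'0 gC' fg']].
exists (fun w => g w + g' w)%E; split.
- exact: emeasurable_funD.
- by move=> w; rewrite adde_ge0.
- by rewrite ge0_integralD// EFinD leeD.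
- by apply: filterS2 fg fg' => w H H'; rewrite EFinD leeD.
Qed.

Lemma EleZ c f C : 0 <= c -> Ele f C -> Ele (fun w => c * f w) (c * C).
Proof.
move=> c0 [g [mg g0 gC fg]]; exists (fun w => c%:E * g w)%E; split.
- exact: measurable_funeM.
- by move=> w; rewrite mule_ge0.
- by rewrite ge0_integralZl// EFinM lee_wpmul2l// lee_fin.
- by apply: filterS fg => w H; rewrite EFinM lee_wpmul2l// lee_fin.
Qed.

Lemma Ele_sum (I : Type) (r : seq I) (F : I -> Omega -> R) (c : I -> R) :
  (forall i, Ele (F i) (c i)) ->
  Ele (fun w => \sum_(i <- r) F i w) (\sum_(i <- r) c i).
Proof.
move=> H; elim: r => [|i r IH].
  rewrite big_nil; apply: Ele_le (Ele_cst (lexx 0)) => //.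
  by apply: aeW => w; rewrite big_nil.
rewrite big_cons; apply: Ele_le (EleD (H i) IH) => //.
by apply: aeW => w; rewrite big_cons.
Qed.

Lemma limn_einf_ge (u : (\bar R)^nat) (x : \bar R) :
  (\forall n \near \oo, x <= u n)%E -> (x <= limn_einf u)%E.
Proof.
move=> [N _ HN]; rewrite limn_einf_lim.
have /cvg_lim -> // := @cvg_einfs_sup _ u.
apply: (@le_trans _ _ (einfs u N)); last by apply: ereal_sup_ubound; exists N.
by apply: le_ereal_inf_tmp => _ [m /= Nm <-]; exact: HN.
Qed.

Lemma limn_einf_le_cst (u : (\bar R)^nat) (x : \bar R) :
  (forall n, u n <= x)%E -> (limn_einf u <= x)%E.
Proof.
move=> H; rewrite limn_einf_lim.
have /cvg_lim -> // := @cvg_einfs_sup _ u.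
apply: ge_ereal_sup => _ [n _ <-]; apply: le_trans (H n).
by apply: ereal_inf_lbound; exists n => /=.
Qed.

(** Fatou's lemma for upper expectations: the lower limit of the measurable majorants is
    a measurable majorant of the limit. *)
Lemma Ele_fatou (F : nat -> Omega -> R) f C : (forall m, Ele (F m) C) ->
  {ae P, forall w, forall e, 0 < e -> \forall m \near \oo, f w <= F m w + e} ->
  Ele f C.
Proof.
move=> /choice[g Hg] fF.
exists (fun w => limn_einf (fun m => g m w)); split.
- apply: measurableT_comp => //; apply: measurable_fun_limn_esup => m.
  by apply: measurableT_comp => //; have [] := Hg m.
- move=> w; apply: limn_einf_ge; apply: nearW => m; by have [] := Hg m.
- apply: le_trans (fatou _ _ _ _) _ => //.
  + by move=> m; have [] := Hg m.
  + by move=> m w _; have [] := Hg m.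
  + by apply: limn_einf_le_cst => m; have [] := Hg m.
- have gall : {ae P, forall w, forall m, ((F m w)%:E <= g m w)%E}.
    by apply: ae_foralln => m; have [] := Hg m.
  apply: filterS2 fF gall => w H1 H2.
  apply/lee_addgt0Pr => e e0.
  have : ((f w - e)%:E <= limn_einf (fun m => g m w))%E.
    apply: limn_einf_ge; apply: filterS (H1 e e0) => m Hm.
    by apply: le_trans (H2 m); rewrite lee_fin lerBlDr.
  by rewrite EFinB leeBlDr.
Qed.

Lemma Ele_cvg (F : nat -> Omega -> R) f C : (forall m, Ele (F m) C) ->
  {ae P, forall w, (F^~ w) @ \oo --> f w} -> Ele f C.
Proof.
move=> HF; move=> Ff; apply: (Ele_fatou HF); apply: filterS Ff => w Fw e e0.
have /cvgrPdist_le/(_ e e0) := Fw; apply: filterS => m.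
by rewrite ler_norml => /andP[_]; rewrite lerBlDl.
Qed.

(** Borel-Cantelli in mean form: a series of nonnegative terms with summable
    expectations is almost surely finite, so its terms tend to 0. *)
Lemma Ele_series (F : nat -> Omega -> R) (c : nat -> R) K :
  (forall n, Ele (F n) (c n)) -> (forall n w, 0 <= F n w) ->
  (forall N, \sum_(0 <= n < N) c n <= K) ->
  {ae P, forall w, (F^~ w) @ \oo --> (0 : R)}.
Proof.
move=> HF F0 cK; have c0 n : 0 <= c n := Ele_ge0 (HF n).
move: HF => /choice[g Hg].
pose G w := (\sum_(n <oo) g n w)%E.
have mg n : measurable_fun setT (g n) by have [] := Hg n.
have g0 n w : (0 <= g n w)%E by have [] := Hg n.
have mG : measurable_fun [set: Omega] G.
  by apply: ge0_emeasurable_sum => // n w _ _; exact: g0.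
have GK : (\int[P]_w G w <= K%:E)%E.
  rewrite integral_nneseries//.
  apply: (@le_trans _ _ (\sum_(n <oo) (c n)%:E)%E).
    by apply: lee_nneseries => [n _ _|n _]; [exact: integral_ge0|have [] := Hg n].
  apply: lime_le; first by apply: is_cvg_nneseries => n _ _; rewrite lee_fin.
  by apply: nearW => N; rewrite sumEFin lee_fin.
have iG : P.-integrable setT G.
  apply/integrableP; split => //.
  under eq_integral do rewrite gee0_abs ?nneseries_ge0//.
  by rewrite (le_lt_trans GK)// ltry.
have Gfin := integrable_ae measurableT iG.
have gall : {ae P, forall w, forall m, ((F m w)%:E <= g m w)%E}.
  by apply: ae_foralln => m; have [] := Hg m.
apply: filterS2 Gfin gall => w /(_ I) Gw Fg.
apply: cvg_series_cvg_0; apply: nondecreasing_is_cvgn.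
  by apply: nondecreasing_series => n _ _; exact: F0.
exists (fine (G w)) => _ [N _ <-].
rewrite -lee_fin fineK// /series/= -sumEFin.
apply: (@le_trans _ _ (\sum_(0 <= n < N) g n w)%E); first by apply: lee_sum => n _.
by apply: nneseries_lim_ge => n _ _; exact: g0.
Qed.

(** Applying the previous lemma to the constant sequence f, with expectations
    bounded by 2^-n, shows that f is its own limit 0. *)
Lemma Ele_null f : (forall w, 0 <= f w) -> (forall e, 0 < e -> Ele f e) ->
  {ae P, forall w, f w = 0}.
Proof.
move=> f0 Hf.
have He (n : nat) : Ele ((fun _ => f) n) ((2 ^+ n)^-1 : R).
  by apply: Hf; rewrite invr_gt0 exprn_gt0.
have hK (N : nat) : \sum_(0 <= n < N) ((2 ^+ n)^-1 : R) <= 2.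
  have -> : \sum_(0 <= n < N) ((2 ^+ n)^-1 : R) = 2 - 2 / 2 ^+ N.
    elim: N => [|N IH]; first by rewrite big_geq// expr0; field.
    by rewrite big_nat_recr//= IH exprS; field; rewrite expf_neq0.
  by rewrite gerBl divr_ge0// exprn_ge0.
have := Ele_series He (fun _ => f0) hK; apply: filterS => w Hw.
by apply: (cvg_unique _ _ Hw); [exact: norm_hausdorff|exact: cvg_cst].
Qed.

End UpperExpectation.

(** * Growth of a solution path *)

Section ExpSums.
Variable R : realType.
Implicit Types (a c T : R) (n N j : nat).

Lemma sqr_le_exp a : 0 < a ->
  exists2 K : R, 0 < K & forall n, n.+1%:R ^+ 2 <= K * expR (a * n%:R).
Proof.
move=> a0; pose m := Num.min 1 (a / 2); have m0 : 0 < m by rewrite lt_min ltr01 divr_gt0.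
(* m (n + 1) <= 1 + (a / 2) n <= e^((a / 2) n), and the square is the claim *)
exists (m ^- 2) => [|n]; first by rewrite invr_gt0 exprn_gt0.
rewrite mulrC ler_pdivlMr ?exprn_gt0// -exprMn.
have -> : a * n%:R = (a / 2 * n%:R) *+ 2 by rewrite -mulr_natr; field.
rewrite -[X in expR X]mulr_natl expRM_natl lerXn2r ?nnegrE ?expR_ge0//; first by rewrite mulr_ge0 ?ltW.
apply: le_trans (expR_ge1Dx _).
rewrite -natr1 mulrDl mul1r mulrC addrC lerD ?ge_min ?lexx//.
by rewrite ler_wpM2r// ge_min lexx orbT.
Qed.

Lemma geo_sum_le (q : R) N : 0 <= q < 1 -> \sum_(0 <= j < N) q ^+ j <= (1 - q)^-1.
Proof.
move=> /andP[q0 q1]; have q1' : 0 < 1 - q by rewrite subr_gt0.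
have -> : \sum_(0 <= j < N) q ^+ j = (1 - q ^+ N) / (1 - q).
  elim: N => [|N IH]; first by rewrite big_geq// expr0 subrr mul0r.
  by rewrite big_nat_recr//= IH exprS; field; rewrite gt_eqF.
by rewrite ler_pdivrMr// mulVf ?gt_eqF// gerBl exprn_ge0.
Qed.

Lemma expRN_lt1 a : 0 < a -> 0 <= expR (- a) < 1.
Proof. by move=> a0; rewrite expR_ge0 expR_lt1 oppr_lt0. Qed.

Lemma sum_sqr_expN a : 0 < a -> exists2 K : R, 0 < K &
  forall N, \sum_(0 <= j < N) expR (- a * j%:R) * j.+1%:R ^+ 2 <= K.
Proof.
move=> a0; have a20 : 0 < a / 2 by rewrite divr_gt0.
have [K K0 HK] := sqr_le_exp a20; have /andP[q0 q1] := expRN_lt1 a20.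
exists (K * (1 - expR (- (a / 2)))^-1) => [|N].
  by rewrite mulr_gt0// invr_gt0 subr_gt0.
apply: le_trans (_ : \sum_(0 <= j < N) K * expR (- (a / 2)) ^+ j <= _); last first.
  rewrite -mulr_sumr; apply: ler_wpM2l; first exact: ltW.
  by apply: geo_sum_le; rewrite q0.
apply: ler_sum_nat => j _; rewrite -expRM_natl.
apply: le_trans (ler_wpM2l (expR_ge0 _) (HK j)) _.
by rewrite mulrCA -expRD le_eqVlt; apply/orP; left; apply/eqP; congr (_ * expR _); field.
Qed.

Lemma II_expR c T : 0 <= T -> c != 0 ->
  \I_[0, T] (fun s => expR (c * s)) = (expR (c * T) - 1) / c.
Proof.
rewrite le_eqVlt => /predU1P[<-|T0] c0; first by rewrite II_same mulr0 expR0 subrr mul0r.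
have cF := @cont0_expR R c; have cFc := @cont0Z R c _ cF.
have dE := derive1_expRM c.
have /(continuous_within_itvP _ T0)[_ F0 FT] := cont0_sub (b := T) (lexx 0) cF.
have H := continuous_FTC2 T0 (cont0_sub (lexx 0) cFc)
  (And3 (fun t _ => (dE t).1) F0 FT) (fun t _ => (dE t).2).
have : \I_[0, T] (fun s => c * expR (c * s)) = expR (c * T) - expR (c * 0).
  by rewrite /Rintegral H.
rewrite mulr0 expR0 IIZ//; last exact: cont0_lbm.
by move=> <-; rewrite mulrC mulKf.
Qed.

End ExpSums.

Lemma norm_le_1Dsqr (R : realFieldType) (a : R) : `|a| <= 1 + a ^+ 2.
Proof. by rewrite -real_normK ?num_real//; have := normr_ge0 a; nra. Qed.

Lemma sqrD_le2 (R : realFieldType) (a b : R) : (a + b) ^+ 2 <= 2 * a ^+ 2 + 2 * b ^+ 2.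
Proof. by have := sqr_ge0 (a - b); nra. Qed.

Section PathBounds.
Variables (R : realType) (alpha K : R) (L x b : R -> R).
Hypotheses (alpha0 : 0 < alpha) (lL : lbm L) (LK : forall t, `|L t| <= K).
Hypotheses (cx : cont0 x) (cb : cont0 b).
Hypothesis eqn : forall t : R, 0 <= t ->
  x t = \I_[0, t] (fun s => L s + alpha * x s) + b t.

Local Notation c := (forcing L b).
Local Notation E n := (expR (alpha * n%:R)).

(** The weighted integral of the forcing c; csq and bsq are the energies of c and
    of the driving path b over unit intervals, and Qsum is the discrete analogue of
    int_0^n e^(-alpha s) c(s)^2 ds that bounds both eta and the energy of x. *)
Definition eta (t : R) : R := \I_[0, t] (fun s => expR (- alpha * s) * c s).
Definition csq (j : nat) : R := \I_[j%:R, j.+1%:R] (fun s => c s ^+ 2).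
Definition bsq (j : nat) : R := \I_[j%:R, j.+1%:R] (fun s => b s ^+ 2).
Definition Qsum (n : nat) : R := \sum_(0 <= j < n) expR (- alpha * j%:R) * csq j.

Lemma eta_at0 : eta 0 = 0. Proof. exact: II_same. Qed.

Lemma K_ge0 : 0 <= K. Proof. exact: le_trans (normr_ge0 _) (LK 0). Qed.

Lemma lbm_c : lbm c.
Proof. by apply: cont0_lbm; exact: forcing_cont0. Qed.

Lemma lbm_ec a : lbm (fun s => expR (a * s) * c s).
Proof. by apply: lbmM lbm_c; apply: cont0_lbm; exact: cont0_expR. Qed.

Lemma csq_ge0 j : 0 <= csq j.
Proof. by apply: II_ge0 => t _; exact: sqr_ge0. Qed.

Lemma bsq_ge0 j : 0 <= bsq j.
Proof. by apply: II_ge0 => t _; exact: sqr_ge0. Qed.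

Lemma Qsum_ge0 n : 0 <= Qsum n.
Proof. by apply: sumr_ge0 => j _; rewrite mulr_ge0 ?expR_ge0 ?csq_ge0. Qed.

Lemma c_sqr_le t : 0 <= t -> c t ^+ 2 <= 2 * b t ^+ 2 + 2 * (K * t) ^+ 2.
Proof.
move=> t0; apply: le_trans (sqrD_le2 _ _) _; rewrite lerD2l ler_pM2l//.
rewrite -[X in X <= _]real_normK ?num_real// lerXn2r ?nnegrE ?mulr_ge0 ?K_ge0//.
by have := II_bound (lexx 0) t0 lL (fun t _ => LK t); rewrite subr0.
Qed.

Lemma csq_le j : csq j <= 2 * bsq j + 2 * K ^+ 2 * j.+1%:R ^+ 2.
Proof.
have lb2 := lbmX2 (cont0_lbm cb).
apply: le_trans (_ : \I_[j%:R, j.+1%:R] (fun s => 2 * b s ^+ 2 + 2 * (K * j.+1%:R) ^+ 2) <= _).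
  apply: II_le => //; first exact/lbmX2/lbm_c.
    by apply: lbmD; [exact: lbmZ|exact: lbm_cst].
  move=> t /andP[jt tj]; have t0 : 0 <= t by apply: le_trans jt; rewrite ler0n.
  apply: le_trans (c_sqr_le t0) _; rewrite lerD2l ler_pM2l//.
  rewrite lerXn2r ?nnegrE ?mulr_ge0 ?K_ge0//.
  by rewrite ler_wpM2l// K_ge0.
rewrite IID//; [|exact: lbmZ|exact: lbm_cst].
rewrite II_cst ?ler_nat// IIZ// lerD2l.
have -> : j.+1%:R - j%:R = 1 :> R by rewrite -natr1; ring.
by rewrite mulr1 exprMn mulrA.
Qed.

Lemma Ic2_le n : \I_[0, n%:R] (fun s => c s ^+ 2) <= E n * Qsum n.
Proof.
have lc2 := lbmX2 lbm_c.
have -> : (0 : R) = 0%:R by []. rewrite II_nat// mulr_sumr.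
apply: ler_sum_nat => j /andP[_ jn]; rewrite mulrA -expRD ler_peMl ?csq_ge0//.
have jn' := ltnW jn; rewrite -[X in X <= _]expR0 ler_expR mulNr -mulrBr.
by apply: mulr_ge0; [exact: ltW|rewrite subr_ge0 ler_nat].
Qed.

Lemma Iec2_le t n : 0 <= t <= n%:R ->
  \I_[0, t] (fun s => expR (- alpha * s) * c s ^+ 2) <= Qsum n.
Proof.
move=> /andP[t0 tn].
have le : lbm (fun s => expR (- alpha * s)) by apply: cont0_lbm; exact: cont0_expR.
have lc2 := lbmX2 lbm_c; have lec := lbmM le lc2.
apply: le_trans (_ : \I_[0, n%:R] (fun s => expR (- alpha * s) * c s ^+ 2) <= _).
  rewrite (II_split (lexx 0) t0 tn lec) lerDl.
  by apply: II_ge0 => s _; rewrite mulr_ge0 ?expR_ge0 ?sqr_ge0.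
have {1}-> : (0 : R) = 0%:R by []. rewrite II_nat//.
apply: ler_sum_nat => j _; rewrite -IIZ//.
apply: II_le => //; first exact: lbmZ.
move=> s /andP[js _]; rewrite ler_wpM2r ?sqr_ge0// ler_expR !mulNr lerN2.
by rewrite ler_wpM2l// ltW.
Qed.

(** Cauchy-Schwarz with the weight e^(-alpha s), whose total mass is at
    most 1 / alpha. *)
Lemma eta_sqr t n : 0 <= t <= n%:R -> eta t ^+ 2 <= Qsum n / alpha.
Proof.
move=> tn; have /andP[t0 _] := tn.
have le : lbm (fun s => expR (- alpha * s)) by apply: cont0_lbm; exact: cont0_expR.
apply: le_trans (II_CS (lexx 0) le lbm_c _) _; first by move=> s _; exact: expR_ge0.
rewrite [leRHS]mulrC; apply: ler_pM; last exact: Iec2_le.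
- by apply: II_ge0 => s _; exact: expR_ge0.
- by apply: II_ge0 => s _; rewrite mulr_ge0 ?expR_ge0 ?sqr_ge0.
- rewrite II_expR ?oppr_eq0 ?gt_eqF// invrN mulrN -mulNr opprB.
  by apply: ler_piMl; [rewrite invr_ge0 ltW|rewrite gerBl expR_ge0].
Qed.

Lemma x_eta t : 0 <= t -> x t = c t + alpha * expR (alpha * t) * eta t.
Proof. exact: ode_solution. Qed.

Lemma expR2 t : expR (2 * alpha * t) = expR (alpha * t) ^+ 2.
Proof. by rewrite -expRM_natl mulrA. Qed.

(** The bound is linear in the energies csq, hence can be integrated over the
    probability space without any control of the path beyond second moments. *)
Lemma Ix2_le n : \I_[0, n%:R] (fun s => x s ^+ 2) <= 3 * E n ^+ 2 * Qsum n.
Proof.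
have lc2 := lbmX2 lbm_c; have lx := cont0_lbm cx.
have le : lbm (fun s => expR (2 * alpha * s)) by apply: cont0_lbm; exact: cont0_expR.
apply: le_trans (_ : \I_[0, n%:R] (fun s => 2 * c s ^+ 2 +
    2 * alpha * Qsum n * expR (2 * alpha * s)) <= _).
  apply: II_le => //; first exact: lbmX2.
    by apply: lbmD; exact: lbmZ.
  move=> t tn; have /andP[t0 _] := tn; rewrite x_eta//.
  apply: le_trans (sqrD_le2 _ _) _; rewrite lerD2l !exprMn expR2.
  have -> : 2 * (alpha ^+ 2 * expR (alpha * t) ^+ 2 * eta t ^+ 2) =
    2 * alpha ^+ 2 * expR (alpha * t) ^+ 2 * eta t ^+ 2 by ring.
  have -> : 2 * alpha * Qsum n * expR (alpha * t) ^+ 2 =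
    2 * alpha ^+ 2 * expR (alpha * t) ^+ 2 * (Qsum n / alpha).
    by field; rewrite gt_eqF.
  apply: ler_wpM2l; last exact: eta_sqr.
  by rewrite !mulr_ge0 ?exprn_ge0 ?expR_ge0 ?(ltW alpha0).
rewrite IID//; [|exact: lbmZ..]; rewrite !IIZ//.
rewrite II_expR//; last by rewrite mulf_neq0// ?gt_eqF// pnatr_eq0.
have En1 : 1 <= E n by rewrite -[X in X <= _]expR0 ler_expR mulr_ge0// (ltW alpha0).
have := Ic2_le n; have := Qsum_ge0 n; rewrite expR2.
have -> : 2 * alpha * Qsum n * ((E n ^+ 2 - 1) / (2 * alpha)) = Qsum n * (E n ^+ 2 - 1).
  by field; rewrite gt_eqF.
have Q0 := Qsum_ge0 n; move=> _ Ic.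
have : E n * Qsum n <= E n ^+ 2 * Qsum n.
  by rewrite ler_wpM2r// expr2 ler_peMl// expR_ge0.
by move: Ic Q0; lra.
Qed.

End PathBounds.

Lemma cvg_nat_bounded (R : realType) (u : nat -> R) (l : R) :
  u @ \oo --> l -> exists2 C : R, 0 < C & forall n, `|u n| <= C.
Proof.
move=> /cvgP/cvg_seq_bounded[M [_ HM]].
exists (`|M| + 1) => [|n]; first by rewrite ltr_wpDl.
by apply: HM => //; rewrite (le_lt_trans (ler_norm _))// ltrDl.
Qed.

Lemma nat_ge (R : realType) (t : R) : exists n : nat, t <= n%:R.
Proof. by exists (Num.bound `|t|); rewrite (le_trans (ler_norm _))// ltW//; exact: archi_boundP. Qed.

Lemma succn_subr (R : realType) (j : nat) : j.+1%:R - j%:R = 1 :> R.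
Proof. by rewrite -natr1; ring. Qed.

Section PathAsymptotics.
Variables (R : realType) (alpha K : R) (L x b : R -> R).
Hypotheses (alpha0 : 0 < alpha) (lL : lbm L) (LK : forall t, `|L t| <= K).
Hypotheses (cx : cont0 x) (cb : cont0 b).
Hypothesis eqn : forall t : R, 0 <= t ->
  x t = \I_[0, t] (fun s => L s + alpha * x s) + b t.

Local Notation c := (forcing L b).
Local Notation E n := (expR (alpha * n%:R)).
Local Notation eta := (eta alpha L b).
Local Notation csq := (csq L b).
Local Notation bsq := (bsq b).
Local Notation Qsum := (Qsum alpha L b).

Hypothesis hW : (fun j => bsq j / j.+1%:R ^+ 2) @ \oo --> (0 : R).

Lemma expNE n : expR (- alpha * n%:R) * E n = 1.
Proof. by rewrite -expRD mulNr addNr expR0. Qed.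

Lemma E_ge1 n : 1 <= E n.
Proof. by rewrite -[X in X <= _]expR0 ler_expR mulr_ge0 ?(ltW alpha0). Qed.

Lemma II_norm_le_1Dsqr (f : R -> R) (j : nat) : lbm f ->
  \I_[j%:R, j.+1%:R] (fun s => `|f s|) <= 1 + \I_[j%:R, j.+1%:R] (fun s => f s ^+ 2).
Proof.
move=> lf; apply: le_trans (_ : \I_[j%:R, j.+1%:R] (fun s => 1 + f s ^+ 2) <= _).
  apply: II_le => //; [exact: lbm_norm|apply: lbmD; [exact: lbm_cst|exact: lbmX2]|].
  by move=> t _; exact: norm_le_1Dsqr.
rewrite IID//; [|exact: lbm_cst|exact: lbmX2].
by rewrite II_cst ?ler_nat// succn_subr mulr1.
Qed.

Lemma bsq_bound : exists2 C : R, 0 < C & forall j, bsq j <= C * j.+1%:R ^+ 2.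
Proof.
have [C C0 HC] := cvg_nat_bounded hW; exists C => // j.
by rewrite -ler_pdivrMr ?exprn_gt0// (le_trans (ler_norm _) (HC j)).
Qed.

Lemma csq_bound : exists2 C : R, 0 < C & forall j, csq j <= C * j.+1%:R ^+ 2.
Proof.
have [C C0 HC] := bsq_bound; exists (2 * C + 2 * K ^+ 2) => [|j].
  by rewrite ltr_pwDl ?mulr_gt0// mulr_ge0 ?sqr_ge0.
apply: le_trans (csq_le lL LK cb j) _; rewrite (mulrDl (2 * C)) lerD2r -mulrA ler_pM2l//.
Qed.

(** Quadratic growth is all that is asked of the energies: exponential weights
    make it summable. *)
Lemma wsum_bound (w : nat -> R) C : 0 < C -> (forall j, w j <= C * j.+1%:R ^+ 2) ->
  exists2 M : R, 0 < M & forall n, \sum_(0 <= j < n) expR (- alpha * j%:R) * w j <= M.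
Proof.
move=> C0 HC; have [M M0 HM] := sum_sqr_expN alpha0.
exists (C * M) => [|n]; first exact: mulr_gt0.
apply: le_trans (_ : C * \sum_(0 <= j < n) expR (- alpha * j%:R) * j.+1%:R ^+ 2 <= _).
  rewrite mulr_sumr; apply: ler_sum_nat => j _.
  by rewrite mulrCA ler_wpM2l ?expR_ge0.
by rewrite ler_wpM2l// ltW.
Qed.

Lemma Qsum_bound : exists2 M : R, 0 < M & forall n, Qsum n <= M.
Proof. by have [C C0 HC] := csq_bound; exact: wsum_bound C0 HC. Qed.

Lemma eta_bound : exists2 M : R, 0 < M & forall t : R, 0 <= t -> `|eta t| <= M.
Proof.
have [Q Q0 HQ] := Qsum_bound; exists (1 + Q / alpha) => [|t t0].
  by rewrite ltr_pwDl// divr_ge0 ?ltW.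
have [n tn] := nat_ge t.
apply: le_trans (norm_le_1Dsqr _) _; rewrite lerD2l.
apply: le_trans (_ : _ <= Qsum n / alpha) _; first by apply: eta_sqr => //; rewrite t0.
by rewrite ler_pM2r ?invr_gt0.
Qed.

Lemma x_bound : exists2 M : R, 0 < M &
  forall t : R, 0 <= t -> `|x t| <= `|c t| + M * expR (alpha * t).
Proof.
have [H H0 HH] := eta_bound; exists (alpha * H) => [|t t0]; first exact: mulr_gt0.
rewrite (x_eta lL cx eqn t0) (le_trans (ler_normD _ _))// lerD2l.
rewrite !normrM (gtr0_norm alpha0) (gtr0_norm (expR_gt0 _)) mulrAC.
by rewrite ler_wpM2r ?expR_ge0// ler_wpM2l ?HH// ltW.
Qed.

Lemma n_le_E n : n%:R <= E n / alpha.
Proof.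
rewrite ler_pdivlMr// mulrC; apply: le_trans (expR_ge1Dx _).
by rewrite lerDr.
Qed.

Lemma Iexp_le n : \I_[0, n%:R] (fun s => expR (alpha * s)) <= E n / alpha.
Proof.
by rewrite II_expR ?gt_eqF// ler_pM2r ?invr_gt0// gerBl.
Qed.

Lemma Iabsc_le : exists2 C : R, 0 < C & forall n, \I_[0, n%:R] (fun s => `|c s|) <= C * E n.
Proof.
have [Q Q0 HQ] := Qsum_bound; have lc := lbm_c lL cb.
exists (alpha^-1 + Q) => [|n]; first by rewrite addr_gt0 ?invr_gt0.
apply: le_trans (_ : \I_[0, n%:R] (fun s => 1 + c s ^+ 2) <= _).
  apply: II_le => //; [exact: lbm_norm|apply: lbmD; [exact: lbm_cst|exact: lbmX2]|].
  by move=> t _; exact: norm_le_1Dsqr.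
rewrite IID//; [|exact: lbm_cst|exact: lbmX2].
rewrite II_cst// mul1r subr0 mulrDl lerD//; first by rewrite mulrC n_le_E.
apply: le_trans (Ic2_le alpha0 lL cb n) _.
by rewrite mulrC ler_wpM2r ?expR_ge0.
Qed.

Lemma Iabsx_le : exists2 C : R, 0 < C & forall n, \I_[0, n%:R] (fun s => `|x s|) <= C * E n.
Proof.
have [M M0 HM] := x_bound; have [C C0 HC] := Iabsc_le; have lc := lbm_c lL cb.
have le : lbm (fun s => expR (alpha * s)) by apply: cont0_lbm; exact: cont0_expR.
exists (C + M / alpha) => [|n]; first by rewrite addr_gt0 ?divr_gt0.
apply: le_trans (_ : \I_[0, n%:R] (fun s => `|c s| + M * expR (alpha * s)) <= _).
  apply: II_le => //; [exact/lbm_norm/cont0_lbm|apply: lbmD; [exact: lbm_norm|exact: lbmZ]|].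
  by move=> t /andP[t0 _]; exact: HM.
rewrite IID//; [|exact: lbm_norm|exact: lbmZ]; rewrite IIZ// mulrDl lerD//.
by rewrite -mulrA ler_pM2l// mulrC Iexp_le.
Qed.

Let r j := expR (- alpha * j%:R) * (1 + csq j).

Lemma r_ge0 j : 0 <= r j.
Proof. by rewrite mulr_ge0 ?expR_ge0// addr_ge0 ?csq_ge0. Qed.

Lemma r_sum : exists2 M : R, 0 < M & forall n, \sum_(0 <= j < n) r j <= M.
Proof.
have [C C0 HC] := csq_bound; apply: (@wsum_bound _ (1 + C)); first by rewrite addr_gt0.
move=> j; rewrite mulrDl mul1r lerD// -[X in X <= _](expr1n _ 2) lerXn2r ?nnegrE//.
by rewrite ler1n.
Qed.

Lemma r_series : cvgn (series r).
Proof.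
have [M _ HM] := r_sum; apply: nondecreasing_is_cvgn.
  by apply: nondecreasing_series => n _ _; exact: r_ge0.
by exists M => _ [n _ <-]; exact: HM.
Qed.

Lemma r_cvg0 : r @ \oo --> (0 : R).
Proof. exact: cvg_series_cvg_0 r_series. Qed.

(** The oscillation of eta over a unit interval is bounded by a summable sequence:
    this gives convergence along the integers, and control in between. *)
Lemma eta_osc (j : nat) (t : R) : j%:R <= t <= j.+1%:R -> `|eta t - eta j%:R| <= r j.
Proof.
move=> /andP[jt tj]; have lc := lbm_c lL cb.
have j0 : 0 <= j%:R :> R by [].
have lec := lbm_ec lL cb (- alpha).
rewrite /eta (II_split (lexx 0) j0 jt lec) addrAC subrr add0r.
apply: le_trans (II_norm _ j0 lec) _.
apply: le_trans (_ : \I_[j%:R, j.+1%:R] (fun s => expR (- alpha * j%:R) * `|c s|) <= _).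
  apply: le_trans (_ : \I_[j%:R, t] (fun s => expR (- alpha * j%:R) * `|c s|) <= _).
    apply: II_le => //; [exact: lbm_norm|by apply: lbmZ; exact: lbm_norm|].
    move=> s /andP[js _]; rewrite normrM (gtr0_norm (expR_gt0 _)) ler_wpM2r//.
    by rewrite ler_expR !mulNr lerN2 ler_wpM2l// ltW.
  rewrite (II_split j0 jt tj); last by apply: lbmZ; exact: lbm_norm.
  by rewrite lerDl; apply: II_ge0 => s _; rewrite mulr_ge0 ?expR_ge0.
rewrite IIZ//; last exact: lbm_norm.
by rewrite ler_wpM2l ?expR_ge0// II_norm_le_1Dsqr.
Qed.

Lemma eta_cvg : cvgn (fun n => eta n%:R).
Proof.
have -> : (fun n => eta n%:R) = series (fun j => eta j.+1%:R - eta j%:R).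
  by apply/funext => n; rewrite /series/= telescope_sumr// eta_at0 subr0.
apply: normed_cvg; apply: (series_le_cvg _ _ _ r_series) => j //=.
- exact: r_ge0.
- by apply: eta_osc; rewrite lexx andbT ler_nat.
Qed.

(** When eta has a nonzero limit, x is close to alpha e^(alpha t) l. A lower
    bound for the last unit interval before n suffices. *)
Lemma Ix2_ge (l : R) : (fun n => eta n%:R) @ \oo --> l -> l != 0 ->
  exists2 k : R, 0 < k & \forall n \near \oo,
    k * E n ^+ 2 <= \I_[0, n%:R] (fun s => x s ^+ 2).
Proof.
move=> etal l0; have lc := lbm_c lL cb; have lx2 := lbmX2 (cont0_lbm cx).
(* near n, |eta| >= |l| / 2 gives (x - c)^2 >= 2 k0 E^2, and x^2 >= (x - c)^2 / 2 - c^2 *)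
pose k0 := alpha ^+ 2 * l ^+ 2 / 8.
have k00 : 0 < k0 by rewrite divr_gt0// mulr_gt0// ?exprn_even_gt0//= ?l0 ?gt_eqF.
have al : 0 < `|l| / 4 by rewrite divr_gt0// normr_gt0.
exists (k0 / 2 * expR (- alpha) ^+ 2) => [|].
  by apply: mulr_gt0; [exact: divr_gt0|exact/exprn_gt0/expR_gt0].
have /cvgrPdist_lt/(_ _ al) H1 := etal.
have /cvgrPdist_lt/(_ _ al) H2 := r_cvg0.
have k20 : 0 < k0 / 2 by rewrite divr_gt0.
have /cvgrPdist_lt/(_ _ k20) H3 := r_cvg0.
suff H : \forall n \near \oo, k0 / 2 * E n ^+ 2 <= \I_[0, n.+1%:R] (fun s => x s ^+ 2).
  case: H => N _ HN; exists N.+1 => //= -[//|n] Nn.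
  apply: le_trans (HN n Nn); rewrite -mulrA ler_pM2l// -exprMn -expRD.
  rewrite le_eqVlt; apply/orP; left; apply/eqP; congr (expR _ ^+ 2).
  by rewrite -natr1; ring.
near=> n.
have h1 : `|l - eta n%:R| < `|l| / 4 by near: n.
have h2 : `|0 - r n| < `|l| / 4 by near: n.
have h3 : `|0 - r n| < k0 / 2 by near: n.
move: h2 h3; rewrite !sub0r !normrN !(ger0_norm (r_ge0 n)) => h2 h3.
have n0 : 0 <= n%:R :> R by [].
rewrite (II_split (lexx 0) n0 _ lx2) ?ler_nat//.
apply: le_trans (_ : \I_[n%:R, n.+1%:R] (fun s => x s ^+ 2) <= _); last first.
  by rewrite lerDr; apply: II_ge0 => s _; exact: sqr_ge0.
have key t : n%:R <= t <= n.+1%:R -> k0 * E n ^+ 2 - c t ^+ 2 <= x t ^+ 2.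
  move=> tn; have /andP[nt _] := tn; have t0 : 0 <= t := le_trans n0 nt.
  rewrite (x_eta lL cx eqn t0); set u := alpha * _ * _.
  have hosc := eta_osc tn.
  have et : `|l| / 2 <= `|eta t|.
    have G1 := ler_normD (l - eta n%:R) (eta n%:R); rewrite subrK in G1.
    have G2 := ler_normB (eta t) (eta t - eta n%:R); rewrite subKr in G2.
    lra.
  have et2 : l ^+ 2 / 4 <= eta t ^+ 2.
    have -> : l ^+ 2 / 4 = (`|l| / 2) ^+ 2 by rewrite exprMn real_normK ?num_real//; field.
    rewrite -[leRHS]real_normK ?num_real// lerXn2r ?nnegrE// divr_ge0//.
  have u2 : 2 * k0 * E n ^+ 2 <= u ^+ 2.
    rewrite /u !exprMn /k0.
    have -> : 2 * (alpha ^+ 2 * l ^+ 2 / 8) * E n ^+ 2 = alpha ^+ 2 * (E n ^+ 2 * (l ^+ 2 / 4)) by field.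
    rewrite -mulrA ler_wpM2l ?sqr_ge0// ler_pM ?sqr_ge0 ?divr_ge0 ?sqr_ge0//.
    by rewrite lerXn2r ?nnegrE ?expR_ge0// ler_expR ler_wpM2l// ltW.
  have := sqr_ge0 (2 * c t + u); nra.
apply: le_trans (_ : \I_[n%:R, n.+1%:R] (fun t => k0 * E n ^+ 2 - c t ^+ 2) <= _); last first.
  by apply: II_le => //; apply: lbmB; [exact: lbm_cst|exact: lbmX2].
rewrite IIB//; [|exact: lbm_cst|exact: lbmX2].
rewrite II_cst ?ler_nat// succn_subr mulr1 -/(csq n).
have rE : csq n <= r n * E n.
  by rewrite /r mulrAC expNE mul1r lerDr.
have : r n * E n <= k0 / 2 * E n ^+ 2.
  rewrite expr2 mulrA ler_wpM2r ?expR_ge0//.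
  apply: le_trans (ltW h3) _; rewrite ler_peMr ?E_ge1// ltW//.
by move=> h; move: (le_trans rE h); lra.
Unshelve. all: by end_near. Qed.

End PathAsymptotics.

Section Sequences.
Variable R : realType.
Implicit Types (u v : nat -> R).

Lemma squeeze0 u v : (\forall n \near \oo, `|u n| <= v n) ->
  v @ \oo --> (0 : R) -> u @ \oo --> (0 : R).
Proof.
move=> uv /cvgrPdist_le v0; apply/cvgrPdist_le => e e0.
near=> n; rewrite sub0r normrN.
have h1 : `|u n| <= v n by near: n.
have h2 : `|0 - v n| <= e by near: n; exact: v0.
rewrite sub0r normrN in h2.
by apply: le_trans h1 (le_trans (ler_norm _) h2).
Unshelve. all: by end_near. Qed.

Lemma cvg0Z C u : u @ \oo --> (0 : R) -> (fun n => C * u n) @ \oo --> (0 : R).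
Proof. by move=> u0; rewrite -[X in _ --> X](mulr0 C); apply: cvgM => //; exact: cvg_cst. Qed.

Lemma cvg0D u v : u @ \oo --> (0 : R) -> v @ \oo --> (0 : R) ->
  (fun n => u n + v n) @ \oo --> (0 : R).
Proof. by move=> u0 v0; rewrite -[X in _ --> X](addr0 0); apply: cvgD. Qed.

Lemma cvg0_norm u : u @ \oo --> (0 : R) -> (fun n => `|u n|) @ \oo --> (0 : R).
Proof. by move=> u0; rewrite -[X in _ --> X](normr0 R); apply: cvg_norm. Qed.

Lemma cvg0_sum (I : Type) (r : seq I) (F : I -> nat -> R) :
  (forall i, F i @ \oo --> (0 : R)) ->
  (fun n => \sum_(i <- r) F i n) @ \oo --> (0 : R).
Proof.
move=> H; elim: r => [|i r IH].
  by under eq_fun do rewrite big_nil; exact: cvg_cst.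
by under eq_fun do rewrite big_cons; exact: cvg0D.
Qed.

Lemma cvg0_inv : (fun n : nat => (n%:R)^-1 : R) @ \oo --> (0 : R).
Proof.
rewrite -(cvg_shiftS (fun n : nat => (n%:R)^-1 : R)).
exact: cvg_harmonic.
Qed.

(** The averages y satisfy y(n + 1) = q (y(n) + w(n)), a contraction with a
    vanishing perturbation. *)
Lemma exp_average (q : R) (w : nat -> R) : 0 < q < 1 -> (forall n, 0 <= w n) ->
  w @ \oo --> (0 : R) ->
  (fun n => \sum_(0 <= j < n) q ^+ (n - j) * w j) @ \oo --> (0 : R).
Proof.
move=> /andP[q0 q1] w0 wc; set y := fun n => _.
have yS n : y n.+1 = q * (y n + w n).
  rewrite /y big_nat_recr//= subSnn expr1 mulrDr; congr (_ + _).
  rewrite mulr_sumr; apply: eq_big_nat => j /andP[_ jn].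
  by rewrite subSn ?(ltnW jn)// exprS mulrA.
have y0 n : 0 <= y n by apply: sumr_ge0 => j _; rewrite mulr_ge0 ?exprn_ge0 ?(ltW q0).
have q1' : 0 < 1 - q by rewrite subr_gt0.
apply/cvgrPdist_le => e e0.
(* the fixed point of y = q (y + e') is e / 2 *)
pose e' := e / 2 * (1 - q) / q.
have e'0 : 0 < e' by rewrite divr_gt0// mulr_gt0// divr_gt0.
have /cvgrPdist_le/(_ e' e'0)[N _ HN] := wc.
have wN n : (N <= n)%N -> w n <= e'.
  by move=> /HN /=; rewrite sub0r normrN ger0_norm.
have key k : y (N + k)%N <= q ^+ k * y N + e / 2.
  elim: k => [|k IH]; first by rewrite addn0 expr0 mul1r lerDl divr_ge0// ltW.
  rewrite addnS yS.
  have h : y (N + k)%N + w (N + k)%N <= q ^+ k * y N + e / 2 + e'.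
    by rewrite lerD// wN// leq_addr.
  apply: le_trans (ler_wpM2l (ltW q0) h) _; rewrite exprS /e'.
  by rewrite le_eqVlt; apply/orP; left; apply/eqP; field; rewrite gt_eqF.
have qc : (fun k => q ^+ k * y N) @ \oo --> (0 : R).
  rewrite -[X in _ --> X](mul0r (y N)); apply: cvgM; last exact: cvg_cst.
  by apply: cvg_expr; rewrite gtr0_norm.
have e20 : 0 < e / 2 by rewrite divr_gt0.
have /cvgrPdist_le/(_ _ e20)[M _ HM] := qc.
exists (N + M)%N => // n /= nNM.
rewrite sub0r normrN ger0_norm//.
have Nn : (N <= n)%N by apply: leq_trans nNM; rewrite leq_addr.
rewrite -(subnKC Nn) (le_trans (key _))// [leRHS]splitr lerD2r.
have /HM /= : (M <= n - N)%N by rewrite leq_subRL.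
by rewrite sub0r normrN ger0_norm// mulr_ge0// exprn_ge0// ltW.
Qed.

End Sequences.

Section PathRemainder.
Variables (R : realType) (alpha K : R) (L x b : R -> R).
Hypotheses (alpha0 : 0 < alpha) (lL : lbm L) (LK : forall t, `|L t| <= K).
Hypotheses (cx : cont0 x) (cb : cont0 b).
Hypothesis eqn : forall t : R, 0 <= t ->
  x t = \I_[0, t] (fun s => L s + alpha * x s) + b t.

Local Notation c := (forcing L b).
Local Notation E n := (expR (alpha * n%:R)).
Local Notation bsq := (bsq b).

Hypothesis hW : (fun j => bsq j / j.+1%:R ^+ 2) @ \oo --> (0 : R).
Hypothesis hb : (fun n : nat => b n%:R / n%:R) @ \oo --> (0 : R).

(** The size o(n e^(alpha n)): what is allowed for the noise of int X dX, since
    it is compared with a denominator of order e^(2 alpha n) and then multiplied by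
    Lambda = O(e^(alpha n) / n). *)
Definition negl (u : nat -> R) : Prop :=
  (fun n : nat => u n / (n%:R * E n)) @ \oo --> (0 : R).

Lemma negl_bound u v C : (\forall n \near \oo, `|u n| <= v n * C * E n) ->
  (fun n : nat => v n / n%:R) @ \oo --> (0 : R) -> negl u.
Proof.
move=> uv v0; apply: (squeeze0 _ (cvg0Z C v0)).
near=> n.
have n0 : 0 < n%:R :> R by rewrite ltr0n; near: n; exists 1%N.
rewrite normrM normfV (ger0_norm (mulr_ge0 (ler0n _ _) (expR_ge0 _))).
rewrite ler_pdivrMr ?mulr_gt0 ?expR_gt0//.
have -> : C * (v n / n%:R) * (n%:R * E n) = v n * C * E n by field; rewrite gt_eqF.
by near: n.
Unshelve. all: by end_near. Qed.

Lemma neglD u v : negl u -> negl v -> negl (fun n => u n + v n).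
Proof.
by move=> hu hv; have := cvg0D hu hv; rewrite /negl; under eq_fun do rewrite -mulrDl.
Qed.

Lemma neglZ C u : negl u -> negl (fun n => C * u n).
Proof.
by move=> hu; have := cvg0Z C hu; rewrite /negl; under eq_fun do rewrite mulrA.
Qed.

Lemma negl_le u v : (forall n, `|u n| <= v n) -> negl v -> negl u.
Proof.
move=> uv; apply: squeeze0; apply: nearW => n.
by rewrite normrM normfV (ger0_norm (mulr_ge0 (ler0n _ _) (expR_ge0 _)))
  ler_wpM2r// invr_ge0 mulr_ge0 ?expR_ge0.
Qed.

Lemma negl_exp u C : (forall n, `|u n| <= C * E n) -> negl u.
Proof.
move=> H; apply: (@negl_bound _ (fun => 1) C).
  by apply: nearW => n; rewrite mul1r.
by under eq_fun do rewrite mul1r; exact: cvg0_inv.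
Qed.

Lemma Ib2_exp : exists2 C : R, 0 < C &
  forall n, \I_[0, n%:R] (fun s => b s ^+ 2) <= C * E n.
Proof.
have [C C0 HC] := bsq_bound hW; have [M M0 HM] := wsum_bound alpha0 C0 HC.
exists M => // n; have lb2 := lbmX2 (cont0_lbm cb).
have -> : (0 : R) = 0%:R by []. rewrite II_nat//.
apply: le_trans (_ : E n * \sum_(0 <= j < n) expR (- alpha * j%:R) * bsq j <= _).
  rewrite mulr_sumr; apply: ler_sum_nat => j /andP[_ jn].
  rewrite mulrA -expRD ler_peMl ?bsq_ge0//.
  have jn' := ltnW jn; rewrite -[X in X <= _]expR0 ler_expR mulNr -mulrBr.
  by apply: mulr_ge0; [exact: ltW|rewrite subr_ge0 ler_nat].
by rewrite mulrC ler_wpM2r ?expR_ge0.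
Qed.

Lemma Iabsb_negl : negl (fun n => \I_[0, n%:R] (fun s => `|b s|)).
Proof.
have [C C0 HC] := Ib2_exp; have lb := cont0_lbm cb.
apply: (@negl_exp _ (alpha^-1 + C)) => n.
rewrite ger0_norm; last exact: II_ge0.
apply: le_trans (_ : \I_[0, n%:R] (fun s => 1 + b s ^+ 2) <= _).
  apply: II_le => //; [exact: lbm_norm|apply: lbmD; [exact: lbm_cst|exact: lbmX2]|].
  by move=> t _; exact: norm_le_1Dsqr.
rewrite IID//; [|exact: lbm_cst|exact: lbmX2].
by rewrite II_cst// mul1r subr0 mulrDl lerD// mulrC n_le_E.
Qed.

Lemma Iabsbc_negl : negl (fun n => \I_[0, n%:R] (fun s => `|b s| * `|c s|)).
Proof.
have [C C0 HC] := Ib2_exp; have lb := cont0_lbm cb; have lc := lbm_c lL cb.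
have [Q Q0 HQ] := Qsum_bound alpha0 lL LK cb hW.
apply: (@negl_exp _ (C + Q)) => n.
rewrite ger0_norm; last by apply: II_ge0 => t _; rewrite mulr_ge0.
apply: le_trans (_ : \I_[0, n%:R] (fun s => b s ^+ 2 + c s ^+ 2) <= _).
  apply: II_le => //; [by apply: lbmM; exact: lbm_norm|by apply: lbmD; exact: lbmX2|].
  move=> t _; rewrite -[b t ^+ 2]real_normK ?num_real// -[c t ^+ 2]real_normK ?num_real//.
  by have := normr_ge0 (b t); have := normr_ge0 (c t); have := sqr_ge0 (`|b t| - `|c t|); nra.
rewrite IID//; [|exact: lbmX2..]; rewrite mulrDl lerD//.
apply: le_trans (Ic2_le alpha0 lL cb n) _.
by rewrite mulrC ler_wpM2r ?expR_ge0.
Qed.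

Let v j := \I_[j%:R, j.+1%:R] (fun s => `|b s|).

Lemma v_ge0 j : 0 <= v j. Proof. exact: II_ge0. Qed.

Lemma v_cvg0 : (fun j => v j / j.+1%:R) @ \oo --> (0 : R).
Proof.
have lb := cont0_lbm cb; have lab := lbm_norm lb.
apply/cvgrPdist_le => e e0.
have e20 : 0 < e ^+ 2 by rewrite exprn_gt0.
have /cvgrPdist_le/(_ _ e20) := hW; apply: filterS => j.
rewrite !sub0r !normrN !ger0_norm ?divr_ge0 ?exprn_ge0 ?v_ge0 ?bsq_ge0//.
rewrite ler_pdivrMr ?exprn_gt0// ler_pdivrMr// => H.
rewrite -(@ler_pXn2r _ 2)// ?nnegrE ?v_ge0 ?mulr_ge0 ?(ltW e0)//.
rewrite exprMn; apply: le_trans H.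
have := II_CS (b := j.+1%:R) (ler0n R j) (lbm_cst 1) lab (fun _ _ => ler01).
rewrite II_cst ?ler_nat// succn_subr mulr1 mul1r.
rewrite (II_eq (g := fun s => `|b s|)); last by move=> t _; rewrite mul1r.
rewrite (II_eq (f := fun s => 1 * `|b s| ^+ 2) (g := fun s => b s ^+ 2))//.
by move=> t _; rewrite mul1r real_normK ?num_real.
Qed.

(** After division by n e^(alpha n) this is at most an exponentially weighted average of
    the null sequence v(j) / (j + 1), where v(j) is the integral of |b| over
    [j, j + 1]. *)
Lemma Ibexp_negl : negl (fun n => \I_[0, n%:R] (fun s => `|b s| * expR (alpha * s))).
Proof.
have lb := cont0_lbm cb; have lab := lbm_norm lb.
have le : lbm (fun s => expR (alpha * s)) by apply: cont0_lbm; exact: cont0_expR.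
have lbe := lbmM lab le.
pose q := expR (- alpha).
have q01 : 0 < q < 1 by rewrite expR_gt0 expR_lt1 oppr_lt0.
have w0 j : 0 <= v j / j.+1%:R by rewrite divr_ge0 ?v_ge0.
have := cvg0Z (expR alpha) (exp_average q01 w0 v_cvg0).
apply: squeeze0; near=> n.
have n0 : 0 < n%:R :> R by rewrite ltr0n; near: n; exists 1%N.
rewrite ger0_norm; last first.
  by rewrite divr_ge0 ?mulr_ge0 ?expR_ge0//; apply: II_ge0 => t _; rewrite mulr_ge0 ?expR_ge0.
rewrite ler_pdivrMr ?mulr_gt0 ?expR_gt0//.
have {1}-> : (0 : R) = 0%:R by []. rewrite II_nat//.
rewrite mulr_sumr mulr_suml; apply: ler_sum_nat => j /andP[_ jn].
apply: le_trans (_ : expR (alpha * j.+1%:R) * v j <= _).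
  rewrite /v -IIZ//; apply: II_le => //; first exact: lbmZ.
  move=> t /andP[_ tj]; rewrite mulrC ler_wpM2r// ler_expR.
  by rewrite ler_wpM2l// ltW.
have -> : expR alpha * (q ^+ (n - j) * (v j / j.+1%:R)) * (n%:R * E n) =
   expR (alpha * j.+1%:R) * v j * (n%:R / j.+1%:R).
  rewrite /q -expRM_natl natrB ?(ltnW jn)//.
  have -> : expR (alpha * j.+1%:R) = expR alpha * expR ((n%:R - j%:R) * - alpha) * E n.
    by rewrite -!expRD; congr expR; rewrite -natr1; ring.
  by field; rewrite addrC natr1.
rewrite ler_peMr ?mulr_ge0 ?expR_ge0 ?v_ge0//.
by rewrite ler_pdivlMr// mul1r ler_nat.
Unshelve. all: by end_near. Qed.

(** The terms that bound the noise of int X dX in the Young case. Each is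
    controlled by |X - b| = O(e^(alpha n)) and by b(n) = o(n), or by the mean growth
    of b over unit intervals. *)
Lemma path_remainder : negl (fun n =>
  `|x n%:R - b n%:R| * `|b n%:R| + b n%:R ^+ 2 / 2 +
  \I_[0, n%:R] (fun s => `|b s| * `|L s + alpha * x s|)).
Proof.
have lb := cont0_lbm cb; have lab := lbm_norm lb; have lx := cont0_lbm cx.
have lc := lbm_c lL cb; have lac := lbm_norm lc.
have le : lbm (fun s => expR (alpha * s)) by apply: cont0_lbm; exact: cont0_expR.
have ldr : lbm (fun s => L s + alpha * x s) by apply: lbmD => //; exact: lbmZ.
have [C C0 HC] := Iabsx_le alpha0 lL LK cx cb eqn hW.
have [M M0 HM] := x_bound alpha0 lL LK cx cb eqn hW.
have hb' := cvg0_norm hb.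
have hb2 : (fun n : nat => `|b n%:R| / n%:R) @ \oo --> (0 : R).
  move: hb'; under eq_fun do rewrite normrM normfV (ger0_norm (ler0n _ _)).
  exact.
have K0 := K_ge0 LK.
apply: neglD; first apply: neglD.
- apply: (@negl_bound _ (fun n => `|b n%:R|) (K / alpha + alpha * C)) => //.
  apply: nearW => n; rewrite ger0_norm ?mulr_ge0// mulrC -mulrA ler_wpM2l//.
  rewrite eqn// addrK; apply: le_trans (II_norm _ (lexx 0) ldr) _.
  apply: le_trans (_ : \I_[0, n%:R] (fun s => K + alpha * `|x s|) <= _).
    apply: II_le => //; first exact: lbm_norm.
      by apply: lbmD; [exact: lbm_cst|apply: lbmZ; exact: lbm_norm].
    move=> t _; rewrite (le_trans (ler_normD _ _))// lerD// normrM.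
    by rewrite (gtr0_norm alpha0).
  rewrite IID//; [|exact: lbm_cst|by apply: lbmZ; exact: lbm_norm].
  rewrite II_cst// IIZ//; last exact: lbm_norm.
  rewrite subr0 mulrDl lerD//.
    by rewrite mulrAC -mulrA ler_wpM2l// n_le_E.
  by rewrite -mulrA ler_wpM2l// ltW.
- have [B B0 HB] := cvg_nat_bounded hb2.
  apply: (@negl_bound _ (fun n => `|b n%:R|) (B / alpha)) => //.
  near=> n; have n0 : 0 < n%:R :> R by rewrite ltr0n; near: n; exists 1%N.
  rewrite ger0_norm ?divr_ge0 ?sqr_ge0//.
  apply: le_trans (_ : b n%:R ^+ 2 <= _); first by rewrite ler_pdivrMr// ler_peMr ?sqr_ge0// ler1n.
  rewrite -real_normK ?num_real// expr2 -mulrA ler_wpM2l//.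
  apply: le_trans (_ : B * n%:R <= _); last by rewrite mulrAC -mulrA ler_wpM2l ?(ltW B0)// n_le_E.
  rewrite -ler_pdivrMr//; apply: le_trans (HB n); exact: ler_norm.
- apply: (@negl_le _ (fun n => K * \I_[0, n%:R] (fun s => `|b s|) +
     (alpha * \I_[0, n%:R] (fun s => `|b s| * `|c s|) +
      alpha * M * \I_[0, n%:R] (fun s => `|b s| * expR (alpha * s))))).
    move=> n; rewrite ger0_norm; last by apply: II_ge0 => t _; rewrite mulr_ge0.
    rewrite -!IIZ//; [|exact: lbmM..].
    rewrite -IID//; [|by apply: lbmZ; exact: lbmM..].
    rewrite -IID//; [|exact: lbmZ|by apply: lbmD; apply: lbmZ; exact: lbmM].
    apply: II_le => //; first by apply: lbmM => //; exact: lbm_norm.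
      apply: lbmD; first exact: lbmZ.
      by apply: lbmD; apply: lbmZ; exact: lbmM.
    move=> t /andP[t0 _].
    have -> : K * `|b t| + (alpha * (`|b t| * `|c t|) + alpha * M * (`|b t| * expR (alpha * t)))
      = `|b t| * (K + alpha * (`|c t| + M * expR (alpha * t))) by ring.
    rewrite ler_wpM2l// (le_trans (ler_normD _ _))// lerD// normrM (gtr0_norm alpha0).
    by rewrite ler_wpM2l ?(ltW alpha0)// HM.
  apply: neglD; first by apply: neglZ; exact: Iabsb_negl.
  by apply: neglD; apply: neglZ; [exact: Iabsbc_negl|exact: Ibexp_negl].
Unshelve. all: by end_near. Qed.

End PathRemainder.

(** * The estimator along one path *)

Section Estimator.
Variables (R : realType) (p : nat) (mu : 'rV[R]_p) (alpha M : R).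
Variables (phi : 'I_p -> R -> R) (x b : R -> R).
Hypotheses (alpha0 : 0 < alpha) (mphi : forall i, measurable_fun [set: R] (phi i)).
Hypothesis bphi : forall i t, `|phi i t| <= M.
Hypothesis horth : forall (n : nat) i j,
  \I_[0, n%:R] (fun s => phi i s * phi j s) = n%:R * (i == j)%:R.
Hypotheses (cx : cont0 x) (cb : cont0 b).
Hypothesis eqn : forall t : R, 0 <= t -> x t = \I_[0, t] (drift mu alpha phi x) + b t.

Local Notation L := (mean_fun mu phi).
Local Notation E n := (expR (alpha * n%:R)).

Lemma phi_lbm i : lbm (phi i).
Proof. by apply: lbm_bounded => //; exact: bphi. Qed.

Lemma mean_lbm : lbm L.
Proof. by apply: lbm_sum => i; apply: lbmZ; exact: phi_lbm. Qed.

Definition mean_sup : R := \sum_(i < p) `|mu ord0 i| * M.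

Lemma mean_bound t : `|L t| <= mean_sup.
Proof.
apply: le_trans (ler_norm_sum _ _ _) _; apply: ler_sum => i _.
by rewrite normrM ler_wpM2l.
Qed.

Lemma drift_lbm : lbm (drift mu alpha phi x).
Proof. by apply: lbmD; [exact: mean_lbm|apply: lbmZ; exact: cont0_lbm]. Qed.

Variables (Iphi : nat -> 'I_p -> R) (IX : nat -> R) (l : R).

Definition noise_phi n k : R := Iphi n k - \I_[0, n%:R] (fun s => phi k s * drift mu alpha phi x s).
Definition noise_x n : R := IX n - \I_[0, n%:R] (fun s => x s * drift mu alpha phi x s).

Hypothesis hW : (fun j => bsq b j / j.+1%:R ^+ 2) @ \oo --> (0 : R).
Hypothesis hN : forall k, (fun n => noise_phi n k / n%:R) @ \oo --> (0 : R).
Hypothesis hM : negl alpha noise_x.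
Hypothesis heta : (fun n : nat => eta alpha L b n%:R) @ \oo --> l.
Hypothesis l0 : l != 0.

Let Iphx n i := \I_[0, n%:R] (fun s => phi i s * x s).
Let D n := \I_[0, n%:R] (fun s => x s ^+ 2) - n%:R * \sum_(i < p) Lambda phi n x i ^+ 2.
Let delta n := (noise_x n - \sum_(k < p) Lambda phi n x k * noise_phi n k) / D n.

Lemma Iphi_noise n k : (0 < n)%N -> Iphi n k =
  n%:R * mu ord0 k + alpha * (n%:R * Lambda phi n x k) + noise_phi n k.
Proof.
move=> n0; have lp := phi_lbm; have lx := cont0_lbm cx.
have n0' : n%:R != 0 :> R by rewrite pnatr_eq0 -lt0n.
rewrite /noise_phi /Lambda mulVKf// addrC.
suff -> : \I_[0, n%:R] (fun s => phi k s * drift mu alpha phi x s) =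
   n%:R * mu ord0 k + alpha * Iphx n k by rewrite subrK.
rewrite (II_eq (g := fun s => \sum_(i < p) mu ord0 i * (phi k s * phi i s) +
   alpha * (phi k s * x s))); last first.
  move=> s _; rewrite /drift /mean_fun mulrDr mulr_sumr mulrCA; congr (_ + _).
  by apply: eq_bigr => i _; rewrite mulrCA.
rewrite IID//; [|by apply: lbm_sum => i; apply: lbmZ; exact: lbmM|by apply: lbmZ; exact: lbmM].
rewrite IIZ//; last exact: lbmM; congr (_ + _).
have sumE (r : seq 'I_p) : \I_[0, n%:R] (fun s => \sum_(i <- r) mu ord0 i * (phi k s * phi i s)) =
   \sum_(i <- r) mu ord0 i * \I_[0, n%:R] (fun s => phi k s * phi i s).
  elim: r => [|i r IH].
    by rewrite big_nil (II_eq (g := fun _ => 0)) ?II_cst ?mul0r// => s _; rewrite big_nil.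
  rewrite big_cons -IH -IIZ//; last exact: lbmM.
  rewrite -IID//; [|by apply: lbmZ; exact: lbmM|by apply: lbm_sum => j; apply: lbmZ; exact: lbmM].
  by apply: II_eq => s _; rewrite big_cons.
rewrite sumE (bigD1 k)//= horth eqxx mulr1 big1 ?addr0 1?mulrC// => i ik.
by rewrite horth eq_sym (negbTE ik) !mulr0.
Qed.

Lemma IX_noise n : (0 < n)%N -> IX n =
  \sum_(k < p) mu ord0 k * (n%:R * Lambda phi n x k) +
  alpha * \I_[0, n%:R] (fun s => x s ^+ 2) + noise_x n.
Proof.
move=> n0; have lp := phi_lbm; have lx := cont0_lbm cx.
have n0' : n%:R != 0 :> R by rewrite pnatr_eq0 -lt0n.
rewrite /noise_x addrC.
under eq_bigr do rewrite /Lambda mulVKf//.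
suff -> : \I_[0, n%:R] (fun s => x s * drift mu alpha phi x s) =
  \sum_(k < p) mu ord0 k * Iphx n k + alpha * \I_[0, n%:R] (fun s => x s ^+ 2) by rewrite subrK.
rewrite (II_eq (g := fun s => \sum_(i < p) mu ord0 i * (phi i s * x s) +
   alpha * x s ^+ 2)); last first.
  move=> s _; rewrite /drift /mean_fun mulrDr mulr_sumr mulrCA -expr2; congr (_ + _).
  by apply: eq_bigr => i _; rewrite mulrCA [x s * _]mulrC.
rewrite IID//; [|by apply: lbm_sum => i; apply: lbmZ; exact: lbmM|by apply: lbmZ; exact: lbmX2].
rewrite IIZ//; last exact: lbmX2; congr (_ + _).
elim: (index_enum _) => [|i r IH].
  by rewrite big_nil (II_eq (g := fun _ => 0)) ?II_cst ?mul0r// => s _; rewrite big_nil.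
rewrite big_cons -IH -IIZ//; last exact: lbmM.
rewrite -IID//; [|by apply: lbmZ; exact: lbmM|by apply: lbm_sum => j; apply: lbmZ; exact: lbmM].
by apply: II_eq => s _; rewrite big_cons.
Qed.

Lemma gammaE n : (0 < n)%N -> gamma phi n x / n%:R = (D n)^-1.
Proof.
move=> n0; have n0' : n%:R != 0 :> R by rewrite pnatr_eq0 -lt0n.
rewrite /gamma -invfM; congr (_^-1).
by rewrite /D mulrBl mulrAC mulVf// mul1r [X in _ - X]mulrC.
Qed.

(** The signal part of the numerator of alpha_hat is exactly alpha times its
    denominator: the mean terms cancel by orthogonality. *)
Lemma numE n : (0 < n)%N -> IX n - \sum_(k < p) Lambda phi n x k * Iphi n k =
  alpha * D n + (noise_x n - \sum_(k < p) Lambda phi n x k * noise_phi n k).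
Proof.
move=> n0; rewrite IX_noise//.
rewrite (_ : \sum_(k < p) Lambda phi n x k * Iphi n k =
   \sum_(k < p) (Lambda phi n x k * (n%:R * mu ord0 k) +
     Lambda phi n x k * (alpha * (n%:R * Lambda phi n x k)) +
     Lambda phi n x k * noise_phi n k)); last first.
  by apply: eq_bigr => k _; rewrite Iphi_noise//; ring.
rewrite !big_split/= /D.
have -> : \sum_(i < p) Lambda phi n x i * (n%:R * mu ord0 i) =
  \sum_(i < p) mu ord0 i * (n%:R * Lambda phi n x i).
  by apply: eq_bigr => i _; ring.
have -> : \sum_(i < p) Lambda phi n x i * (alpha * (n%:R * Lambda phi n x i)) =
  alpha * (n%:R * \sum_(i < p) Lambda phi n x i ^+ 2).
  by rewrite mulrA mulr_sumr; apply: eq_bigr => i _; ring.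
ring.
Qed.

Lemma alpha_hatE n : (0 < n)%N -> D n != 0 ->
  alpha_hat phi n x (Iphi n) (IX n) = alpha + delta n.
Proof.
move=> n0 D0; rewrite /alpha_hat gammaE// numE// mulrDr mulrCA mulVf// mulr1.
by rewrite /delta mulrC.
Qed.

Lemma mu_hatE n i : (0 < n)%N -> D n != 0 ->
  mu_hat phi n x (Iphi n) (IX n) ord0 i =
  mu ord0 i + noise_phi n i / n%:R - Lambda phi n x i * delta n.
Proof.
move=> n0 D0; have n0' : n%:R != 0 :> R by rewrite pnatr_eq0 -lt0n.
have dE : gamma phi n x / n%:R * (IX n - \sum_(k < p) Lambda phi n x k * Iphi n k) = alpha + delta n.
  exact: alpha_hatE.
rewrite mxE; set S := \sum_(k < p) _ in dE *.
have -> : n%:R^-1 * (Iphi n i + gamma phi n x * Lambda phi n x i * S - gamma phi n x * Lambda phi n x i * IX n)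
  = Iphi n i / n%:R - Lambda phi n x i * (gamma phi n x / n%:R * (IX n - S)) by ring.
by rewrite dE Iphi_noise//; field.
Qed.

Lemma Lambda_bound : exists2 C : R, 0 < C & forall n i, n%:R * `|Lambda phi n x i| <= C * E n.
Proof.
have lp := phi_lbm; have lx := cont0_lbm cx.
have [C C0 HC] := Iabsx_le alpha0 mean_lbm mean_bound cx cb eqn hW.
exists ((`|M| + 1) * C) => [|n i]; first by rewrite mulr_gt0// ltr_wpDl.
have [->|n0] := posnP n.
  by rewrite mul0r !mulr_ge0 ?addr_ge0 ?expR_ge0// ltW.
have n0' : 0 < n%:R :> R by rewrite ltr0n.
rewrite /Lambda normrM normfV (gtr0_norm n0') mulVKf ?gt_eqF//.
apply: le_trans (II_norm _ (lexx 0) (lbmM (lp i) lx)) _.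
apply: le_trans (_ : \I_[0, n%:R] (fun s => (`|M| + 1) * `|x s|) <= _).
  apply: II_le => //; [by apply: lbm_norm; exact: lbmM|by apply: lbmZ; exact: lbm_norm|].
  move=> s _; rewrite normrM ler_wpM2r// (le_trans (bphi _ _))//.
  by rewrite (le_trans (ler_norm _))// lerDl.
by rewrite IIZ//; [rewrite -mulrA ler_wpM2l ?addr_ge0|exact: lbm_norm].
Qed.

(** The projection term n sum Lambda^2 is O(e^(2 alpha n) / n), hence of lower
    order than the energy of x. *)
Lemma D_ge : exists2 k : R, 0 < k & \forall n \near \oo, k * E n ^+ 2 <= D n.
Proof.
have [k k0 Hk] := Ix2_ge alpha0 mean_lbm mean_bound cx cb eqn hW heta l0.
have [C C0 HC] := Lambda_bound.
exists (k / 2) => [|]; first by rewrite divr_gt0.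
have H0 := cvg0Z (p%:R * C ^+ 2) (@cvg0_inv R).
have k20 : 0 < k / 2 by rewrite divr_gt0.
have /cvgrPdist_le/(_ _ k20) H1 := H0.
near=> n.
have n0 : 0 < n%:R :> R by rewrite ltr0n; near: n; exists 1%N.
have h1 : k * E n ^+ 2 <= \I_[0, n%:R] (fun s => x s ^+ 2) by near: n.
have h2 : `|0 - p%:R * C ^+ 2 / n%:R| <= k / 2 by near: n.
rewrite sub0r normrN ger0_norm in h2; last first.
  by apply: divr_ge0; [apply: mulr_ge0; [exact: ler0n|exact: sqr_ge0]|exact: ltW].
have h3 : n%:R * \sum_(i < p) Lambda phi n x i ^+ 2 <= p%:R * C ^+ 2 / n%:R * E n ^+ 2.
  apply: le_trans (_ : n%:R * \sum_(i < p) (C * E n / n%:R) ^+ 2 <= _).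
    rewrite ler_wpM2l//; apply: ler_sum => i _.
    rewrite -real_normK ?num_real// lerXn2r ?nnegrE ?divr_ge0 ?mulr_ge0 ?expR_ge0 ?(ltW C0)//.
    by rewrite ler_pdivlMr// mulrC.
  rewrite sumr_const card_ord -[_ *+ p]mulr_natl le_eqVlt; apply/orP; left; apply/eqP.
  by field; rewrite gt_eqF.
have h4 : p%:R * C ^+ 2 / n%:R * E n ^+ 2 <= k / 2 * E n ^+ 2.
  by rewrite ler_wpM2r// exprn_ge0// expR_ge0.
rewrite /D; lra.
Unshelve. all: by end_near. Qed.

(** The error of alpha_hat is so small that it tends to 0 even after
    multiplication by Lambda, which is of order e^(alpha n) / n. *)
Lemma delta_negl : (fun n => E n / n%:R * delta n) @ \oo --> (0 : R).
Proof.
have [k k0 Hk] := D_ge; have [C C0 HC] := Lambda_bound.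
pose g n := k^-1 * (`|noise_x n / (n%:R * E n)| + C * \sum_(i < p) `|noise_phi n i / n%:R|).
have g0 : g @ \oo --> (0 : R).
  apply: cvg0Z; apply: cvg0D; first exact: cvg0_norm.
  by apply: cvg0Z; apply: cvg0_sum => i; exact: cvg0_norm.
apply: squeeze0 g0; near=> n.
have n0 : 0 < n%:R :> R by rewrite ltr0n; near: n; exists 1%N.
have n1 : 1 <= n%:R :> R by rewrite ler1n; near: n; exists 1%N.
have hD : k * E n ^+ 2 <= D n by near: n.
have E0 : 0 < E n := expR_gt0 _.
have D0 : 0 < D n by apply: lt_le_trans hD; rewrite mulr_gt0 ?exprn_gt0.
rewrite /delta /g normrM (ger0_norm (divr_ge0 (ltW E0) (ltW n0))).
rewrite normrM normfV (gtr0_norm D0).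
have hnum : `|noise_x n - \sum_(k < p) Lambda phi n x k * noise_phi n k| <=
   `|noise_x n| + C * E n * \sum_(i < p) `|noise_phi n i / n%:R|.
  apply: le_trans (ler_normB _ _) _; rewrite lerD2l.
  apply: le_trans (ler_norm_sum _ _ _) _; rewrite mulr_sumr; apply: ler_sum => i _.
  rewrite (normrM (Lambda _ _ _ _)) (normrM (noise_phi n i)) (normfV n%:R) (gtr0_norm n0).
  rewrite mulrA ler_pdivlMr//.
  by rewrite mulrAC ler_wpM2r// [X in X <= _]mulrC.
rewrite mulrA ler_pdivrMr//.
apply: le_trans (_ : E n / n%:R * (`|noise_x n| + C * E n * \sum_(i < p) `|noise_phi n i / n%:R|) <= _).
  by rewrite ler_wpM2l// divr_ge0 ?ltW.
set S := \sum_(i < p) _; have S0 : 0 <= S by apply: sumr_ge0.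
set T := _ * (_ + _) in |- *.
have gg : 0 <= `|noise_x n / (n%:R * E n)| + C * S by rewrite addr_ge0// mulr_ge0// ltW.
apply: le_trans (_ : k^-1 * (`|noise_x n / (n%:R * E n)| + C * S) * (k * E n ^+ 2) <= _); last first.
  by rewrite ler_wpM2l// mulr_ge0// invr_ge0 ltW.
rewrite normrM normfV (gtr0_norm (mulr_gt0 n0 E0)).
have -> : k^-1 * (`|noise_x n| / (n%:R * E n) + C * S) * (k * E n ^+ 2) =
   E n / n%:R * (`|noise_x n| + C * (n%:R * (E n * S))).
  by field; rewrite !gt_eqF.
rewrite /T ler_wpM2l ?divr_ge0 ?(ltW E0) ?(ltW n0)// lerD2l -mulrA ler_wpM2l ?(ltW C0)//.
by rewrite ler_peMl// mulr_ge0// ltW.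
Unshelve. all: by end_near. Qed.

(** Consistency for one path: the probabilistic input is reduced to two bounds on noise
    terms, a growth bound on b and l <> 0. *)
Lemma estimator_cvg :
  (fun n => theta_hat phi n x (Iphi n) (IX n)) @ \oo --> (mu, alpha).
Proof.
have [k k0 Hk] := D_ge; have [C C0 HC] := Lambda_bound; have hd := delta_negl.
have D0 : \forall n \near \oo, D n != 0.
  apply: filterS Hk => n Hn; rewrite gt_eqF//; apply: lt_le_trans Hn.
  by rewrite mulr_gt0// exprn_gt0// expR_gt0.
have H1 : (fun n => mu_hat phi n x (Iphi n) (IX n)) @ \oo --> mu.
  apply/cvg_ballP => e e0.
  have H (i : 'I_p) : \forall n \near \oo,
      ball (mu ord0 i) e (mu_hat phi n x (Iphi n) (IX n) ord0 i).
    suff : (fun n => mu_hat phi n x (Iphi n) (IX n) ord0 i - mu ord0 i) @ \oo --> (0 : R).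
      move=> /cvgrPdist_lt/(_ e e0); apply: filterS => n.
      by rewrite /ball/= sub0r normrN distrC.
    have := cvg0D (cvg0_norm (hN i)) (cvg0Z C (cvg0_norm hd)); apply: squeeze0.
    near=> n; have n0 : (0 < n)%N by near: n; exists 1%N.
    have n0' : 0 < n%:R :> R by rewrite ltr0n.
    rewrite mu_hatE//; last by near: n.
    have -> : mu ord0 i + noise_phi n i / n%:R - Lambda phi n x i * delta n - mu ord0 i =
      noise_phi n i / n%:R - Lambda phi n x i * delta n by ring.
    rewrite (le_trans (ler_normB _ _))// lerD2l (normrM (Lambda _ _ _ _)) (normrM (E n / n%:R)).
    rewrite mulrA ler_wpM2r// (normrM (E n)) (normfV n%:R) (gtr0_norm n0').
    by rewrite (gtr0_norm (expR_gt0 _)) mulrA ler_pdivlMr// mulrC; exact: HC.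
  near=> n; split => // i j; rewrite ord1; move: j; near: n.
  by apply: filter_forall.
suff H2 : (fun n => alpha_hat phi n x (Iphi n) (IX n)) @ \oo --> alpha.
  exact: cvg_pair H1 H2.
apply/cvgrPdist_lt => e e0.
suff : (fun n => alpha_hat phi n x (Iphi n) (IX n) - alpha) @ \oo --> (0 : R).
  by move=> /cvgrPdist_lt/(_ e e0); apply: filterS => n; rewrite sub0r normrN distrC.
have HH := cvg0Z alpha^-1 (cvg0_norm hd); apply: (squeeze0 _ HH).
near=> n; have n0 : (0 < n)%N by near: n; exists 1%N.
have n0' : 0 < n%:R :> R by rewrite ltr0n.
rewrite alpha_hatE//; last by near: n.
rewrite addrC addKr (normrM (E n / n%:R)) mulrA ler_peMl// (normrM (E n)) (normfV n%:R).
rewrite (gtr0_norm n0') (gtr0_norm (expR_gt0 _)).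
by rewrite mulrA ler_pdivlMr// mul1r mulrC n_le_E.
Unshelve. all: by end_near. Qed.

End Estimator.

(** * Young integrals as limits of dyadic sums *)

Section Young.
Variable R : realType.
Implicit Types (f g : R -> R) (m n : nat).

Definition stieltjes_sum m (j k : nat) f g : R :=
  \sum_(j * 2 ^ m <= i < k * 2 ^ m) f (dy R m i) * (g (dy R m i.+1) - g (dy R m i)).

Lemma big_nat_double (F : nat -> R) N :
  \sum_(0 <= i < N.*2) F i = \sum_(0 <= i < N) (F i.*2 + F i.*2.+1).
Proof.
elim: N => [|N IH]; first by rewrite !big_geq.
by rewrite doubleS !big_nat_recr//= IH addrA.
Qed.

Lemma dy_in m n i : (0 * 2 ^ m <= i < n * 2 ^ m)%N ->
  0 <= dy R m i <= n%:R /\ 0 <= dy R m i.+1 <= n%:R.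
Proof.
move=> h; have [_ h2] := dy_itv R h; rewrite !dy_ge0 h2 (le_trans (dy_leS _ _ _) h2).
by [].
Qed.

Lemma sum_dy_cst m n (c : R) : \sum_(0 * 2 ^ m <= i < n * 2 ^ m) c = n%:R * 2 ^+ m * c.
Proof.
by rewrite sumr_const_nat mul0n subn0 -[c *+ _]mulr_natl natrM natrX.
Qed.

Lemma half_powR (a : R) m : ((2 : R) ^+ m)^-1 `^ a = (2 `^ (- a)) ^+ m.
Proof.
have -> : ((2 : R) ^+ m)^-1 = 2 `^ (- m%:R) by rewrite powRN powR_mulrn.
by rewrite -powRrM -[RHS]powR_mulrn ?powR_ge0// -powRrM; congr (_ `^ _); ring.
Qed.

(** The ratio 2^(1 - a - b) by which the error of dyadic sums decreases from one
    level to the next, for Hoelder exponents a and b. *)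
Definition rho (a b : R) : R := 2 * (2 `^ (- a) * 2 `^ (- b)).

Lemma rho_lt1 (a b : R) : 1 < a + b -> 0 <= rho a b < 1.
Proof.
move=> ab; rewrite /rho mulr_ge0 ?mulr_ge0 ?powR_ge0//= -powRD; last by rewrite pnatr_eq0 implybT.
rewrite -{1}[2]powRr1// -powRD; last by rewrite pnatr_eq0 implybT.
rewrite /powR pnatr_eq0/= expR_lt1 pmulr_llt0; first by lra.
by rewrite ln_gt0// ltr1n.
Qed.

(** Refining a cell changes the sum by a product of one increment of f and one
    of g, hence by at most Cf Cg 2^(- (m + 1) (a + b)); there are n 2^m cells. *)
Lemma stieltjes_sum_step f g (a b Cf Cg : R) m n : 0 <= Cf -> 0 <= Cg ->
  holder_norm_le a n%:R f Cf -> holder_norm_le b n%:R g Cg ->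
  `|stieltjes_sum m.+1 0 n f g - stieltjes_sum m 0 n f g| <= n%:R * Cf * Cg * rho a b ^+ m.+1.
Proof.
move=> Cf0 Cg0 [_ hf] [_ hg].
have -> : stieltjes_sum m.+1 0 n f g = \sum_(0 * 2 ^ m <= i < n * 2 ^ m)
   (f (dy R m.+1 i.*2) * (g (dy R m.+1 i.*2.+1) - g (dy R m.+1 i.*2)) +
    f (dy R m.+1 i.*2.+1) * (g (dy R m.+1 i.*2.+2) - g (dy R m.+1 i.*2.+1))).
  by rewrite /stieltjes_sum !mul0n expnS mulnCA mul2n big_nat_double.
rewrite /stieltjes_sum -sumrB.
apply: le_trans (ler_norm_sum _ _ _) _.
apply: le_trans (_ : \sum_(0 * 2 ^ m <= i < n * 2 ^ m)
   Cf * Cg * (2 `^ (- a) * 2 `^ (- b)) ^+ m.+1 <= _); last first.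
  rewrite sum_dy_cst /rho [in leRHS]exprMn.
  have T0 : 0 <= (2 `^ (- a) * 2 `^ (- b)) ^+ m.+1 by rewrite exprn_ge0// mulr_ge0// powR_ge0.
  have h2 : (2 : R) ^+ m <= 2 ^+ m.+1 by rewrite exprS ler_peMl ?exprn_ge0// ler1n.
  move: T0; set T := (_ * _) ^+ m.+1 => T0.
  have -> : n%:R * 2 ^+ m * (Cf * Cg * T) = n%:R * Cf * Cg * (2 ^+ m * T) by ring.
  by rewrite ler_wpM2l ?mulr_ge0// ler_wpM2r.
apply: ler_sum_nat => i hi.
have hi' : (0 * 2 ^ m.+1 <= i.*2 < n * 2 ^ m.+1)%N.
  by rewrite !mul0n /= expnS mulnCA mul2n ltn_double; move: hi; rewrite mul0n.
have hi'' : (0 * 2 ^ m.+1 <= i.*2.+1 < n * 2 ^ m.+1)%N.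
  by rewrite !mul0n /= expnS mulnCA mul2n ltn_Sdouble; move: hi; rewrite mul0n.
have [h0 h1] := dy_in hi'; have [_ h2] := dy_in hi''.
rewrite -(dy_double R m i) -(dy_double R m i.+1) doubleS.
have -> : f (dy R m.+1 i.*2) * (g (dy R m.+1 i.*2.+1) - g (dy R m.+1 i.*2)) +
    f (dy R m.+1 i.*2.+1) * (g (dy R m.+1 i.*2.+2) - g (dy R m.+1 i.*2.+1)) -
    f (dy R m.+1 i.*2) * (g (dy R m.+1 i.*2.+2) - g (dy R m.+1 i.*2)) =
   (f (dy R m.+1 i.*2.+1) - f (dy R m.+1 i.*2)) *
   (g (dy R m.+1 i.*2.+2) - g (dy R m.+1 i.*2.+1)) by ring.
have e j : `|dy R m.+1 j.+1 - dy R m.+1 j| = (2 ^+ m.+1)^-1.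
  by rewrite dyS addrC addKr gtr0_norm// invr_gt0 pow2_gt0.
have := hf _ _ h0 h1; have := hg _ _ h1 h2; rewrite !e !half_powR => Hg Hf.
rewrite normrM exprMn mulrACA; exact: ler_pM.
Qed.

(** The rate depends on g through its Hoelder constant only: it is uniform over the
    smooth approximations in the definition of the Young integral. *)
Lemma stieltjes_sum_rate f g (a b Cf Cg I : R) n : 1 < a + b -> 0 <= Cf -> 0 <= Cg ->
  holder_norm_le a n%:R f Cf -> holder_norm_le b n%:R g Cg ->
  (fun m => stieltjes_sum m 0 n f g) @ \oo --> I ->
  forall m, `|stieltjes_sum m 0 n f g - I| <= n%:R * Cf * Cg * (1 - rho a b)^-1 * rho a b ^+ m.
Proof.
move=> ab Cf0 Cg0 hf hg HI m.
have /andP[r0 r1] := rho_lt1 ab.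
set C := n%:R * Cf * Cg; have C0 : 0 <= C by rewrite !mulr_ge0.
have key k : `|stieltjes_sum m 0 n f g - stieltjes_sum (m + k) 0 n f g| <= C * (1 - rho a b)^-1 * rho a b ^+ m.
  apply: le_trans (_ : \sum_(0 <= j < k) C * rho a b ^+ m * rho a b ^+ j <= _); last first.
    rewrite -mulr_sumr mulrAC ler_wpM2r ?exprn_ge0// ler_wpM2l//.
    by apply: geo_sum_le; rewrite r0.
  elim: k => [|k IH]; first by rewrite addn0 subrr normr0 big_geq.
  rewrite big_nat_recr//= addnS.
  have -> : stieltjes_sum m 0 n f g - stieltjes_sum (m + k).+1 0 n f g =
    (stieltjes_sum m 0 n f g - stieltjes_sum (m + k) 0 n f g) - (stieltjes_sum (m + k).+1 0 n f g - stieltjes_sum (m + k) 0 n f g) by ring.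
  apply: le_trans (ler_normB _ _) _; rewrite lerD//.
  apply: le_trans (stieltjes_sum_step (m + k) Cf0 Cg0 hf hg) _.
  rewrite -/C -mulrA ler_wpM2l// -exprD exprS ler_piMl ?exprn_ge0// ltW//.
have Hk : (fun k => `|stieltjes_sum m 0 n f g - stieltjes_sum (m + k) 0 n f g|) @ \oo --> `|stieltjes_sum m 0 n f g - I|.
  apply: cvg_norm; apply: cvgB; first exact: cvg_cst.
  under eq_fun do rewrite addnC.
  by move: HI; rewrite -(cvg_shiftn m).
by apply: (cvgr_to_le Hk); exact: nearW.
Qed.

(** A Hoelder condition on [0, n] says nothing beyond n; stopping the argument
    at n gives a function that is continuous on the whole half line. *)
Lemma holder_clip_cont f (a C : R) n : 0 < a -> 0 <= C -> holder_norm_le a n%:R f C ->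
  cont0 (fun t => f (Num.min t n%:R)).
Proof.
move=> a0 C0 [_ hf]; apply/cont0P => s s0 e e0.
have C1 : 0 < C + 1 by rewrite ltr_wpDl.
exists ((e / (C + 1)) `^ a^-1); first exact/powR_gt0/divr_gt0.
move=> t t0 ts.
have cl (u : R) : 0 <= u -> 0 <= Num.min u n%:R <= n%:R.
  by move=> u0; rewrite le_min u0 ler0n ge_min lexx orbT.
apply: le_lt_trans (hf _ _ (cl s s0) (cl t t0)) _.
have le1 : `|Num.min t n%:R - Num.min s n%:R| <= `|t - s|.
  have h1 := ler_norm (t - s); have h2 := ler_norm (s - t); rewrite distrC in h2.
  have h3 := normr_ge0 (t - s); move: (`|t - s|) h1 h2 h3 => N h1 h2 h3.
  rewrite ler_norml; case: (leP t n%:R); case: (leP s n%:R) => h4 h5; apply/andP; split; lra.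
apply: le_lt_trans (_ : C * `|t - s| `^ a < e).
  by rewrite ler_wpM2l// ge0_ler_powR ?nnegrE// ltW.
apply: le_lt_trans (_ : (C + 1) * `|t - s| `^ a < e).
  by rewrite ler_wpM2r ?powR_ge0// lerDl.
rewrite mulrC -ltr_pdivlMr//.
have -> : e / (C + 1) = ((e / (C + 1)) `^ a^-1) `^ a.
  by rewrite -powRrM mulVf ?gt_eqF// powRr1// divr_ge0// ltW.
by rewrite gt0_ltr_powR ?nnegrE ?powR_ge0.
Qed.

Lemma stieltjes_clip f h (a C : R) n : 0 < a -> 0 <= C -> holder_norm_le a n%:R f C -> lbm h ->
  (fun m => \sum_(0 * 2 ^ m <= i < n * 2 ^ m)
              f (dy R m i) * \I_[dy R m i, dy R m i.+1] h) @ \oo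
  --> \I_[0, n%:R] (fun s => f s * h s).
Proof.
move=> a0 C0 hf lh; have cf := holder_clip_cont a0 C0 hf.
have := stieltjes_cvg (leq0n n) cf lh.
rewrite (II_eq (g := fun s => f s * h s)); last first.
  by move=> t /andP[t0 tn]; rewrite min_l.
apply: cvg_trans; apply: near_eq_cvg; apply: nearW => m /=.
apply: eq_big_nat => i hi; have [/andP[_ dn] _] := dy_in hi.
by rewrite min_l.
Qed.

Lemma C1_increment g (s t : R) : (forall u, derivable g u 1) -> continuous (derive1 g) ->
  s <= t -> g t - g s = \I_[s, t] (derive1 g).
Proof.
move=> dg cg; rewrite le_eqVlt => /predU1P[<-|st]; first by rewrite II_same subrr.
have cgc : continuous g.
  by move=> u; apply/differentiable_continuous/derivable1_diffP; exact: dg.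
rewrite /Rintegral (@continuous_FTC2 _ (derive1 g) g)//.
- exact: continuous_subspaceT.
- split; first by move=> u _; exact: dg.
  + by apply: cvg_at_right_filter; exact: cgc.
  + by apply: cvg_at_left_filter; exact: cgc.
Qed.

(** For smooth g_k the sums converge to int f g_k' at a rate that does not depend on
    k; at a fixed level the sums for g_k tend to those for g. *)
Lemma young_stieltjes_sum f g (I : R) n : is_young_integral n%:R f g I ->
  (fun m => stieltjes_sum m 0 n f g) @ \oo --> I.
Proof.
move=> [a [b [[/andP[a0 a1] /andP[b0 b1] ab [Cf hf] [Cg hg]] [g_ [dg cg hgk HI]]]]].
have n0 : 0 <= (0 : R) <= n%:R by rewrite lexx ler0n.
have Cf0 : 0 <= Cf by apply: le_trans (hf.1 0 n0).
have Cg0 : 0 <= Cg by apply: le_trans (hg.1 0 n0).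
have /andP[r0 r1] := rho_lt1 ab.
have Ck k : (fun m => stieltjes_sum m 0 n f (g_ k)) @ \oo --> \I_[0, n%:R] (fun s => f s * derive1 (g_ k) s).
  have lg : lbm (derive1 (g_ k)) by apply: cont0_lbm; apply: continuous_cont0; exact: cg.
  have := stieltjes_clip a0 Cf0 hf lg; apply: cvg_trans; apply: near_eq_cvg.
  apply: nearW => m; apply: eq_bigr => i _.
  by rewrite (C1_increment (dg k) (cg k))// dy_leS.
pose K := n%:R * Cf * (Cg + 1) * (1 - rho a b)^-1.
suff rate m : `|stieltjes_sum m 0 n f g - I| <= K * rho a b ^+ m.
  have Kr : (fun m => K * rho a b ^+ m) @ \oo --> (0 : R).
    by apply: cvg0Z; apply: cvg_expr; rewrite ger0_norm.
  have H : (fun m => stieltjes_sum m 0 n f g - I) @ \oo --> (0 : R).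
    by apply: squeeze0 Kr; exact: nearW.
  have : (fun m => stieltjes_sum m 0 n f g - I + I) @ \oo --> (0 + I).
    by apply: cvgD H _; exact: cvg_cst.
  by rewrite add0r; under eq_fun do rewrite subrK.
apply/ler_addgt0Pr => e e0.
pose N : R := n%:R * 2 ^+ m * (Cf * 2).
have N0 : 0 <= N by rewrite !mulr_ge0// exprn_ge0.
(* at most 1 for a uniform Hoelder constant of g_k, and small against the number of cells *)
pose e' := Num.min 1 (e / 2 / (N + 1)).
have e'0 : 0 < e' by rewrite lt_min ltr01 !divr_gt0// ltr_wpDl.
have e20 : 0 < e / 2 by rewrite divr_gt0.
have /cvgrPdist_le/(_ _ e20) HI' := HI.
have /filter_ex[k [h1 h2]] : \forall k \near \oo,
    holder_norm_le b n%:R (fun t => g_ k t - g t) e' /\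
    `|I - \I_[0, n%:R] (fun s => f s * derive1 (g_ k) s)| <= e / 2.
  by apply: filterI HI'; exact: hgk.
set Ik := \I_[_, _] _ in h2.
have hgk' : holder_norm_le b n%:R (g_ k) (Cg + 1).
  have e'1 : e' <= 1 by rewrite ge_min lexx.
  split.
    move=> t ht; have -> : g_ k t = g t + (g_ k t - g t) by ring.
    apply: le_trans (ler_normD _ _) _; rewrite lerD ?hg.1//.
    by apply: le_trans (h1.1 t ht) _.
  move=> s t hs ht.
  have -> : g_ k t - g_ k s = (g t - g s) + ((g_ k t - g t) - (g_ k s - g s)) by ring.
  apply: le_trans (ler_normD _ _) _; rewrite mulrDl lerD ?hg.2//.
  apply: le_trans (h1.2 s t hs ht) _.
  by rewrite ler_wpM2r ?powR_ge0.
have Cg10 : 0 <= Cg + 1 by rewrite addr_ge0.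
have h3 := stieltjes_sum_rate ab Cf0 Cg10 hf hgk' (Ck k) m.
have h4 : `|stieltjes_sum m 0 n f g - stieltjes_sum m 0 n f (g_ k)| <= e / 2.
  rewrite /stieltjes_sum -sumrB; apply: le_trans (ler_norm_sum _ _ _) _.
  apply: le_trans (_ : \sum_(0 * 2 ^ m <= i < n * 2 ^ m) Cf * (2 * e') <= _).
    apply: ler_sum_nat => i hi; have [i0 i1] := dy_in hi.
    rewrite -mulrBr normrM ler_pM ?hf.1//.
    have -> : g (dy R m i.+1) - g (dy R m i) - (g_ k (dy R m i.+1) - g_ k (dy R m i)) =
      (g_ k (dy R m i) - g (dy R m i)) - (g_ k (dy R m i.+1) - g (dy R m i.+1)) by ring.
    apply: le_trans (ler_normB _ _) _; rewrite mulr_natl mulr2n.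
    by apply: lerD; apply: h1.1.
  rewrite sum_dy_cst (_ : _ * _ * (Cf * (2 * e')) = N * e'); last by rewrite /N; ring.
  apply: le_trans (_ : (N + 1) * e' <= _); first by rewrite ler_wpM2r ?(ltW e'0)// lerDl.
  by rewrite mulrC -ler_pdivlMr ?ltr_wpDl// ge_min lexx orbT.
have -> : stieltjes_sum m 0 n f g - I = (stieltjes_sum m 0 n f g - stieltjes_sum m 0 n f (g_ k)) + (stieltjes_sum m 0 n f (g_ k) - Ik) - (I - Ik) by ring.
apply: le_trans (ler_normB _ _) _; apply: le_trans (lerD (ler_normD _ _) (lexx _)) _.
by move: h2 h3 h4; rewrite -/K; lra.
Qed.

End Young.

Section YoungPath.
Variable R : realType.
Implicit Types (f g : R -> R) (m n : nat).

Definition qvar m n f : R := \sum_(0 * 2 ^ m <= i < n * 2 ^ m) (f (dy R m i.+1) - f (dy R m i)) ^+ 2.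

(** Summation by parts: x (y - x) = (y^2 - x^2 - (y - x)^2) / 2 in each cell. *)
Lemma stieltjes_sum_self m n f : stieltjes_sum m 0 n f f = (f n%:R ^+ 2 - f 0 ^+ 2 - qvar m n f) / 2.
Proof.
rewrite /stieltjes_sum /qvar -(dy_nat R m n) mul0n.
have -> : f 0 = f (dy R m 0) by rewrite /dy mul0r.
elim: (n * 2 ^ m)%N => [|N IH]; first by rewrite !big_geq// subrr subr0 mul0r.
by rewrite !big_nat_recr//= IH; field.
Qed.

Lemma qvar_cvg0 f n (q C : R) : 0 <= q < 1 ->
  (forall m i, (0 * 2 ^ m <= i < n * 2 ^ m)%N ->
     (f (dy R m i.+1) - f (dy R m i)) ^+ 2 <= C * (q ^+ m / 2 ^+ m)) ->
  (fun m => qvar m n f) @ \oo --> (0 : R).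
Proof.
move=> /andP[q0 q1] H.
have : (fun m => n%:R * C * q ^+ m) @ \oo --> (0 : R).
  by apply: cvg0Z; apply: cvg_expr; rewrite ger0_norm.
apply: squeeze0; apply: nearW => m.
rewrite ger0_norm; last by apply: sumr_ge0 => i _; exact: sqr_ge0.
apply: le_trans (_ : \sum_(0 * 2 ^ m <= i < n * 2 ^ m) C * (q ^+ m / 2 ^+ m) <= _).
  by apply: ler_sum_nat => i; exact: H.
rewrite sum_dy_cst le_eqVlt; apply/orP; left; apply/eqP.
by field; rewrite gt_eqF// pow2_gt0.
Qed.

(** A path that has a Young integral against itself is Hoelder of exponents a and b with
    a + b > 1, so its quadratic variation vanishes. *)
Lemma young_self f n (I : R) : is_young_integral n%:R f f I ->
  I = (f n%:R ^+ 2 - f 0 ^+ 2) / 2.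
Proof.
move=> hI; have hRS := young_stieltjes_sum hI.
move: hI => [a [b [[/andP[a0 _] /andP[b0 _] ab [Cf hf] [Cg hg]] _]]].
have n0 : 0 <= (0 : R) <= n%:R by rewrite lexx ler0n.
have Cf0 : 0 <= Cf by apply: le_trans (hf.1 0 n0).
have Cg0 : 0 <= Cg by apply: le_trans (hg.1 0 n0).
have r01 := rho_lt1 ab.
have hq : (fun m => qvar m n f) @ \oo --> (0 : R).
  apply: (@qvar_cvg0 _ _ (rho a b) (Cf * Cg)) => // m i hi.
  have [i0 i1] := dy_in R hi.
  have e : `|dy R m i.+1 - dy R m i| = (2 ^+ m)^-1.
    by rewrite dyS addrC addKr gtr0_norm// invr_gt0 pow2_gt0.
  have := hf.2 _ _ i0 i1; have := hg.2 _ _ i0 i1; rewrite !e !half_powR => Hg Hf.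
  rewrite -real_normK ?num_real// expr2.
  apply: le_trans (ler_pM _ _ Hf Hg) _ => //.
  rewrite /rho exprMn [2 ^+ m * _]mulrC mulfK ?gt_eqF ?pow2_gt0// exprMn.
  by rewrite mulrACA.
have : (fun m => stieltjes_sum m 0 n f f) @ \oo --> (f n%:R ^+ 2 - f 0 ^+ 2) / 2.
  under eq_fun do rewrite stieltjes_sum_self.
  apply: cvgM; last exact: cvg_cst.
  by rewrite -[X in _ --> X]subr0; apply: cvgB => //; exact: cvg_cst.
by move=> /(cvg_unique _ hRS) ->//; exact: norm_hausdorff.
Qed.

Variables (x b dr : R -> R).
Hypotheses (cx : cont0 x) (cb : cont0 b) (ldr : lbm dr).
Hypothesis eqn : forall t : R, 0 <= t -> x t = \I_[0, t] dr + b t.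

Lemma increment_eqn m i : x (dy R m i.+1) - x (dy R m i) =
  b (dy R m i.+1) - b (dy R m i) + \I_[dy R m i, dy R m i.+1] dr.
Proof.
rewrite !eqn ?dy_ge0// (II_split (lexx 0) (dy_ge0 R m i) (dy_leS R m i) ldr); ring.
Qed.

(** The drift part of x contributes an ordinary integral, so what is left of the
    Young integral is a limit of sums against b alone. *)
Lemma young_noise f n (I : R) : is_young_integral n%:R f x I ->
  (fun m => stieltjes_sum m 0 n f b) @ \oo --> I - \I_[0, n%:R] (fun s => f s * dr s).
Proof.
move=> hI; have hRS := young_stieltjes_sum hI.
move: hI => [a [c [[/andP[a0 _] _ _ [Cf hf] _] _]]].
have n0 : 0 <= (0 : R) <= n%:R by rewrite lexx ler0n.
have Cf0 : 0 <= Cf by apply: le_trans (hf.1 0 n0).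
have -> : (fun m => stieltjes_sum m 0 n f b) = (fun m => stieltjes_sum m 0 n f x -
    \sum_(0 * 2 ^ m <= i < n * 2 ^ m) f (dy R m i) * \I_[dy R m i, dy R m i.+1] dr).
  apply/funext => m; rewrite /stieltjes_sum -sumrB; apply: eq_bigr => i _.
  by rewrite increment_eqn; ring.
exact: cvgB hRS (stieltjes_clip a0 Cf0 hf ldr).
Qed.

(** An absolutely continuous path has no quadratic variation either. *)
Lemma drift_square n : \I_[0, n%:R] (fun s => \I_[0, s] dr * dr s) = (\I_[0, n%:R] dr) ^+ 2 / 2.
Proof.
pose A := (fun t : R => \I_[0, t] dr).
have cA : cont0 A := II_cont ldr.
have := stieltjes_cvg (leq0n n) cA ldr => H1.
have [D HD] := ldr.2 n%:R.
have inc m i : A (dy R m i.+1) - A (dy R m i) = \I_[dy R m i, dy R m i.+1] dr.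
  by rewrite /A (II_split (lexx 0) (dy_ge0 R m i) (dy_leS R m i) ldr) addrAC subrr add0r.
have hq : (fun m => qvar m n A) @ \oo --> (0 : R).
  have q01 : 0 <= (2^-1 : R) < 1 by rewrite invr_ge0 ler0n/= invf_lt1// ltr1n.
  apply: (qvar_cvg0 (C := D ^+ 2) q01) => m i hi.
  have [/andP[i0 _] /andP[_ i1]] := dy_in R hi.
  rewrite inc.
  have B : `|\I_[dy R m i, dy R m i.+1] dr| <= D / 2 ^+ m.
    have e : (2 ^+ m)^-1 = dy R m i.+1 - dy R m i by rewrite dyS addrC addKr.
    rewrite e; apply: II_bound => //; first exact: dy_leS.
    move=> t /andP[it ti]; apply: HD.
    by rewrite (le_trans i0 it) (le_trans ti).
  rewrite -real_normK ?num_real//.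
  apply: le_trans (_ : (D / 2 ^+ m) ^+ 2 <= _).
    by rewrite lerXn2r ?nnegrE// (le_trans _ B).
  rewrite [2^-1 ^+ m]exprVn le_eqVlt; apply/orP; left; apply/eqP.
  by field; rewrite gt_eqF// pow2_gt0.
have H2 : (fun m => stieltjes_sum m 0 n A A) @ \oo --> A n%:R ^+ 2 / 2.
  under eq_fun do rewrite stieltjes_sum_self.
  apply: cvgM; last exact: cvg_cst.
  rewrite -[X in _ --> X]subr0; apply: cvgB => //.
  by rewrite {2}/A II_same expr0n/= subr0; exact: cvg_cst.
have H3 : (fun m => stieltjes_sum m 0 n A A) @ \oo --> \I_[0, n%:R] (fun s => A s * dr s).
  move: H1; apply: cvg_trans; apply: near_eq_cvg; apply: nearW => m.
  by apply: eq_bigr => i _; rewrite inc.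
by apply: (cvg_unique _ H3 H2); exact: norm_hausdorff.
Qed.

(** With A = int dr and x = A + b, expand x^2 / 2 - int x dr and use
    int A dA = A^2 / 2; what remains contains b in every term. *)
Lemma young_self_noise n (I : R) : x 0 = 0 -> is_young_integral n%:R x x I ->
  I - \I_[0, n%:R] (fun s => x s * dr s) =
  (x n%:R - b n%:R) * b n%:R + b n%:R ^+ 2 / 2 - \I_[0, n%:R] (fun s => b s * dr s).
Proof.
move=> x0 /young_self ->; rewrite x0 expr0n/= subr0.
have lb := cont0_lbm cb; have lA := cont0_lbm (II_cont ldr).
rewrite (II_eq (g := fun s => \I_[0, s] dr * dr s + b s * dr s)); last first.
  by move=> t /andP[t0 _]; rewrite eqn// mulrDl.
rewrite IID//; [|exact: lbmM..].
by rewrite drift_square eqn//; field.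
Qed.

End YoungPath.

(** * Mean squares and a strong law *)

Section SquareIntegrable.
Context (R : realType) (d : measure_display) (Omega : measurableType d).
Variable P : probability Omega R.
Implicit Types (f g : Omega -> R).

Definition EE f : R := Rintegral P setT f.
Definition intg f : Prop := P.-integrable [set: Omega] (EFin \o f).
Definition sqint f : Prop := measurable_fun [set: Omega] f /\ intg (fun w => f w ^+ 2).

Lemma intg_meas f : intg f -> measurable_fun [set: Omega] f.
Proof. by move=> /integrableP[/measurable_EFinP]. Qed.

Lemma intg_le f g : measurable_fun [set: Omega] f -> (forall w, `|f w| <= g w) -> intg g -> intg f.
Proof.
move=> mf fg ig; apply: le_integrable ig => //.
  exact/measurable_EFinP.
by move=> w _ /=; rewrite lee_fin (le_trans (fg w))// ler_norm.
Qed.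

Lemma intgD f g : intg f -> intg g -> intg (fun w => f w + g w).
Proof. by move=> hf hg; have := integrableD measurableT hf hg. Qed.

Lemma intgZ c f : intg f -> intg (fun w => c * f w).
Proof. by move=> hf; have := integrableZl measurableT c hf. Qed.

Lemma intg_cst c : intg (fun _ => c).
Proof. exact: finite_measure_integrable_cst. Qed.

Lemma intg_sum (I : Type) (r : seq I) (F : I -> Omega -> R) :
  (forall i, intg (F i)) -> intg (fun w => \sum_(i <- r) F i w).
Proof.
move=> H; elim: r => [|i r IH].
  by under eq_fun do rewrite big_nil; exact: intg_cst.
by under eq_fun do rewrite big_cons; exact: intgD.
Qed.

Lemma EED f g : intg f -> intg g -> EE (fun w => f w + g w) = EE f + EE g.
Proof. by move=> hf hg; rewrite /EE RintegralD. Qed.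

Lemma EEZ c f : intg f -> EE (fun w => c * f w) = c * EE f.
Proof. by move=> hf; rewrite /EE RintegralZl. Qed.

Lemma EE_cst c : EE (fun _ => c) = c.
Proof. by rewrite /EE /Rintegral; have := integral_cst P measurableT c%:E; rewrite /cst/= probability_setT mule1 => ->. Qed.

Lemma EE_fine f : intg f -> (\int[P]_w (f w)%:E)%E = (EE f)%:E.
Proof. by move=> hf; rewrite /EE /Rintegral fineK//; exact: integrable_fin_num. Qed.

Lemma EE_sum (I : Type) (r : seq I) (F : I -> Omega -> R) :
  (forall i, intg (F i)) -> EE (fun w => \sum_(i <- r) F i w) = \sum_(i <- r) EE (F i).
Proof.
move=> H; elim: r => [|i r IH].
  by under [X in EE X]eq_fun do rewrite big_nil; rewrite big_nil EE_cst.
under [X in EE X]eq_fun do rewrite big_cons.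
by rewrite big_cons EED// ?IH//; exact: intg_sum.
Qed.

Lemma sqint_mul f g : sqint f -> sqint g -> intg (fun w => f w * g w).
Proof.
move=> [mf hf] [mg hg]; apply: (intg_le _ _ (intgD hf hg)).
  exact: measurable_funM.
move=> w; rewrite normrM -[f w ^+ 2]real_normK ?num_real// -[g w ^+ 2]real_normK ?num_real//.
by have := normr_ge0 (f w); have := normr_ge0 (g w); have := sqr_ge0 (`|f w| - `|g w|); nra.
Qed.

Lemma sqintD f g : sqint f -> sqint g -> sqint (fun w => f w + g w).
Proof.
move=> [mf hf] [mg hg]; split; first exact: measurable_funD.
apply: (intg_le _ _ (intgD (intgZ 2 hf) (intgZ 2 hg))).
  by apply: measurable_funX; exact: measurable_funD.
by move=> w; rewrite ger0_norm ?sqr_ge0// sqrD_le2.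
Qed.

Lemma sqintZ c f : sqint f -> sqint (fun w => c * f w).
Proof.
move=> [mf hf]; split; first by apply: measurable_funM.
by under eq_fun do rewrite exprMn; exact: intgZ.
Qed.

Lemma sqintB f g : sqint f -> sqint g -> sqint (fun w => f w - g w).
Proof.
move=> hf hg; have := sqintD hf (sqintZ (-1) hg).
by under eq_fun do rewrite mulN1r.
Qed.

Lemma sqint_cst c : sqint (fun _ => c).
Proof. by split=> //; exact: intg_cst. Qed.

Lemma sqint_sum (I : Type) (r : seq I) (F : I -> Omega -> R) :
  (forall i, sqint (F i)) -> sqint (fun w => \sum_(i <- r) F i w).
Proof.
move=> H; elim: r => [|i r IH].
  by under eq_fun do rewrite big_nil; exact: sqint_cst.
by under eq_fun do rewrite big_cons; exact: sqintD.
Qed.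

Lemma EE_sqr_sum (I : Type) (r : seq I) (c : I -> R) (F : I -> Omega -> R) :
  (forall i, sqint (F i)) ->
  EE (fun w => (\sum_(i <- r) c i * F i w) ^+ 2) =
  \sum_(i <- r) \sum_(j <- r) c i * c j * EE (fun w => F i w * F j w).
Proof.
move=> H.
have -> : (fun w => (\sum_(i <- r) c i * F i w) ^+ 2) =
  (fun w => \sum_(i <- r) \sum_(j <- r) c i * c j * (F i w * F j w)).
  apply/funext => w; rewrite expr2 big_distrlr/=.
  by apply: eq_bigr => i _; apply: eq_bigr => j _; rewrite mulrACA.
rewrite EE_sum => [|i]; last by apply: intg_sum => j; apply: intgZ; exact: sqint_mul.
apply: eq_bigr => i _; rewrite EE_sum => [|j]; last by apply: intgZ; exact: sqint_mul.
by apply: eq_bigr => j _; rewrite EEZ//; exact: sqint_mul.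
Qed.

Lemma Ele_sqint f C : sqint f -> EE (fun w => f w ^+ 2) <= C -> Ele P (fun w => f w ^+ 2) C.
Proof.
move=> [mf hf] hC; apply: Ele_integral.
- exact: measurable_funX.
- by move=> w; exact: sqr_ge0.
- by rewrite EE_fine// lee_fin.
Qed.

End SquareIntegrable.

Section StrongLaw.
Context (R : realType) (d : measure_display) (Omega : measurableType d).
Variable P : probability Omega R.

Lemma sqr_sum_le (x : nat -> R) a b : (a <= b)%N ->
  (\sum_(a <= j < b) `|x j|) ^+ 2 <= (b - a)%:R * \sum_(a <= j < b) x j ^+ 2.
Proof.
elim: b => [|b IH]; first by rewrite leqn0 => /eqP ->; rewrite !big_geq// expr0n mulr0.
rewrite leq_eqVlt => /predU1P[->|ab]; first by rewrite !big_geq// expr0n mulr0.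
have {}IH := IH ab; rewrite !big_nat_recr//= subSn//.
move: IH; set s := \sum_(a <= j < b) `|x j|; set V := \sum_(a <= j < b) x j ^+ 2.
rewrite -[x b ^+ 2]real_normK ?num_real//; move: `|x b| (normr_ge0 (x b)) => y y0.
have s0 : 0 <= s by apply: sumr_ge0.
have V0 : 0 <= V by apply: sumr_ge0 => j _; exact: sqr_ge0.
have [-> |n0] := posnP (b - a)%N.
  rewrite mul0r => s2; have -> : s = 0.
    by apply/eqP; rewrite -(sqrf_eq0 s) eq_le s2 sqr_ge0.
  by rewrite add0r mul1r lerDr.
have l0 : 0 < (b - a)%:R :> R by rewrite ltr0n.
rewrite -[(b - a).+1%:R]natr1; move: ((b - a)%:R : R) l0 => l l0 IH.
suff h : 2 * s * y <= l * y ^+ 2 + V by nra.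
rewrite -(ler_pM2l l0); have := sqr_ge0 (l * y - s); nra.
Qed.

Lemma sum_inv_sqr N : \sum_(0 <= m < N) (m.+1%:R ^+ 2)^-1 <= (2 : R).
Proof.
case: N => [|N]; first by rewrite big_geq.
suff : \sum_(0 <= m < N.+1) (m.+1%:R ^+ 2)^-1 <= 2 - (N.+1%:R)^-1 :> R.
  by move/le_trans; apply; rewrite gerBl invr_ge0.
elim: N => [|N IH]; first by rewrite big_nat1 expr1n invr1; lra.
rewrite big_nat_recr//=; apply: le_trans (lerD IH (lexx _)) _.
have a0 : 0 < N.+1%:R :> R by rewrite ltr0n.
rewrite -[N.+2%:R]natr1; move: (N.+1%:R : R) a0 => a a0.
have a1 : 0 < a + 1 by lra.
rewrite -subr_ge0.
have -> : 2 - (a + 1)^-1 - (2 - a^-1 + ((a + 1) ^+ 2)^-1) = (a * (a + 1) ^+ 2)^-1.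
  by field; rewrite !gt_eqF.
by rewrite invr_ge0 mulr_ge0 ?sqr_ge0// ltW.
Qed.

Lemma pow_step (x : R) q : 0 <= x <= 1 -> (1 + x) ^+ q <= 1 + 2 ^+ q * x.
Proof.
move=> /andP[x0 x1]; elim: q => [|q IH]; first by rewrite !expr0 mul1r lerDl.
rewrite !exprS; have h : (1 + x) ^+ q <= 2 ^+ q.
  by rewrite lerXn2r ?nnegrE//; lra.
have : 1 <= (2 : R) ^+ q by apply: exprn_ege1; rewrite ler1n.
by nra.
Qed.

Variables (S : nat -> Omega -> R) (C r : R).
Hypotheses (r2 : r < 2) (C0 : 0 <= C).
Hypothesis hS : forall n, Ele P (fun w => S n w ^+ 2) (C * n%:R `^ r).
Hypothesis hD : forall n, Ele P (fun w => (S n.+1 w - S n w) ^+ 2) C.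

(** Along the subsequence N(m) = (m + 1)^(q + 1), with q large, the normalized second
    moments are summable. Between N(m) and N(m + 1) the sum of the increments is
    bounded by Cauchy-Schwarz; the gap is O(N(m) / m), so these maximal terms are
    summable as well. *)
Lemma strong_law : {ae P, forall w, (fun n => S n w / n%:R) @ \oo --> (0 : R)}.
Proof.
have [q qr] : exists q : nat, 2 <= q.+1%:R * (2 - r).
  have [n hn] := nat_ge (2 / (2 - r)); exists n.
  rewrite -ler_pdivrMr ?subr_gt0// (le_trans hn)// ler_nat//.
(* with (q + 1) (2 - r) >= 2 the sequence N(m)^(r - 2) is at most (m + 1)^-2 *)
pose N m := (m.+1 ^ q.+1)%N.
have N0 m : 0 < (N m)%:R :> R by rewrite ltr0n expn_gt0.
have NS m : (N m <= N m.+1)%N by rewrite leq_exp2r.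
have h1 m : Ele P (fun w => (S (N m) w / (N m)%:R) ^+ 2) (C * (m.+1%:R ^+ 2)^-1).
  apply: Ele_le (EleZ (c := ((N m)%:R ^+ 2)^-1) _ (hS (N m))).
  - by apply: aeW => w; rewrite exprMn exprVn mulrC.
  - rewrite mulrCA ler_wpM2l//.
    have -> : (N m)%:R = m.+1%:R `^ q.+1%:R :> R by rewrite powR_mulrn// natrX.
    rewrite -powR_mulrn ?powR_ge0// -[m.+1%:R ^+ 2]powR_mulrn// -!powRrM -!powRN -powRD; last first.
      by rewrite pnatr_eq0 implybT.
    by apply: ler_powR; [rewrite ler1n|nra].
  - by rewrite invr_ge0 exprn_ge0.
pose l m := (N m.+1 - N m)%N.
pose V m w := \sum_(N m <= j < N m.+1) (S j.+1 w - S j w) ^+ 2.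
have lN m : (l m)%:R / (N m)%:R <= 2 ^+ q.+1 / m.+1%:R :> R.
  rewrite natrB// mulrBl mulfV ?gt_eqF// lerBlDl.
  have -> : (N m.+1)%:R / (N m)%:R = (1 + m.+1%:R^-1) ^+ q.+1 :> R.
    by rewrite !natrX -expr_div_n; congr (_ ^+ _); rewrite -[m.+2%:R]natr1; field.
  by apply: pow_step; rewrite invr_ge0 ler0n/= invf_le1 ?ltr0n// ler1n.
have h2 m : Ele P (fun w => (l m)%:R * V m w / (N m)%:R ^+ 2) (C * (2 ^+ q.+1) ^+ 2 * (m.+1%:R ^+ 2)^-1).
  have e : Ele P (fun w => V m w) ((l m)%:R * C).
    apply: Ele_le (Ele_sum (index_iota (N m) (N m.+1)) hD); first exact: aeW.
    by rewrite sumr_const_nat mulr_natl.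
  apply: Ele_le (EleZ (c := (l m)%:R / (N m)%:R ^+ 2) _ e).
  - by apply: aeW => w; rewrite mulrAC.
  - have -> : (l m)%:R / (N m)%:R ^+ 2 * ((l m)%:R * C) = C * ((l m)%:R / (N m)%:R) ^+ 2.
      by field; rewrite gt_eqF.
    rewrite -mulrA ler_wpM2l// -exprVn -exprMn lerXn2r ?nnegrE ?divr_ge0 ?exprn_ge0//.
  - by rewrite divr_ge0// exprn_ge0.
have b1 K : \sum_(0 <= m < K) C * (m.+1%:R ^+ 2)^-1 <= C * 2.
  by rewrite -mulr_sumr ler_wpM2l// sum_inv_sqr.
have b2 K : \sum_(0 <= m < K) C * (2 ^+ q.+1) ^+ 2 * (m.+1%:R ^+ 2)^-1 <= C * (2 ^+ q.+1) ^+ 2 * 2.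
  by rewrite -mulr_sumr ler_wpM2l ?sum_inv_sqr// mulr_ge0// sqr_ge0.
have V0 m w : 0 <= V m w by apply: sumr_ge0 => j _; exact: sqr_ge0.
have p2 m w : 0 <= (l m)%:R * V m w / (N m)%:R ^+ 2.
  by rewrite divr_ge0 ?mulr_ge0 ?exprn_ge0.
apply: filterS2 (Ele_series h1 (fun _ _ => sqr_ge0 _) b1) (Ele_series h2 p2 b2).
move=> w c1 c2; apply/cvgrPdist_le => e e0.
have e4 : 0 < e ^+ 2 / 4 by rewrite divr_gt0// exprn_gt0.
have /cvgrPdist_le/(_ _ e4)[M1 _ H1] := c1.
have /cvgrPdist_le/(_ _ e4)[M2 _ H2] := c2.
exists (N (maxn M1 M2)) => // n /= Nn.
have [m mM /andP[Nm nm]] : exists2 m, (maxn M1 M2 <= m)%N & (N m <= n < N m.+1)%N.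
  have ex : exists m, (N m <= n)%N by exists (maxn M1 M2).
  have ub m : (N m <= n)%N -> (m <= n)%N.
    move=> h; apply: leq_trans h; apply: leq_trans (leqnSn m) _.
    by rewrite -[X in (X <= _)%N]expn1 leq_pexp2l.
  case: (ex_maxnP ex ub) => m Nm hm; exists m; first exact: hm.
  by rewrite Nm/= ltnNge; apply/negP => /hm; rewrite ltnn.
have M1m : (M1 <= m)%N by apply: leq_trans mM; rewrite leq_maxl.
have M2m : (M2 <= m)%N by apply: leq_trans mM; rewrite leq_maxr.
have := H1 _ M1m; have := H2 _ M2m => /=.
rewrite !sub0r !normrN (ger0_norm (p2 _ _)) (ger0_norm (sqr_ge0 _)) => H2' H1'.
have n0 : 0 < n%:R :> R by apply: lt_le_trans (N0 m) _; rewrite ler_nat.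
have tel : `|S n w| <= `|S (N m) w| + \sum_(N m <= j < N m.+1) `|S j.+1 w - S j w|.
  have -> : S n w = S (N m) w + \sum_(N m <= j < n) (S j.+1 w - S j w).
    by rewrite telescope_sumr// addrC subrK.
  apply: le_trans (ler_normD _ _) _; rewrite lerD2l.
  apply: le_trans (ler_norm_sum _ _ _) _.
  rewrite (big_cat_nat Nm (ltnW nm))/= lerDl; exact: sumr_ge0.
have cs := sqr_sum_le (fun j => S j.+1 w - S j w) (NS m).
rewrite -(@ler_pXn2r _ 2)// ?nnegrE ?(ltW e0)//.
rewrite normrM normfV (gtr0_norm n0) expr_div_n.
rewrite ler_pdivrMr ?exprn_gt0//.
set T := \sum_(N m <= j < N m.+1) `|_| in tel cs.
have T0 : 0 <= T by apply: sumr_ge0.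
have A : `|S n w| ^+ 2 <= 2 * S (N m) w ^+ 2 + 2 * T ^+ 2.
  apply: le_trans (_ : (`|S (N m) w| + T) ^+ 2 <= _).
    by rewrite lerXn2r ?nnegrE ?addr_ge0.
  by rewrite -[S (N m) w ^+ 2]real_normK ?num_real// sqrD_le2.
apply: le_trans A _; apply: le_trans (_ : e ^+ 2 * (N m)%:R ^+ 2 <= _); last first.
  by rewrite ler_wpM2l ?sqr_ge0// lerXn2r ?nnegrE ?ler_nat.
move: H1' H2'; rewrite expr_div_n ler_pdivrMr ?exprn_gt0// ler_pdivrMr ?exprn_gt0//.
by rewrite -/(V m w) in cs; move: cs; rewrite -/(l m); lra.
Qed.

End StrongLaw.

(** * Second moments of fractional Brownian motion *)

Section UpperExpectationIntegrals.
Context (R : realType) (d : measure_display) (Omega : measurableType d).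
Variable P : probability Omega R.

Lemma Ele_sum_nat (F : nat -> Omega -> R) (c : nat -> R) a b :
  (forall i, (a <= i < b)%N -> Ele P (F i) (c i)) ->
  Ele P (fun w => \sum_(a <= i < b) F i w) (\sum_(a <= i < b) c i).
Proof.
move=> H; have := @Ele_sum _ _ _ P _ (index_iota a b)
  (fun i w => if (a <= i < b)%N then F i w else 0) (fun i => if (a <= i < b)%N then c i else 0).
have h i : Ele P (fun w => if (a <= i < b)%N then F i w else 0) (if (a <= i < b)%N then c i else 0).
  by case: ifP => [/H//|_]; exact: Ele_cst.
move/(_ h); apply: Ele_le.
  by apply: aeW => w; rewrite le_eqVlt; apply/orP; left; apply/eqP; apply: eq_big_nat => i ->.
by rewrite le_eqVlt; apply/orP; left; apply/eqP; apply: eq_big_nat => i ->.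
Qed.

(** Tonelli's theorem would need joint measurability of Y; here the integral is a
    limit of Riemann sums along each continuous path, and Fatou's lemma is enough. *)
Lemma Ele_II_sqr (Y : R -> Omega -> R) (j : nat) (C : R) :
  {ae P, forall w, cont0 (fun t => Y t w)} ->
  (forall t : R, j%:R <= t <= j.+1%:R -> Ele P (fun w => Y t w ^+ 2) C) ->
  Ele P (fun w => \I_[j%:R, j.+1%:R] (fun s => Y s w ^+ 2)) C.
Proof.
move=> cY hY; apply: (@Ele_cvg _ _ _ P
  (fun m w => \sum_(j * 2 ^ m <= i < j.+1 * 2 ^ m) Y (dy R m i) w ^+ 2 / 2 ^+ m)).
  move=> m; have := @Ele_sum_nat (fun i w => (2 ^+ m)^-1 * Y (dy R m i) w ^+ 2)
    (fun i => (2 ^+ m)^-1 * C) (j * 2 ^ m) (j.+1 * 2 ^ m).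
  have p0 : 0 <= ((2 : R) ^+ m)^-1 by rewrite invr_ge0 ltW// pow2_gt0.
  have h i : (j * 2 ^ m <= i < j.+1 * 2 ^ m)%N ->
     Ele P (fun w => (2 ^+ m)^-1 * Y (dy R m i) w ^+ 2) ((2 ^+ m)^-1 * C).
    move=> hi; apply: EleZ => //; apply: hY; have [-> h] := dy_itv R hi.
    by rewrite (le_trans (dy_leS _ _ _) h).
  move=> /(_ h); apply: Ele_le.
    by apply: aeW => w; apply: ler_sum_nat => i _; rewrite mulrC.
  rewrite sumr_const_nat -mulnBl subSnn mul1n -[_ *+ _]mulr_natl natrX.
  by rewrite mulrA mulfV ?mul1r// gt_eqF// pow2_gt0.
apply: filterS cY => w cw.
apply: (@riemann_cvg _ (fun s => Y s w ^+ 2) j j.+1) => //.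
by have := cont0M cw cw; under eq_fun do rewrite -expr2.
Qed.

End UpperExpectationIntegrals.

Section FBM.
Context (R : realType) (d : measure_display) (Omega : measurableType d).
Variables (P : probability Omega R) (H : R) (B : R -> {RV P >-> R}).
Hypotheses (hH : 2^-1 <= H < 1) (hB : fractional_brownian_motion H B).

Lemma H2_gt0 : 0 < 2 * H.
Proof. by move: hH => /andP[h1 _]; lra. Qed.

Lemma cov_diag t : 0 <= t -> fbm_cov H t t = t `^ (2 * H).
Proof.
by move=> t0; rewrite /fbm_cov subrr normr0 powR0 ?gt_eqF ?H2_gt0// subr0; field.
Qed.

Lemma cov_int s t : 0 <= s -> 0 <= t ->
  (\int[P]_w (B s w * B t w)%:E)%E = (fbm_cov H s t)%:E.
Proof.
move=> s0 t0; rewrite -(fbm_covariance hB s0 t0) covariance.unlock.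
rewrite !(fbm_centered hB)//= expectation.unlock; apply: eq_integral => w _ /=.
by rewrite (_ : B s w * B t w = (B s w - 0) * (B t w - 0))// !subr0.
Qed.

Lemma B_sqint t : 0 <= t -> sqint P (B t).
Proof.
move=> t0; split => //; apply/integrableP; split.
  by apply/measurable_EFinP; exact: measurable_funX.
have := cov_int t0 t0; under eq_integral do rewrite -expr2.
under [in X in _ -> X]eq_integral do rewrite /= ger0_norm ?sqr_ge0//.
by move=> ->; rewrite ltry.
Qed.

Lemma B_cov s t : 0 <= s -> 0 <= t -> EE P (fun w => B s w * B t w) = fbm_cov H s t.
Proof. by move=> s0 t0; rewrite /EE /Rintegral cov_int. Qed.

Lemma B_mean t : 0 <= t -> EE P (B t) = 0.
Proof.
move=> t0; have := fbm_centered hB t0; rewrite expectation.unlock => h.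
by rewrite /EE /Rintegral h.
Qed.

Lemma incr_sqint s t : 0 <= s -> 0 <= t -> sqint P (fun w => B t w - B s w).
Proof. by move=> s0 t0; apply: sqintB; exact: B_sqint. Qed.

Lemma incr_prod s t u v : 0 <= s -> 0 <= t -> 0 <= u -> 0 <= v ->
  EE P (fun w => (B t w - B s w) * (B v w - B u w)) =
  2^-1 * (`|v - s| `^ (2 * H) + `|u - t| `^ (2 * H) - `|v - t| `^ (2 * H) - `|u - s| `^ (2 * H)).
Proof.
move=> s0 t0 u0 v0.
have i x y : 0 <= x -> 0 <= y -> intg P (fun w => B x w * B y w).
  by move=> x0 y0; apply: sqint_mul; exact: B_sqint.
have -> : (fun w => (B t w - B s w) * (B v w - B u w)) =
  (fun w => (B t w * B v w + B s w * B u w) + -1 * (B t w * B u w + B s w * B v w)).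
  by apply/funext => w; ring.
rewrite EED; [|by apply: intgD; exact: i|by apply: intgZ; apply: intgD; exact: i].
rewrite EEZ; [|by apply: intgD; exact: i].
rewrite !EED; [|exact: i..]; rewrite !B_cov// /fbm_cov; ring.
Qed.

Lemma incr_sqr s t : 0 <= s -> 0 <= t ->
  EE P (fun w => (B t w - B s w) ^+ 2) = `|t - s| `^ (2 * H).
Proof.
move=> s0 t0; under [X in EE P X]eq_fun do rewrite expr2.
rewrite incr_prod// !subrr normr0 powR0 ?gt_eqF ?H2_gt0// subr0 (distrC s).
by field.
Qed.

Lemma convex_powR_mid (a h : R) : 0 <= h <= a ->
  2 * a `^ (2 * H) <= (a + h) `^ (2 * H) + (a - h) `^ (2 * H).
Proof.
move=> /andP[h0 ha]; have H1 : 1 <= 2 * H by move: hH => /andP[h1 _]; lra.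
have i0 : (0 : R) <= 2^-1 by lra.
have i1 : (2^-1 : R) <= 1 by lra.
have := @convex_powR R (2 * H) H1 (Itv01 i0 i1) (a + h) (a - h).
rewrite !inE/= !in_itv/= !andbT subr_ge0 ha addr_ge0 ?(le_trans h0 ha)// => /(_ isT isT).
rewrite convRE [X in X `^ _ <= _ -> _]convRE/= /unstable.onem.
have -> : 2^-1 * (a + h) + (1 - 2^-1) * (a - h) = a by field.
lra.
Qed.

(** The covariance of two increments over cells of equal length is a second
    difference of the function |t|^(2H), which is convex because H >= 1/2. *)
Lemma grid_incr_ge0 m i j :
  0 <= EE P (fun w => (B (dy R m i.+1) w - B (dy R m i) w) * (B (dy R m j.+1) w - B (dy R m j) w)).
Proof.
wlog ij : i j / (i <= j)%N.
  move=> W; have [ij|/ltnW ji] := leqP i j; first exact: W.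
  by under [X in EE P X]eq_fun do rewrite mulrC; exact: W.
rewrite incr_prod ?dy_ge0//.
move: ij; rewrite leq_eqVlt => /predU1P[<-|ij].
  rewrite !subrr normr0 powR0 ?gt_eqF ?H2_gt0// !subr0.
set h := ((2 : R) ^+ m)^-1; have h0 : 0 <= h by rewrite invr_ge0 ltW// pow2_gt0.
set a := dy R m j - dy R m i.
have ha : h <= a by rewrite /a lerBrDl addrC; have := dy_le R m ij; rewrite dyS addrC.
have -> : dy R m j.+1 - dy R m i = a + h by rewrite dyS /a /h; ring.
have -> : dy R m j - dy R m i.+1 = a - h by rewrite dyS /a /h; ring.
have -> : dy R m j.+1 - dy R m i.+1 = a by rewrite !dyS /a /h; ring.
have ah : 0 <= h <= a by rewrite h0.
have a0 : 0 <= a := le_trans h0 ha.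
rewrite (ger0_norm (addr_ge0 a0 h0)) (ger0_norm a0) [`|a - h|]ger0_norm ?subr_ge0//.
by have := convex_powR_mid ah; lra.
Qed.

(** All covariances of increments are nonnegative, so bounded weights can be
    replaced by their bound M; the unweighted sum telescopes. *)
Lemma weighted_incr (u : nat -> R) (M : R) m p q : (p <= q)%N -> (forall i, `|u i| <= M) ->
  Ele P (fun w => (\sum_(p <= i < q) u i * (B (dy R m i.+1) w - B (dy R m i) w)) ^+ 2)
    (M ^+ 2 * (dy R m q - dy R m p) `^ (2 * H)).
Proof.
move=> pq uM.
have hs i : sqint P (fun w => B (dy R m i.+1) w - B (dy R m i) w).
  by apply: incr_sqint; exact: dy_ge0.
have M0 : 0 <= M := le_trans (normr_ge0 _) (uM 0%N).
apply: Ele_sqint; first by apply: sqint_sum => i; exact: sqintZ.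
rewrite EE_sqr_sum//.
have -> : (dy R m q - dy R m p) `^ (2 * H) =
  \sum_(p <= i < q) \sum_(p <= j < q) 1 * 1 * EE P (fun w => (B (dy R m i.+1) w - B (dy R m i) w) * (B (dy R m j.+1) w - B (dy R m j) w)).
  rewrite -(EE_sqr_sum _ (fun _ => 1)) //.
  have -> : (fun w => (\sum_(p <= i < q) 1 * (B (dy R m i.+1) w - B (dy R m i) w)) ^+ 2) =
    (fun w => (B (dy R m q) w - B (dy R m p) w) ^+ 2).
    apply/funext => w; under eq_bigr do rewrite mul1r.
    by rewrite (telescope_sumr (fun i => B (dy R m i) w)).
  by rewrite incr_sqr ?dy_ge0// ger0_norm// subr_ge0 dy_le.
rewrite mulr_sumr; apply: ler_sum => i _; rewrite mulr_sumr; apply: ler_sum => j _.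
rewrite !mul1r ler_wpM2r ?grid_incr_ge0//.
apply: le_trans (ler_norm _) _; rewrite normrM expr2.
by apply: ler_pM.
Qed.

Lemma B_path : {ae P, forall w, cont0 (fun t => B t w)}.
Proof. exact: fbm_continuous hB. Qed.

Lemma incr_Ele s t : 0 <= s -> 0 <= t ->
  Ele P (fun w => (B t w - B s w) ^+ 2) (`|t - s| `^ (2 * H)).
Proof. by move=> s0 t0; apply: Ele_sqint; [exact: incr_sqint|rewrite incr_sqr]. Qed.

Lemma H2_lt2 : 2 * H < 2.
Proof. by move: hH => /andP[_ h1]; lra. Qed.

Lemma B_Ele t : 0 <= t -> Ele P (fun w => B t w ^+ 2) (t `^ (2 * H)).
Proof.
move=> t0; apply: Ele_sqint; first exact: B_sqint.
by under [X in EE P X]eq_fun do rewrite expr2; rewrite B_cov// cov_diag.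
Qed.

Lemma B_strong_law : {ae P, forall w, (fun n : nat => B n%:R w / n%:R) @ \oo --> (0 : R)}.
Proof.
apply: (@strong_law _ _ _ P (fun n => B n%:R) 1 (2 * H)) => //; first exact: H2_lt2.
  by move=> n; rewrite mul1r; exact: B_Ele.
move=> n; have := @incr_Ele n%:R n.+1%:R (ler0n _ _) (ler0n _ _).
by rewrite succn_subr normr1 powR1.
Qed.

Let Z j w := \I_[j%:R, j.+1%:R] (fun s => (B s w - B j%:R w) ^+ 2).

Lemma Z_Ele j : Ele P (Z j) 1.
Proof.
apply: (@Ele_II_sqr _ _ _ P (fun s w => B s w - B j%:R w)).
  by apply: filterS B_path => w cw; apply: cont0B => //; exact: cont0_cst.
move=> t /andP[jt tj]; have t0 : 0 <= t := le_trans (ler0n _ _) jt.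
have := incr_Ele (ler0n R j) t0; apply: Ele_le; first exact: aeW.
have e1 : (1 : R) `^ (2 * H) = 1 by rewrite powR1.
rewrite ger0_norm ?subr_ge0// -[leRHS]e1.
apply: ge0_ler_powR; rewrite ?nnegrE ?(ltW H2_gt0) ?subr_ge0//.
by move: tj; rewrite -natr1; lra.
Qed.

Lemma bsq_le_Z : {ae P, forall w, forall j,
  bsq (fun t => B t w) j <= 2 * B j%:R w ^+ 2 + 2 * Z j w}.
Proof.
apply: filterS B_path => w cw j.
have lb := cont0_lbm cw; have lbj := lbmX2 (lbmB lb (lbm_cst (B j%:R w))).
apply: le_trans (_ : \I_[j%:R, j.+1%:R] (fun s => 2 * B j%:R w ^+ 2 + 2 * (B s w - B j%:R w) ^+ 2) <= _).
  apply: II_le => //; first exact: lbmX2.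
    by apply: lbmD; [exact: lbm_cst|exact: lbmZ].
  move=> t _; rewrite {1}(_ : B t w = B j%:R w + (B t w - B j%:R w)); last by ring.
  exact: sqrD_le2.
rewrite IID//; [|exact: lbm_cst|exact: lbmZ].
by rewrite II_cst ?ler_nat// succn_subr mulr1 IIZ.
Qed.

(** Comparing B on [j, j + 1] with its value at j. *)
Lemma bsq_Ele : exists2 C : R, 0 < C & forall j,
  Ele P (fun w => bsq (fun t => B t w) j) (C * j.+1%:R ^+ 2).
Proof.
exists 4 => // j.
have h := EleD (EleZ (c := 2) (ler0n _ _) (B_Ele (ler0n R j))) (EleZ (c := 2) (ler0n _ _) (Z_Ele j)).
apply: Ele_le h; first by apply: filterS bsq_le_Z => w; exact.
have h1 : (j%:R : R) `^ (2 * H) <= j.+1%:R ^+ 2.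
  apply: le_trans (_ : (j.+1%:R : R) `^ (2 * H) <= _).
    by apply: ge0_ler_powR; rewrite ?nnegrE ?(ltW H2_gt0)// ler_nat.
  by rewrite -powR_mulrn//; apply: ler_powR; rewrite ?ler1n// ltW// H2_lt2.
have h2 : (1 : R) <= j.+1%:R ^+ 2 by rewrite exprn_ege1// ler1n.
by lra.
Qed.

Lemma bsq_cvg0 : {ae P, forall w,
  (fun j => bsq (fun t => B t w) j / j.+1%:R ^+ 2) @ \oo --> (0 : R)}.
Proof.
have h j : Ele P (fun w => Z j w * (j.+1%:R ^+ 2)^-1) ((j.+1%:R ^+ 2)^-1).
  apply: Ele_le (EleZ (c := (j.+1%:R ^+ 2)^-1) _ (Z_Ele j)).
  - by apply: aeW => w; rewrite mulrC.
  - by rewrite mulr1.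
  - by rewrite invr_ge0 sqr_ge0.
have Z0 j w : 0 <= Z j w * (j.+1%:R ^+ 2)^-1.
  by rewrite divr_ge0 ?sqr_ge0//; apply: II_ge0 => t _; exact: sqr_ge0.
have hc := Ele_series h Z0 (@sum_inv_sqr R).
apply: filterS3 B_strong_law hc bsq_le_Z => w c1 c2 hb.
have c3 : (fun j : nat => 2 * (B j%:R w / j%:R) ^+ 2 + 2 * (Z j w * (j.+1%:R ^+ 2)^-1)) @ \oo --> (0 : R).
  apply: cvg0D; apply: cvg0Z => //.
  by have h2 := cvgM c1 c1; rewrite mulr0 in h2; exact: h2.
apply: squeeze0 c3; near=> j.
have j0 : 0 < j%:R :> R by rewrite ltr0n; near: j; exists 1%N.
rewrite ger0_norm; last by rewrite divr_ge0 ?sqr_ge0// bsq_ge0.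
apply: le_trans (ler_wpM2r _ (hb j)) _; first by rewrite invr_ge0 sqr_ge0.
rewrite mulrDl -(mulrA 2 (Z j w)) lerD2r -mulrA ler_wpM2l//.
rewrite expr_div_n ler_wpM2l ?sqr_ge0// lef_pV2 ?posrE ?exprn_gt0//.
by rewrite lerXn2r ?nnegrE// ler_nat.
Unshelve. all: by end_near. Qed.

End FBM.

(** * The Ito isometry *)

Section Independence.
Context (R : realType) (d : measure_display) (Omega : measurableType d).
Variable P : probability Omega R.
Implicit Types (U V : {RV P >-> R}).
Local Open Scope ereal_scope.

(** The joint law is the product of the marginal laws, so Fubini's theorem
    factorizes the expectation of the product. *)
Lemma indep_EE U V :
  (forall A B : set R, measurable A -> measurable B ->
    P (U @^-1` A `&` V @^-1` B) = P (U @^-1` A) * P (V @^-1` B)) ->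
  intg P U -> intg P V ->
  intg P (fun w => U w * V w)%R /\ EE P (fun w => U w * V w)%R = (EE P U * EE P V)%R.
Proof.
move=> ind iU iV.
have mUV : measurable_fun [set: Omega] (fun w => (U w, V w)).
  by apply/measurable_fun_pairP; split.
pose UV : {RV P >-> (R * R)%type} := mfun_Sub (mem_set mUV).
pose m1 : probability _ R := distribution P U.
pose m2 : probability _ R := distribution P V.
pose m' : {measure set _ -> \bar R} := distribution P UV.
pose f (z : R * R) : \bar R := (z.1 * z.2)%:E.
have mf : measurable_fun [set: R * R] f.
  by apply/measurable_EFinP; apply: measurable_funM; [exact: measurable_fst|exact: measurable_snd].
have m'E X : measurable X -> (m1 \x m2) X = m' X.
  by apply: product_measure_unique => A B mA mB; exact: ind.
have eUV (g : R * R -> \bar R) : measurable_fun [set: R * R] g -> (forall z, 0 <= g z) ->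
   \int[m1 \x m2]_z g z = \int[P]_w g (U w, V w).
  move=> mg g0; rewrite (eq_measure_integral m') => [|A mA _]; last exact: m'E.
  by rewrite ge0_integral_distribution.
have i1 : m1.-integrable setT (EFin \o idfun).
  by apply: integrable_pushforward => //; apply/measurable_EFinP; exact: measurable_id.
have i2 : m2.-integrable setT (EFin \o idfun).
  by apply: integrable_pushforward => //; apply/measurable_EFinP; exact: measurable_id.
have E1 : \int[m1]_x x%:E = (EE P U)%:E.
  by rewrite integral_distribution//; exact: EE_fine.
have E2 : \int[m2]_x x%:E = (EE P V)%:E.
  by rewrite integral_distribution//; exact: EE_fine.
have mabs : measurable_fun [set: R] (fun x : R => `|x|%:E).
  by apply/measurable_EFinP; exact: normr_measurable.
have K1 : \int[m1]_x `|x|%:E < +oo by have /integrableP[_] := i1.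
have K2 : \int[m2]_x `|x|%:E < +oo by have /integrableP[_] := i2.
have imf : (m1 \x m2).-integrable setT f.
  apply/integrable12ltyP => //.
  have -> : \int[m1]_x \int[m2]_y `|f (x, y)| = \int[m1]_x (`|x|%:E * \int[m2]_y `|y|%:E).
    apply: eq_integral => x _; rewrite -ge0_integralZl//.
    by apply: eq_integral => y _; rewrite /f/= normrM EFinM.
  rewrite ge0_integralZr//; last exact: integral_ge0.
  by rewrite lte_mul_pinfty// ?ge0_fin_numE//; exact: integral_ge0.
have iUV : intg P (fun w => U w * V w)%R.
  apply/integrableP; split; first exact/measurable_EFinP/measurable_funM.
  have /integrableP[_] := imf; rewrite eUV//.
  by apply: measurableT_comp.
split => //.
apply: EFin_inj; rewrite -EE_fine//.
have <- : \int[m']_z f z = \int[P]_w (U w * V w)%:E.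
  by rewrite integral_distribution.
rewrite -(eq_measure_integral m' (m1 := m1 \x m2)) => [|A mA _]; last exact: m'E.
rewrite -integral12_prod_meas1//.
have -> : \int[m1]_x fubini_F m2 f x = \int[m1]_x (x%:E * (EE P V)%:E).
  apply: eq_integral => x _; rewrite /fubini_F /f /= -E2 -integralZl//.
by rewrite integralZr// E1 EFinM.
Qed.
End Independence.

Section Indicators.
Variable R : realType.

Lemma II_sum (I : Type) (r : seq I) (F : I -> R -> R) (a b : R) : 0 <= a ->
  (forall i, lbm (F i)) ->
  \I_[a, b] (fun s => \sum_(i <- r) F i s) = \sum_(i <- r) \I_[a, b] (F i).
Proof.
move=> a0 lF; elim: r => [|i r IH].
  rewrite big_nil (II_eq (g := fun _ => 0 * 0)) => [|s _]; last by rewrite big_nil mul0r.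
  by rewrite IIZ ?mul0r//; exact: lbm_cst.
rewrite big_cons -IH -IID//; last exact: lbm_sum.
by apply: II_eq => s _; rewrite big_cons.
Qed.

Definition ind (s t u : R) : R := \1_(`]s, t]) u.

Lemma indE s t u : ind s t u = ((s < u) && (u <= t))%:R.
Proof. by rewrite /ind indicE mem_setE in_itv. Qed.

Lemma lbm_ind s t : lbm (ind s t).
Proof.
apply: (lbm_bounded (M := 1)); first by apply: measurable_indic.
by move=> u; rewrite indE; case: (_ && _); rewrite ?normr1 ?normr0.
Qed.

(** The length of the intersection of ]s, t] and ]s', t']. *)
Definition overlap (s t s' t' : R) : R := Num.max 0 (Num.min t t' - Num.max s s').

Lemma II_ind (s t T : R) : 0 <= s -> t <= T -> \I_[0, T] (ind s t) = Num.max 0 (t - s).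
Proof.
move=> s0 tT.
have sub : (`]s, t] : set R) `&` `[0, T] = `]s, t]%classic.
  apply/setIidPl => x /=; rewrite !in_itv/= => /andP[sx xt].
  by rewrite (le_trans s0 (ltW sx)) (le_trans xt tT).
rewrite /Rintegral /ind integral_indic//= sub lebesgue_measure_itv/= lte_fin.
have [ts|st] := leP t s.
  by rewrite /= max_l// subr_le0.
by rewrite /= max_r// subr_ge0 ltW.
Qed.

Lemma II_ind2 (s t s' t' T : R) : 0 <= s -> t <= T -> 
  \I_[0, T] (fun u => ind s t u * ind s' t' u) = overlap s t s' t'.
Proof.
move=> s0 tT.
rewrite (II_eq (g := ind (Num.max s s') (Num.min t t'))) => [|u _].
  by rewrite II_ind// ?le_max ?s0// ge_min tT.
rewrite !indE gt_max le_min -natrM mulnb; congr (_%:R); congr nat_of_bool.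
by case: (s < u); case: (s' < u); case: (u <= t); case: (u <= t').
Qed.

End Indicators.

Section Ito.
Context (R : realType) (d : measure_display) (Omega : measurableType d).
Variables (P : probability Omega R) (B : R -> {RV P >-> R}) (F : R -> set (set Omega)).
Hypotheses (hB : fractional_brownian_motion 2^-1 B) (hF : brownian_filtration B F).

(** Measurability of a real random variable with respect to F s, stated on
    preimages as in the definition of a filtration. *)
Definition Fm (s : R) (U : Omega -> R) : Prop :=
  forall A : set R, measurable A -> F s (U @^-1` A).

Lemma FmP s U : 0 <= s ->
  Fm s U <-> @measurable_fun _ _ (g_sigma_algebraType (F s)) R setT U.
Proof.
move=> s0; have E : <<s F s >> = F s by apply: sigma_algebra_id; exact: bf_sigma_algebra hF _ s0.
split=> [h _ A mA|h A mA].
  by rewrite setTI /measurable/= E; exact: h.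
by have := h measurableT A mA; rewrite setTI /measurable/= E.
Qed.

Lemma Fm_meas s U : 0 <= s -> Fm s U -> measurable_fun [set: Omega] U.
Proof. by move=> s0 h _ A mA; rewrite setTI; apply: (bf_measurable hF s0); exact: h. Qed.

Lemma Fm_mono s t U : 0 <= s -> s <= t -> Fm s U -> Fm t U.
Proof. by move=> s0 st h A mA; apply: (bf_nondecreasing hF s0 st); exact: h. Qed.

Lemma FmM s U V : 0 <= s -> Fm s U -> Fm s V -> Fm s (fun w => U w * V w).
Proof. by move=> s0 /(FmP _ s0) h /(FmP _ s0) h'; apply/(FmP _ s0); exact: measurable_funM. Qed.

Lemma FmB s U V : 0 <= s -> Fm s U -> Fm s V -> Fm s (fun w => U w - V w).
Proof. by move=> s0 /(FmP _ s0) h /(FmP _ s0) h'; apply/(FmP _ s0); exact: measurable_funB. Qed.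

Lemma Fm_incr s t u : 0 <= s -> 0 <= t -> s <= u -> t <= u -> Fm u (fun w => B t w - B s w).
Proof.
move=> s0 t0 su tu; apply: FmB; first exact: le_trans su.
  by apply: Fm_mono tu _ => // A mA; exact: (bf_adapted hF).
by apply: Fm_mono su _ => // A mA; exact: (bf_adapted hF).
Qed.

Lemma half_hurst : 2^-1 <= (2^-1 : R) < 1.
Proof. by rewrite lexx/=; lra. Qed.

Lemma sqint_intg f : sqint P f -> intg P f.
Proof.
by move=> h; have := sqint_mul h (sqint_cst P 1); under eq_fun do rewrite mulr1.
Qed.

Lemma incr_L2 s t : 0 <= s -> 0 <= t -> sqint P (fun w => B t w - B s w).
Proof. by move=> s0 t0; apply: incr_sqint hB _ _ s0 t0. Qed.

Lemma BM_incr_sqr s t : 0 <= s -> s <= t -> EE P (fun w => (B t w - B s w) ^+ 2) = t - s.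
Proof.
move=> s0 st; rewrite (incr_sqr half_hurst hB s0 (le_trans s0 st)) ger0_norm ?subr_ge0//.
by rewrite mulfV// powRr1// subr_ge0.
Qed.

Lemma indep_incr s t U (g : R -> R) : 0 <= s -> s <= t -> Fm s U -> measurable_fun [set: R] g ->
  intg P U -> intg P (fun w => g (B t w - B s w)) ->
  intg P (fun w => U w * g (B t w - B s w)) /\
  EE P (fun w => U w * g (B t w - B s w)) = EE P U * EE P (fun w => g (B t w - B s w)).
Proof.
move=> s0 st hU mg iU iV.
pose U' : {RV P >-> R} := mfun_Sub (mem_set (intg_meas iU)).
pose V' : {RV P >-> R} := mfun_Sub (mem_set (intg_meas iV)).
apply: (@indep_EE _ _ _ P U' V') => // A A' mA mA'.
have mgA : measurable (g @^-1` A') by rewrite -[X in measurable X]setTI; exact: mg.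
exact: (bf_independent hF s0 st (hU A mA) mgA).
Qed.

Lemma mart s t U : 0 <= s -> s <= t -> Fm s U -> intg P U ->
  EE P (fun w => U w * (B t w - B s w)) = 0.
Proof.
move=> s0 st hU iU; have t0 := le_trans s0 st.
have iV := sqint_intg (incr_L2 s0 t0).
have [_ ->] := indep_incr s0 st hU (@measurable_id _ R setT) iU iV.
have i x : 0 <= x -> intg P (B x) by move=> x0; apply: sqint_intg; exact: B_sqint hB _ x0.
have -> : EE P (fun w => B t w - B s w) = 0.
  have -> : (fun w => B t w - B s w) = (fun w => B t w + -1 * B s w).
    by apply/funext => w; rewrite mulN1r.
  by rewrite (EED (i t t0) (intgZ (-1) (i s s0))) (EEZ (-1) (i s s0)) !(B_mean hB)// mulr0 addr0.
by rewrite mulr0.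
Qed.

Lemma qvar_incr s t U : 0 <= s -> s <= t -> Fm s U -> intg P U ->
  EE P (fun w => U w * (B t w - B s w) ^+ 2) = EE P U * (t - s).
Proof.
move=> s0 st hU iU; have t0 := le_trans s0 st.
have [_ iV] := incr_L2 s0 t0.
have [_ ->] := indep_incr s0 st hU (exprn_measurable 2) iU iV.
by rewrite BM_incr_sqr.
Qed.

(** The process c on ]s, t] and 0 elsewhere, with c bounded and known at time s. *)
Record elementary (s t : R) (c : Omega -> R) : Prop := Elementary {
  el_ge0 : 0 <= s;
  el_le : s <= t;
  el_adapted : Fm s c;
  el_bounded : exists M : R, forall w, `|c w| <= M }.

Definition incr (s t : R) (c : Omega -> R) (w : Omega) : R := c w * (B t w - B s w).

Lemma bounded_sqint s t c f : elementary s t c -> sqint P f -> sqint P (fun w => c w * f w).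
Proof.
move=> [s0 st hc [M HM]] [mf hf]; have mc := Fm_meas s0 hc; split; first exact: measurable_funM.
apply: (intg_le _ _ (intgZ (M ^+ 2) hf)); first by apply: measurable_funX; exact: measurable_funM.
move=> w; rewrite ger0_norm ?sqr_ge0// exprMn ler_wpM2r ?sqr_ge0//.
by rewrite -real_normK ?num_real// lerXn2r ?nnegrE// (le_trans _ (HM w)).
Qed.

Lemma el_sqint s t c : elementary s t c -> sqint P c.
Proof. by move=> h; have := bounded_sqint h (sqint_cst P 1); under eq_fun do rewrite mulr1. Qed.

Lemma elementary_incr_sqint s t c : elementary s t c -> sqint P (incr s t c).
Proof.
move=> h; have [s0 st _ _] := h; apply: (bounded_sqint h).
by apply: incr_L2 => //; exact: le_trans st.
Qed.

(** Cutting both increments at the common end m of the overlap leaves one square, of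
    expectation E(c c') (m - s'), and terms in which the later increment is independent
    of everything else and has mean 0. Polarized in this way, the isometry
    holds for families of intervals in any position. *)
Lemma incr_cov s t c s' t' c' : elementary s t c -> elementary s' t' c' ->
  EE P (fun w => incr s t c w * incr s' t' c' w) =
  EE P (fun w => c w * c' w) * overlap s t s' t'.
Proof.
wlog ss' : s t c s' t' c' / s <= s'.
  move=> W h h'; have [ss'|/ltW s's] := leP s s'; first exact: W.
  under [X in EE P X = _]eq_fun do rewrite mulrC.
  under [X in _ = EE P X * _]eq_fun do rewrite mulrC.
  by rewrite W// /overlap (minC t') (maxC s').
move=> h h'; have [s0 st hc bc] := h; have [s'0 st' hc' bc'] := h'.
have t0 := le_trans s0 st; have t'0 := le_trans s'0 st'.
have L2c := el_sqint h; have L2c' := el_sqint h'.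
have icc := sqint_mul L2c L2c'.
have hcs' : Fm s' c := Fm_mono s0 ss' hc.
have hcc : Fm s' (fun w => c w * c' w) by exact: FmM.
have [ts'|/ltW s't] := leP t s'.
  have -> : overlap s t s' t' = 0.
    rewrite /overlap; apply/max_idPl; rewrite subr_le0 (max_idPr ss').
    by rewrite ge_min ts'.
  rewrite mulr0.
  have -> : (fun w => incr s t c w * incr s' t' c' w) =
     (fun w => (c w * c' w * (B t w - B s w)) * (B t' w - B s' w)).
    by apply/funext => w; rewrite /incr; ring.
  apply: mart => //.
    by apply: FmM => //; exact: Fm_incr.
  have -> : (fun w => c w * c' w * (B t w - B s w)) = (fun w => (c w * (B t w - B s w)) * c' w).
    by apply/funext => w; ring.
  by apply: sqint_mul => //; exact: elementary_incr_sqint h.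
set m := Num.min t t'.
have mt : m <= t by rewrite ge_min lexx.
have mt' : m <= t' by rewrite ge_min lexx orbT.
have s'm : s' <= m by rewrite le_min s't st'.
have m0 := le_trans s'0 s'm; have s'0' := s'0.
have -> : overlap s t s' t' = m - s'.
  by rewrite /overlap (max_idPr ss') -/m; apply/max_idPr; rewrite subr_ge0.
have D x y : 0 <= x -> 0 <= y -> sqint P (fun w => B y w - B x w) by exact: incr_L2.
have cD x y : 0 <= x -> 0 <= y -> sqint P (fun w => c w * (B y w - B x w)).
  by move=> x0 y0; apply: (bounded_sqint h); exact: D.
have cD' x y : 0 <= x -> 0 <= y -> sqint P (fun w => c' w * (B y w - B x w)).
  by move=> x0 y0; apply: (bounded_sqint h'); exact: D.
pose T1 w := (c w * c' w * (B s' w - B s w)) * (B t' w - B s' w).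
pose T2 w := (c w * c' w) * (B m w - B s' w) ^+ 2.
pose T3 w := (c w * c' w * (B m w - B s' w)) * (B t' w - B m w).
pose T4 w := (c w * c' w * (B m w - B s' w)) * (B t w - B m w).
have -> : (fun w => incr s t c w * incr s' t' c' w) = (fun w => T1 w + (T2 w + (T3 w + T4 w))).
  apply/funext => w; rewrite /incr /T1 /T2 /T3 /T4.
  (* m is one of t and t' *)
  have : (B t w - B m w) * (B t' w - B m w) = 0.
    by rewrite /m minEle; case: ifP => _; rewrite subrr ?mul0r ?mulr0.
  move: (B t w) (B t' w) (B m w) (B s w) (B s' w) => x x' y z z' e0.
  have -> : c w * (x - z) * (c' w * (x' - z')) = c w * c' w * ((x - z) * (x' - z') - (x - y) * (x' - y)).
    by rewrite e0 subr0; ring.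
  by ring.
have ccI x y : 0 <= x -> 0 <= y -> intg P (fun w => c w * c' w * (B y w - B x w)).
  move=> x0 y0; have := sqint_mul (cD x y x0 y0) L2c'.
  by congr intg; apply/funext => w; ring.
have prodI x y x' y' : 0 <= x -> 0 <= y -> 0 <= x' -> 0 <= y' ->
    intg P (fun w => c w * c' w * (B y w - B x w) * (B y' w - B x' w)).
  move=> x0 y0 x'0 y'0; have := sqint_mul (cD x y x0 y0) (cD' x' y' x'0 y'0).
  by congr intg; apply/funext => w; ring.
have I1 : intg P T1 by exact: prodI.
have I2 : intg P T2.
  by have := prodI s' m s' m s'0 m0 s'0 m0; congr intg; apply/funext => w; rewrite /T2; ring.
have I3 : intg P T3 by exact: prodI.
have I4 : intg P T4 by exact: prodI.
rewrite EED//; last by apply: intgD => //; exact: intgD.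
rewrite EED//; last by apply: intgD.
rewrite EED//.
have -> : EE P T1 = 0.
  apply: mart => //; last exact: ccI.
  by apply: FmM => //; exact: Fm_incr.
have -> : EE P T2 = EE P (fun w => c w * c' w) * (m - s') by exact: qvar_incr.
have Fm3 : Fm m (fun w => c w * c' w * (B m w - B s' w)).
  apply: FmM => //; first exact: Fm_mono hcc.
  exact: Fm_incr.
have -> : EE P T3 = 0 by apply: mart => //; exact: ccI.
have -> : EE P T4 = 0 by apply: mart => //; exact: ccI.
by rewrite add0r !addr0.
Qed.

Section Family.
Variables (I : finType) (s t : I -> R) (c : I -> Omega -> R) (T : R).
Hypotheses (hel : forall i, elementary (s i) (t i) (c i)) (hT : forall i, t i <= T).

(** Families of elementary processes are indexed by an arbitrary finite type, with no
    order on the intervals: the difference of two simple processes with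
    different partitions is again such a family. *)
Definition fam_eval (u : R) (w : Omega) : R := \sum_i c i w * ind (s i) (t i) u.
Definition fam_int (w : Omega) : R := \sum_i incr (s i) (t i) (c i) w.
Definition fam_energy (w : Omega) : R := \I_[0, T] (fun u => fam_eval u w ^+ 2).

Lemma fam_eval_lbm w : lbm (fun u => fam_eval u w).
Proof. by apply: lbm_sum => i; apply: lbmZ; exact: lbm_ind. Qed.

Lemma fam_energyE w : fam_energy w =
  \sum_i \sum_j overlap (s i) (t i) (s j) (t j) * (c i w * c j w).
Proof.
rewrite /fam_energy (II_eq (g := fun u => \sum_i \sum_j
   (c i w * c j w) * (ind (s i) (t i) u * ind (s j) (t j) u))); last first.
  move=> u _; rewrite /fam_eval expr2 big_distrlr/=.
  by apply: eq_bigr => i _; apply: eq_bigr => j _; rewrite mulrACA.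
have l i j : lbm (fun u => (c i w * c j w) * (ind (s i) (t i) u * ind (s j) (t j) u)).
  by apply: lbmZ; apply: lbmM; exact: lbm_ind.
rewrite II_sum// => [|i]; last exact: lbm_sum.
apply: eq_bigr => i _; rewrite II_sum//; apply: eq_bigr => j _.
rewrite IIZ//; last by apply: lbmM; exact: lbm_ind.
by rewrite (II_ind2 _ _ (el_ge0 (hel i)) (hT i)) mulrC.
Qed.

Lemma fam_energy_intg : intg P fam_energy.
Proof.
have -> : fam_energy = (fun w => \sum_i \sum_j overlap (s i) (t i) (s j) (t j) * (c i w * c j w)).
  by apply/funext => w; exact: fam_energyE.
apply: intg_sum => i; apply: intg_sum => j; apply: intgZ; apply: sqint_mul; exact: el_sqint (hel _).
Qed.

Lemma fam_int_sqint : sqint P fam_int.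
Proof. by apply: sqint_sum => i; exact: elementary_incr_sqint. Qed.

Lemma ito_isometry : EE P (fun w => fam_int w ^+ 2) = EE P fam_energy.
Proof.
have hs i : sqint P (incr (s i) (t i) (c i)) by exact: elementary_incr_sqint.
have -> : (fun w => fam_int w ^+ 2) = (fun w => (\sum_i 1 * incr (s i) (t i) (c i) w) ^+ 2).
  by apply/funext => w; congr (_ ^+ 2); apply: eq_bigr => i _; rewrite mul1r.
rewrite EE_sqr_sum//.
have -> : fam_energy = (fun w => \sum_i \sum_j overlap (s i) (t i) (s j) (t j) * (c i w * c j w)).
  by apply/funext => w; exact: fam_energyE.
have ic i j : intg P (fun w => c i w * c j w) by apply: sqint_mul; exact: el_sqint (hel _).
rewrite EE_sum => [|i]; last by apply: intg_sum => j; exact: intgZ.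
apply: eq_bigr => i _; rewrite EE_sum => [|j]; last exact: intgZ.
apply: eq_bigr => j _; rewrite EEZ// !mul1r mulrC.
by rewrite incr_cov// mulrC.
Qed.

End Family.

End Ito.

Lemma II_le_obnd (R : realType) (a b : R) (f g : R -> R) : 0 <= a -> lbm f -> lbm g ->
  (forall t, a < t <= b -> f t <= g t) -> \I_[a, b] f <= \I_[a, b] g.
Proof.
move=> a0 lf lg fg.
have sub : `]a, b] `<=` (`[a, b] : set R) by apply: subset_itvr; rewrite bnd_simp.
have io h : lbm h -> lebesgue_measure.-integrable `]a, b] (EFin \o h).
  by move=> lh; apply: integrableS (lbm_integrable b a0 lh).
rewrite -[X in X <= _](@Rintegral_itv_obnd_cbnd R a (BRight b) f (io f lf)).
rewrite -[X in _ <= X](@Rintegral_itv_obnd_cbnd R a (BRight b) g (io g lg)).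
by apply: le_Rintegral => [//|||x /=]; [exact: io|exact: io|rewrite in_itv/=; exact: fg].
Qed.

Section LowerIntegral.
Context (R : realType) (d : measure_display) (Omega : measurableType d).
Variable P : probability Omega R.

Lemma ge0_le_integral_nonmeasurable (m g : Omega -> \bar R) :
  (forall w, 0 <= m w)%E -> (forall w, m w <= g w)%E ->
  (\int[P]_w m w <= \int[P]_w g w)%E.
Proof.
move=> m0 mg; have g0 w : (0 <= g w)%E := le_trans (m0 w) (mg w).
rewrite !ge0_integralTE//; apply: ge_ereal_sup => _ [h /= hm <-]; apply: ereal_sup_ubound.
by exists h => //= w; exact: le_trans (hm w) (mg w).
Qed.

(** The integral of g is only a supremum over simple functions below g, as g need not
    be measurable. It still dominates the integral of the measurable function
    max(0, h - v'), where v' is a measurable majorant of v. *)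
Lemma Ele_nonmeasurable (h v : Omega -> R) (g : Omega -> \bar R) (delta V : R) :
  measurable_fun [set: Omega] h -> (forall w, 0 <= h w) -> (forall w, 0 <= g w)%E ->
  (\int[P]_w g w <= delta%:E)%E -> Ele P v V ->
  {ae P, forall w, ((h w)%:E <= g w + (v w)%:E)%E} -> Ele P h (delta + V).
Proof.
move=> mh h0 g0 gd [v' [mv' v'0 v'V vv']] hgv.
have [N [mN PN HN]] := filterI hgv vv'.
have bad w : ~ N w -> ((h w)%:E <= g w + v' w)%E.
  move=> nN; have : ~ ~ (((h w)%:E <= g w + (v w)%:E)%E /\ ((v w)%:E <= v' w)%E).
    by move=> h1; apply: nN; apply: HN.
  move=> /contrapT[h1 h2]; apply: le_trans h1 _; exact: leeD2l.
(* the null set on which the comparison may fail is removed to keep m below g *)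
pose m w := (maxe 0 ((h w)%:E - v' w) * (\1_(~` N) w)%:E)%E.
have mm : measurable_fun [set: Omega] m.
  apply: emeasurable_funM.
    apply: measurable_maxe; first exact: measurable_cst.
    by apply: emeasurable_funB => //; exact/measurable_EFinP.
  by apply/measurable_EFinP; apply: measurable_indic; exact: measurableC.
have m0 w : (0 <= m w)%E by rewrite mule_ge0// le_max lexx.
have mg w : (m w <= g w)%E.
  rewrite /m indicE; have [wN|wN] := boolP (w \in ~` N); last by rewrite mule0.
  rewrite mule1 ge_max g0/=.
  have := bad w (set_mem wN); case: (v' w) (v'0 w) => [r| |]//= r0.
    by rewrite -leeBlDr.
  by move=> _; rewrite leNye.
exists (fun w => m w + v' w)%E; split.
- exact: emeasurable_funD.
- by move=> w; rewrite adde_ge0.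
- rewrite ge0_integralD// EFinD leeD//.
  apply: le_trans gd; exact: ge0_le_integral_nonmeasurable.
- exists N; split => // w /= hw; apply: contrapT => wN; apply: hw.
  rewrite /m indicE mem_set// mule1.
  case E : (v' w) (v'0 w) => [r| |]//= r0.
    by rewrite -leeBlDr// le_max lexx orbT.
  by rewrite addey ?leey//.
Qed.

Lemma EE_le_Ele (h : Omega -> R) C : intg P h -> (forall w, 0 <= h w) -> Ele P h C -> EE P h <= C.
Proof.
move=> ih h0 [g [mg g0 gC hg]]; rewrite -lee_fin -EE_fine//; apply: le_trans gC.
apply: ae_ge0_le_integral => //.
- by move=> w _; rewrite lee_fin.
- by apply/measurable_EFinP; exact: (intg_meas ih).
- by apply: filterS hg => w H _.
Qed.

End LowerIntegral.

Section ItoBounds.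
Context (R : realType) (d : measure_display) (Omega : measurableType d).
Variables (P : probability Omega R) (B : R -> {RV P >-> R}) (F : R -> set (set Omega)).
Hypotheses (hB : fractional_brownian_motion 2^-1 B) (hF : brownian_filtration B F).

Section Simple.
Variables (T : R) (S : simple_process F T).

Definition sp_s (i : 'I_(sp_size S)) : R := sp_time S i.
Definition sp_t (i : 'I_(sp_size S)) : R := sp_time S i.+1.
Definition sp_c (i : 'I_(sp_size S)) : Omega -> R := sp_coef S i.

Lemma sp_time_homo i j : (i <= j)%N -> (j <= sp_size S)%N -> sp_time S i <= sp_time S j.
Proof.
elim: j => [|j IH]; first by rewrite leqn0 => /eqP ->.
rewrite leq_eqVlt => /predU1P[->//|ij] js.
by apply: le_trans (IH ij (ltnW js)) _; exact: sp_time_le.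
Qed.

Lemma sp_elementary i : elementary F (sp_s i) (sp_t i) (sp_c i).
Proof.
split.
- by apply: le_trans (sp_time_ge0 S) (sp_time_homo _ _) => //; exact: ltnW.
- exact: sp_time_le.
- by move=> A mA; exact: sp_coef_adapted.
- exact: sp_coef_bounded.
Qed.

Lemma sp_t_le i : sp_t i <= T.
Proof. by apply: le_trans (sp_time_homo _ _) (sp_time_leT S) => //. Qed.

Lemma sp_eval_lbm w : lbm (fun u => sp_eval S u w).
Proof. exact: (fam_eval_lbm sp_s sp_t sp_c w). Qed.

End Simple.

Lemma ereal_Rintegral (f : R -> R) (T : R) : lbm f ->
  (\int[lebesgue_measure]_(s in `[0%R, T]) (f s)%:E)%E = (\I_[0, T] f)%:E.
Proof.
move=> lf; rewrite /Rintegral fineK//; apply: integrable_fin_num => //.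
exact: lbm_integrable.
Qed.

(** A single simple process within distance 1 is enough, since only orders of
    magnitude matter. *)
Lemma ito_approx (T : R) (Y : R -> Omega -> R) (J : {RV P >-> R}) :
  is_ito_integral F B T Y J ->
  exists S : simple_process F T,
    (\int[P]_w \int[lebesgue_measure]_(s in `[0%R, T])
        ((sp_eval S s w - Y s w) ^+ 2)%:E <= 1%:E)%E /\
    Ele P (fun w => (sp_integral (fun t => B t : Omega -> R) S w - J w) ^+ 2) 1.
Proof.
move=> [S [h1 h2]].
have small (u : nat -> \bar R) : u @ \oo --> 0%E -> \forall k \near \oo, (u k <= 1%:E)%E.
  move=> u0; have : (0 < 1%:E :> \bar R)%E by rewrite lte_fin.
  move=> /open_ereal_lt' h; have : \forall k \near \oo, (u k < 1%:E)%E by exact: u0 _ h.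
  by apply: filterS => k /ltW.
have [N1 _ H1] := small _ h1; have [N2 _ H2] := small _ h2.
have h3 := H1 (maxn N1 N2) (leq_maxl _ _); have h4 := H2 (maxn N1 N2) (leq_maxr _ _).
move: (maxn N1 N2) h3 h4 => k /= h3 h4.
exists (S k); split => //.
apply: Ele_integral => //; last by move=> w; exact: sqr_ge0.
apply: measurable_funX; apply: measurable_funB => //.
have [mI _] := fam_int_sqint hB hF (@sp_elementary T (S k)); exact: mI.
Qed.

(** The approximating simple process has energy at most 2 (1 + V) by the
    triangle inequality; the isometry transfers this to its integral, which is at
    distance at most 1 from J. *)
Lemma ito_L2 (n : nat) (Y : R -> Omega -> R) (J : {RV P >-> R}) (V : R) :
  is_ito_integral F B n%:R Y J -> {ae P, forall w, lbm (fun s => Y s w)} ->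
  Ele P (fun w => \I_[0, n%:R] (fun s => Y s w ^+ 2)) V ->
  Ele P (fun w => J w ^+ 2) (6 + 4 * V).
Proof.
move=> /ito_approx[S [hG hJ]] lY hV.
have hel := @sp_elementary _ S; have hT := @sp_t_le _ S.
pose e := fam_energy (@sp_s _ S) (@sp_t _ S) (@sp_c _ S) n%:R.
have ie : intg P e.
  have := fam_energy_intg hF hel hT; exact.
have e0 w : 0 <= e w by apply: II_ge0 => u _; exact: sqr_ge0.
have he : Ele P (fun w => 2^-1 * e w) (1 + V).
  apply: (Ele_nonmeasurable _ _ _ hG hV).
  - by apply: measurable_funM => //; exact: (intg_meas ie).
  - by move=> w; rewrite mulr_ge0 ?invr_ge0.
  - by move=> w; apply: integral_ge0 => s _; rewrite lee_fin sqr_ge0.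
  - apply: filterS lY => w lYw; have lS := sp_eval_lbm S w.
    rewrite ereal_Rintegral; last by apply: lbmX2; exact: lbmB.
    rewrite -EFinD lee_fin -ler_pdivlMl ?invr_gt0// invrK mulrDr.
    rewrite -!IIZ//; [|exact: lbmX2|by apply: lbmX2; exact: lbmB].
    rewrite -IID//; [|by apply: lbmZ; apply: lbmX2; exact: lbmB|by apply: lbmZ; exact: lbmX2].
    apply: II_le => //; first exact: lbmX2.
      by apply: lbmD; apply: lbmZ; apply: lbmX2 => //; exact: lbmB.
    move=> s _; rewrite {1}(_ : fam_eval _ _ _ s w = (sp_eval S s w - Y s w) + Y s w).
      exact: sqrD_le2.
    by rewrite subrK.
have hI : Ele P (fun w => fam_int B (@sp_s _ S) (@sp_t _ S) (@sp_c _ S) w ^+ 2) (2 * (1 + V)).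
  apply: Ele_sqint; first by have := fam_int_sqint hB hF hel; exact.
  rewrite (ito_isometry hB hF hel hT) -ler_pdivrMl// -EEZ//; apply: EE_le_Ele => //.
  - exact: intgZ.
  - by move=> w; rewrite mulr_ge0 ?invr_ge0.
apply: Ele_le (EleD (EleZ (c := 2) (ler0n _ _) hJ) (EleZ (c := 2) (ler0n _ _) hI)); last by lra.
apply: aeW => w; set I := sp_integral _ _ _.
rewrite -[fam_int _ _ _ _ w]/I.
rewrite [X in X ^+ 2 <= _](_ : _ = - (I - J w) + I); last by ring.
by apply: le_trans (sqrD_le2 _ _) _; rewrite sqrrN.
Qed.

Section Deterministic.
Variables (phi : R -> R) (M : R).
Hypotheses (lphi : lbm phi) (bphi : forall t, `|phi t| <= M).

(** For a deterministic integrand, the distance to a simple process is a polynomial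
    in the coefficients of that process, hence is measurable. *)
Lemma ito_approx_deterministic (T : R) (J : {RV P >-> R}) : 0 <= T ->
  is_ito_integral F B T (fun t _ => phi t) J ->
  exists S : simple_process F T,
    Ele P (fun w => \I_[0, T] (fun s => (sp_eval S s w - phi s) ^+ 2)) 1 /\
    Ele P (fun w => (sp_integral (fun t => B t : Omega -> R) S w - J w) ^+ 2) 1.
Proof.
move=> T0 /ito_approx[S [hG hJ]]; exists S; split => //.
have hel := @sp_elementary _ S; have hT := @sp_t_le _ S.
have lS w := sp_eval_lbm S w.
have lSp w : lbm (fun s => (sp_eval S s w - phi s) ^+ 2) by apply: lbmX2; exact: lbmB.
apply: Ele_integral.
- pose g i s := ind (@sp_s _ S i) (sp_t i) s * phi s.
  have -> : (fun w => \I_[0, T] (fun s => (sp_eval S s w - phi s) ^+ 2)) =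
    (fun w => fam_energy (@sp_s _ S) (@sp_t _ S) (@sp_c _ S) T w
        + (-2 * (\sum_i sp_c i w * \I_[0, T] (g i)) + \I_[0, T] (fun s => phi s ^+ 2))).
    apply/funext => w.
    have lg i : lbm (g i) by apply: lbmM => //; exact: lbm_ind.
    have -> : \sum_i sp_c i w * \I_[0, T] (g i) = \I_[0, T] (fun s => sp_eval S s w * phi s).
      under eq_bigr => i _ do rewrite -IIZ//.
      rewrite -II_sum// => [|i]; last exact: lbmZ.
      apply: II_eq => s _; rewrite [in RHS]/sp_eval mulr_suml.
      by apply: eq_bigr => i _; rewrite /g mulrA.
    have lSphi : lbm (fun s => sp_eval S s w * phi s) by exact: lbmM.
    rewrite -IIZ// -IID//; [|exact: lbmZ|exact: lbmX2].
    have lS2 : lbm (fun s => fam_eval (@sp_s _ S) (@sp_t _ S) (@sp_c _ S) s w ^+ 2).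
      by apply: lbmX2; exact: (lS w).
    rewrite -IID//; last by apply: lbmD; [exact: lbmZ|exact: lbmX2].
    apply: II_eq => s _; rewrite -[fam_eval _ _ _ s w]/(sp_eval S s w); ring.
  apply: measurable_funD; first exact: (intg_meas (fam_energy_intg hF hel hT)).
  apply: measurable_funD => //; apply: measurable_funM => //.
  apply: measurable_sum => i; apply: measurable_funM => //.
  exact: (Fm_meas hF (el_ge0 (hel i)) (el_adapted (hel i))).
- by move=> w; apply: II_ge0 => s _; exact: sqr_ge0.
- apply: le_trans hG; rewrite le_eqVlt; apply/predU1P; left.
  by apply: eq_integral => w _; rewrite ereal_Rintegral.
Qed.

Lemma sp_eval_after (T s : R) (S : simple_process F T) w : T < s -> sp_eval S s w = 0.
Proof.
move=> Ts; rewrite /sp_eval big1// => i _; rewrite -/(ind (sp_s i) (sp_t i) s) indE.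
by rewrite [s <= _]leNgt (le_lt_trans (sp_t_le i) Ts) andbF mulr0.
Qed.

(** The two integrals are defined by unrelated approximations on different intervals.
    The difference of the two simple processes is one finite family, to which the
    isometry applies; on [0, n] both are close to phi, and on ]n, n + 1] only the
    second one is present. *)
Lemma ito_increment (n : nat) (J1 J2 : {RV P >-> R}) :
  is_ito_integral F B n%:R (fun t _ => phi t) J1 ->
  is_ito_integral F B n.+1%:R (fun t _ => phi t) J2 ->
  Ele P (fun w => (J2 w - J1 w) ^+ 2) (16 + 4 * M ^+ 2).
Proof.
move=> /(ito_approx_deterministic (ler0n _ _))[S1 [hG1 hJ1]].
move=> /(ito_approx_deterministic (ler0n _ _))[S2 [hG2 hJ2]].
have nS : n%:R <= n.+1%:R :> R by rewrite ler_nat.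
pose s (i : 'I_(sp_size S2) + 'I_(sp_size S1)) := match i with inl j => sp_s j | inr j => sp_s j end.
pose t (i : 'I_(sp_size S2) + 'I_(sp_size S1)) := match i with inl j => sp_t j | inr j => sp_t j end.
(* the simple process for n + 1, minus the one for n *)
pose c (i : 'I_(sp_size S2) + 'I_(sp_size S1)) :=
  match i with inl j => sp_c j | inr j => fun w => - sp_c j w end.
have hel i : elementary F (s i) (t i) (c i).
  case: i => j /=; first exact: sp_elementary.
  have [s0 st hc [K hK]] := sp_elementary j; split => //.
    by apply/(FmP hF _ s0); apply: measurableT_comp => //; exact/(FmP hF _ s0).
  by exists K => w; rewrite normrN.
have hT i : t i <= n.+1%:R.
  case: i => j /=; first exact: sp_t_le.
  by apply: le_trans nS; exact: sp_t_le.
have evE u w : fam_eval s t c u w = sp_eval S2 u w - sp_eval S1 u w.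
  rewrite /fam_eval big_sumType/=; congr (_ + _).
  by rewrite /sp_eval -sumrN; apply: eq_bigr => i _; rewrite mulNr.
pose i1 w := sp_integral (fun t => B t : Omega -> R) S1 w.
pose i2 w := sp_integral (fun t => B t : Omega -> R) S2 w.
have intE w : fam_int B s t c w = i2 w - i1 w.
  rewrite /fam_int big_sumType/=; congr (_ + _).
  by rewrite /i1 /sp_integral -sumrN; apply: eq_bigr => i _; rewrite /incr mulNr.
have ie := fam_energy_intg hF hel hT.
have e0 w : 0 <= fam_energy s t c n.+1%:R w by apply: II_ge0 => u _; exact: sqr_ge0.
have M0 : 0 <= M ^+ 2 by exact: sqr_ge0.
have hE : Ele P (fam_energy s t c n.+1%:R) (2 * 1 + 2 * 1 + 2 * M ^+ 2).
  apply: Ele_le (EleD (EleD (EleZ (c := 2) (ler0n _ _) hG2) (EleZ (c := 2) (ler0n _ _) hG1))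
    (Ele_cst P (_ : 0 <= 2 * M ^+ 2))) => //; last by rewrite mulr_ge0.
  apply: aeW => w; rewrite /fam_energy.
  have l1 := sp_eval_lbm S1 w; have l2 := sp_eval_lbm S2 w.
  have l1p : lbm (fun u => (sp_eval S1 u w - phi u) ^+ 2) by apply: lbmX2; exact: lbmB.
  have l2p : lbm (fun u => (sp_eval S2 u w - phi u) ^+ 2) by apply: lbmX2; exact: lbmB.
  have le : lbm (fun u => fam_eval s t c u w ^+ 2) by apply: lbmX2; exact: fam_eval_lbm.
  rewrite (II_split (lexx 0) (ler0n _ _) nS le) (II_split (lexx 0) (ler0n _ _) nS l2p).
  have h1 : \I_[0, n%:R] (fun u => fam_eval s t c u w ^+ 2) <=
     2 * \I_[0, n%:R] (fun u => (sp_eval S2 u w - phi u) ^+ 2) +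
     2 * \I_[0, n%:R] (fun u => (sp_eval S1 u w - phi u) ^+ 2).
    rewrite -!IIZ// -IID//; [|exact: lbmZ|exact: lbmZ].
    apply: II_le => //; first by apply: lbmD; exact: lbmZ.
    move=> u _; rewrite evE.
    have -> : sp_eval S2 u w - sp_eval S1 u w = (sp_eval S2 u w - phi u) + - (sp_eval S1 u w - phi u) by ring.
    by apply: le_trans (sqrD_le2 _ _) _; rewrite sqrrN.
  have h2 : \I_[n%:R, n.+1%:R] (fun u => fam_eval s t c u w ^+ 2) <=
     2 * \I_[n%:R, n.+1%:R] (fun u => (sp_eval S2 u w - phi u) ^+ 2) + 2 * M ^+ 2.
    have -> : 2 * M ^+ 2 = \I_[n%:R, n.+1%:R] (fun _ => 2 * M ^+ 2).
      by rewrite II_cst// -[n.+1%:R]natr1; ring.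
    rewrite -!IIZ// -IID//; [|exact: lbmZ|exact: lbm_cst].
    apply: II_le_obnd => //; first by apply: lbmD; [exact: lbmZ|exact: lbm_cst].
    move=> u /andP[nu _]; rewrite evE (sp_eval_after _ _ nu) subr0.
    rewrite [X in X ^+ 2 <= _](_ : _ = (sp_eval S2 u w - phi u) + phi u); last by ring.
    apply: le_trans (sqrD_le2 _ _) _; rewrite lerD2l ler_wpM2l//.
    by rewrite -real_normK ?num_real// lerXn2r ?nnegrE// (le_trans _ (bphi u)).
  by lra.
have hI : Ele P (fun w => fam_int B s t c w ^+ 2) (4 + 2 * M ^+ 2).
  apply: Ele_sqint; first by have := fam_int_sqint hB hF hel; exact.
  rewrite (ito_isometry hB hF hel hT); apply: EE_le_Ele => //.
  by apply: Ele_le hE; [exact: aeW|lra].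
apply: Ele_le (EleD (EleD (EleZ (c := 4) (ler0n _ _) hJ2) (EleZ (c := 4) (ler0n _ _) hJ1))
  (EleZ (c := 2) (ler0n _ _) hI)); last by lra.
apply: aeW => w; rewrite intE -/(i1 w) -/(i2 w).
have := sqrD_le2 (J2 w - i2 w - (J1 w - i1 w)) (i2 w - i1 w).
have := sqrD_le2 (J2 w - i2 w) (- (J1 w - i1 w)).
have -> : J2 w - i2 w - (J1 w - i1 w) + (i2 w - i1 w) = J2 w - J1 w by ring.
rewrite sqrrN -[(i2 w - J2 w) ^+ 2]sqrrN -[(i1 w - J1 w) ^+ 2]sqrrN !opprB.
by lra.
Qed.

End Deterministic.

End ItoBounds.

(** * Small balls and nondegeneracy of the limit *)

Section SmallBalls.
Variable R : realType.
Local Notation mu := lebesgue_measure.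

Lemma normal_prob_ball (m s x e : R) : s != 0 -> 0 <= e ->
  (normal_prob m s (`](x - e)%R, (x + e)%R[%classic) <= (normal_peak s * (2 * e))%:E)%E.
Proof.
move=> s0 e0; rewrite /normal_prob.
apply: le_trans (_ : \int[mu]_(y in `](x - e)%R, (x + e)%R[) (normal_peak s)%:E <= _)%E.
  apply: ge0_le_integral => //.
  - by move=> y _; rewrite lee_fin normal_pdf_ge0.
  - by apply/measurable_EFinP; apply: measurable_funTS; exact: measurable_normal_pdf.
  - by move=> y _; rewrite lee_fin normal_pdf_ub.
rewrite integral_cst//= lebesgue_measure_itv/= lte_fin.
have [h|h] := ltP; last by rewrite mule0 lee_fin mulr_ge0 ?normal_peak_ge0 ?mulr_ge0.
rewrite -EFinB -EFinM lee_fin ler_wpM2l ?normal_peak_ge0//; lra.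
Qed.

(** Since y - m is at least k standard deviations, a part of the exponent can be
    traded for the factor e^(-k/4); the rest is the density of a
    Gaussian variable with twice the standard deviation. *)
Lemma normal_pdf_tail (m s y : R) k : s != 0 -> k%:R * `|s| <= `|y - m| ->
  normal_pdf m s y <= 2 * expR (- 4^-1 * k%:R) * normal_pdf m (2 * s) y.
Proof.
move=> s0 hy; have s20 : 2 * s != 0 by rewrite mulf_neq0.
rewrite !normal_pdfE// /normal_peak /normal_fun.
have s2 : 0 < s ^+ 2 by rewrite exprn_even_gt0.
have -> : Num.sqrt ((2 * s) ^+ 2 * pi *+ 2) = 2 * Num.sqrt (s ^+ 2 * pi *+ 2).
  rewrite exprMn -mulrA -mulrnAr sqrtrM ?sqr_ge0// sqrtr_sqr ger0_norm//.
set q := Num.sqrt _; have q0 : 0 < q.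
  by rewrite sqrtr_gt0 mulrn_wgt0// mulr_gt0 ?pi_gt0.
rewrite [leRHS](_ : _ = q^-1 *
  (expR (- 4^-1 * k%:R) * expR (- (y - m) ^+ 2 / ((2 * s) ^+ 2 *+ 2)))); last first.
  by field; rewrite gt_eqF.
rewrite ler_wpM2l ?invr_ge0 ?(ltW q0)// -expRD ler_expR.
have h : k%:R ^+ 2 * s ^+ 2 <= (y - m) ^+ 2.
  rewrite -[s ^+ 2]real_normK ?num_real// -[(y - m) ^+ 2]real_normK ?num_real// -exprMn.
  by rewrite lerXn2r ?nnegrE ?mulr_ge0.
have kk : k%:R <= k%:R ^+ 2 :> R by case: (k) => [|k']; rewrite -natrX ler_nat// leq_pmulr.
set z := (y - m) ^+ 2 in h *.
have -> : - z / (s ^+ 2 *+ 2) = - (z / s ^+ 2) / 2 by field.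
have -> : - z / ((2 * s) ^+ 2 *+ 2) = - (z / s ^+ 2) / 8 by field.
have : k%:R ^+ 2 <= z / s ^+ 2 by rewrite ler_pdivlMr.
by have := ler0n R k; move: (z / _) => u; lra.
Qed.

Lemma measurable_far (m a : R) : measurable [set y : R | a <= `|y - m|].
Proof.
have -> : [set y : R | a <= `|y - m|] = (fun y => `|y - m|) @^-1` `[a, +oo[.
  by apply/seteqP; split=> y /=; rewrite in_itv/= andbT.
rewrite -[X in measurable X]setTI.
have h : measurable_fun [set: R] (fun y => `|y - m|).
  by apply: measurableT_comp => //; exact: measurable_funB.
exact: h.
Qed.

Lemma normal_prob_tail (m s : R) k : s != 0 ->
  (normal_prob m s [set y : R | (k%:R * `|s| <= `|y - m|)%R] <= (2 * expR (- 4^-1 * k%:R))%:E)%E.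
Proof.
move=> s0; set A := [set y | _].
have mA : measurable A.
  exact: measurable_far.
rewrite /normal_prob.
apply: le_trans (_ : \int[mu]_(y in A) ((2 * expR (- 4^-1 * k%:R))%:E * (normal_pdf m (2 * s) y)%:E) <= _)%E.
  apply: ge0_le_integral => //.
  - by move=> y _; rewrite lee_fin normal_pdf_ge0.
  - by apply/measurable_EFinP; apply: measurable_funTS; exact: measurable_normal_pdf.
  - by apply: measurable_funeM; apply/measurable_EFinP; apply: measurable_funTS; exact: measurable_normal_pdf.
  - by move=> y Ay; rewrite -EFinM lee_fin normal_pdf_tail.
have c0 : 0 <= 2 * expR (- 4^-1 * k%:R) :> R by rewrite mulr_ge0// expR_ge0.
rewrite ge0_integralZl//=.
- rewrite -[leRHS]mule1 lee_wpmul2l// -(integral_normal_pdf m (2 * s)).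
  apply: ge0_subset_integral => //.
  + by apply/measurable_EFinP; exact: measurable_normal_pdf.
  + by move=> y _; rewrite lee_fin normal_pdf_ge0.
- by apply/measurable_EFinP; apply: measurable_funTS; exact: measurable_normal_pdf.
- by move=> y _; rewrite lee_fin normal_pdf_ge0.
Qed.

Lemma sum_odd n : \sum_(0 <= k < n) (2 * k%:R + 1) = n%:R ^+ 2 :> R.
Proof.
elim: n => [|n IH]; first by rewrite big_geq// expr0n.
by rewrite big_nat_recr//= IH -[n.+1%:R]natr1; ring.
Qed.

Context (d : measure_display) (Omega : measurableType d).
Variable P : probability Omega R.

Lemma Ele_indic (A : set Omega) C : measurable A -> (P A <= C%:E)%E -> Ele P (\1_A) C.
Proof.
move=> mA PA; apply: Ele_integral.
- exact: measurable_indic.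
- by move=> w; rewrite indicE.
- by rewrite integral_indic// setIT.
Qed.

(** The second moment is summed over the tails: (Z - m)^2 is at most
    s^2 times the sum of the odd numbers 2 k + 1 over those k with
    k |s| <= |Z - m|. *)
Lemma gaussian_second_moment : exists2 K : R, 0 < K & forall (Z : Omega -> R) m s, s != 0 ->
  measurable_fun [set: Omega] Z ->
  (forall A : set R, measurable A -> P (Z @^-1` A) = normal_prob m s A) ->
  Ele P (fun w => (Z w - m) ^+ 2) (K * s ^+ 2).
Proof.
have [K K0 HK] := @sum_sqr_expN R 4^-1 (ltac:(lra)).
exists (4 * K); first by rewrite mulr_gt0.
move=> Z m s s0 mZ hZ.
(* the tail events, each of probability at most 2 e^(-k/4) *)
pose A k := [set w | k%:R * `|s| <= `|Z w - m|].
have mB k : measurable [set y : R | k%:R * `|s| <= `|y - m|].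
  exact: measurable_far.
have mA k : measurable (A k) by have h := mZ measurableT _ (mB k); rewrite setTI in h; exact: h.
have hA k : Ele P (\1_(A k)) (2 * expR (- 4^-1 * k%:R)).
  apply: Ele_indic => //; have := hZ _ (mB k); rewrite [X in P X = _]/= => ->.
  exact: normal_prob_tail.
pose G n w := s ^+ 2 * \sum_(0 <= k < n) (2 * k%:R + 1) * \1_(A k) w.
have hG n : Ele P (G n) (4 * K * s ^+ 2).
  have h := @Ele_sum _ _ _ P _ (index_iota 0 n) _ _ (fun k : nat =>
     EleZ (c := 2 * k%:R + 1) (ltac:(by rewrite addr_ge0// mulr_ge0)) (hA k)).
  apply: Ele_le (EleZ (c := s ^+ 2) (sqr_ge0 _) h); first exact: aeW.
  rewrite [leRHS]mulrC ler_wpM2l ?sqr_ge0//.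
  apply: le_trans (_ : 4 * \sum_(0 <= k < n) expR (- 4^-1 * k%:R) * k.+1%:R ^+ 2 <= _); last first.
    by rewrite ler_wpM2l.
  rewrite mulr_sumr; apply: ler_sum_nat => k _.
  rewrite [leRHS]mulrCA [leLHS]mulrA [leLHS]mulrC ler_wpM2l ?expR_ge0//.
  rewrite -[k.+1%:R]natr1; have := ler0n R k; move: (k%:R : R) => x x0; nra.
apply: (Ele_fatou hG); apply: aeW => w e e0.
have s1 : 0 < `|s| by rewrite normr_gt0.
have [N HN] := nat_ge (`|Z w - m| / `|s|).
exists N.+1 => // n /= Nn; apply: le_trans (_ : G n w <= _); last by rewrite lerDl ltW.
have ex : exists k : nat, k%:R * `|s| <= `|Z w - m| by exists 0%N; rewrite mul0r.
have ub k : k%:R * `|s| <= `|Z w - m| -> (k <= N)%N.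
  by rewrite -ler_pdivlMr// => h; rewrite -(ler_nat R); exact: le_trans HN.
case: (ex_maxnP ex ub) => k hk hmax.
have kN : (k.+1 <= n)%N by apply: leq_trans Nn; rewrite ltnS; exact: ub.
rewrite /G (big_cat_nat (leq0n k.+1) kN)/= mulrDr.
apply: le_trans (_ : s ^+ 2 * \sum_(0 <= i < k.+1) (2 * i%:R + 1) * \1_(A i) w <= _); last first.
  rewrite lerDl mulr_ge0 ?sqr_ge0//; apply: sumr_ge0 => i _.
  by rewrite mulr_ge0 ?addr_ge0 ?mulr_ge0// indicE.
rewrite (eq_big_nat _ _ (F2 := fun i => 2 * i%:R + 1)) => [|i /andP[_ ik]]; last first.
  rewrite indicE mem_set ?mulr1//= /A/=; apply: le_trans hk.
  by rewrite ler_wpM2r// ler_nat -ltnS.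
rewrite sum_odd -[_ ^+ 2]real_normK ?num_real// -[s ^+ 2]real_normK ?num_real// -exprMn.
rewrite lerXn2r ?nnegrE ?mulr_ge0// mulrC leNgt; apply/negP => /ltW /hmax.
by rewrite ltnn.
Qed.

(** The density is at most its peak, of order 1 / |s|, and s^2 is bounded below by the
    variance up to a constant factor. A variable that is almost surely constant has variance 0 and is
    excluded. *)
Lemma gaussian_small_ball (v : R) : 0 < v -> exists2 C : R, 0 < C &
  forall Z : Omega -> R, gaussian_variable P Z -> sqint P Z ->
  (forall m, v <= EE P (fun w => (Z w - m) ^+ 2)) ->
  forall x e : R, 0 < e -> Ele P (fun w => ((`|Z w - x| < e)%R)%:R) (C * e).
Proof.
move=> v0; have [K K0 HK] := gaussian_second_moment.
have vK : 0 < v / K by rewrite divr_gt0.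
exists (2 * (Num.sqrt (v / K * pi *+ 2))^-1).
  by rewrite mulr_gt0// invr_gt0 sqrtr_gt0 mulrn_wgt0// mulr_gt0// pi_gt0.
move=> Z [m [s [[s0 hZ]|hZ]]] hL hv x e e0; last first.
  exfalso; have := hv m; rewrite leNgt => /negP; apply.
  have [mZ hZm] := sqintB hL (sqint_cst P m).
  apply: le_lt_trans v0; apply: EE_le_Ele => //; first by move=> w; exact: sqr_ge0.
  apply: Ele_le (Ele_cst P (lexx 0)) => //.
  by apply: filterS hZ => w ->; rewrite subrr expr0n.
have [mZ hZm] := sqintB hL (sqint_cst P m).
have hs : v / K <= s ^+ 2.
  rewrite ler_pdivrMr// mulrC; apply: le_trans (hv m) _.
  apply: EE_le_Ele => //; first by move=> w; exact: sqr_ge0.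
  by apply: HK => //; case: hL.
pose A := Z @^-1` `]x - e, x + e[%classic.
have mA : measurable A 
  by case: hL => mZ' _; have h := mZ' measurableT _ (measurable_itv `]x - e, x + e[); rewrite setTI in h; exact: h.
have hA : Ele P (\1_A) (2 * (Num.sqrt (v / K * pi *+ 2))^-1 * e).
  apply: Ele_indic => //; rewrite hZ//; apply: le_trans (normal_prob_ball _ _ s0 (ltW e0)) _.
  rewrite lee_fin [leLHS](_ : _ = 2 * normal_peak s * e); last by ring.
  rewrite ler_wpM2r ?(ltW e0)// ler_wpM2l//.
  have s20 : 0 < s ^+ 2 by exact: lt_le_trans hs.
  rewrite lef_pV2 ?posrE ?sqrtr_gt0; last 2 first.
  - by rewrite mulrn_wgt0// mulr_gt0// pi_gt0.
  - by rewrite mulrn_wgt0// mulr_gt0// pi_gt0.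
  by rewrite ler_wsqrtr// lerMn2r/= ler_wpM2r ?pi_ge0.
apply: Ele_le hA => //; apply: aeW => w; rewrite indicE; case: (ltP `|Z w - x| e) => // h.
rewrite mem_set// /A/= in_itv/=; move: h; rewrite ltr_norml => /andP[h1 h2].
by apply/andP; split; lra.
Qed.

End SmallBalls.

Lemma ler_sum_subrange (R : realType) (F : nat -> R) (a b c : nat) : (a <= b)%N -> (b <= c)%N ->
  (forall i, 0 <= F i) -> \sum_(a <= i < b) F i <= \sum_(0 <= i < c) F i.
Proof.
move=> ab bc F0; rewrite (big_cat_nat (leq0n a) (leq_trans ab bc))/= (big_cat_nat ab bc)/=.
by rewrite [leRHS]addrCA lerDl addr_ge0// sumr_ge0.
Qed.

Section NonDegenerate.
Context (R : realType) (d : measure_display) (Omega : measurableType d).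
Variables (P : probability Omega R) (H alpha : R) (B : R -> {RV P >-> R}) (L : R -> R).
Hypotheses (hH : 2^-1 <= H < 1) (hB : fractional_brownian_motion H B).
Hypotheses (alpha0 : 0 < alpha) (lL : lbm L).

Lemma fbm_cov_ge0 (s t : R) : 0 <= s -> 0 <= t -> 0 <= fbm_cov H s t.
Proof.
wlog st : s t / s <= t.
  move=> W s0 t0; have [st|/ltW ts] := leP s t; first exact: W.
  by have := W t s ts t0 s0; rewrite /fbm_cov distrC [s `^ _ + _]addrC.
move=> s0 t0; rewrite /fbm_cov mulr_ge0// addrAC addr_ge0 ?powR_ge0// subr_ge0.
rewrite ger0_norm ?subr_ge0// ge0_ler_powR ?nnegrE ?subr_ge0//.
- exact: ltW (H2_gt0 hH).
- by rewrite gerBl.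
Qed.

Lemma fbm_cov_ge_half (s t : R) : 1 <= s <= 2 -> 1 <= t <= 2 -> 2^-1 <= fbm_cov H s t.
Proof.
move=> /andP[s1 s2] /andP[t1 t2]; have h0 := ltW (H2_gt0 hH).
have pow1 : 1 `^ (2 * H) = 1 :> R by rewrite powR1.
have g1 x : 1 <= x -> 1 <= x `^ (2 * H) by move=> x1; rewrite -[leLHS]pow1 ge0_ler_powR ?nnegrE//; lra.
have l1 : `|t - s| `^ (2 * H) <= 1.
  rewrite -[leRHS]pow1 ge0_ler_powR ?nnegrE//.
  by rewrite ler_norml; apply/andP; split; lra.
by rewrite /fbm_cov -[leLHS]mulr1 ler_wpM2l//; have := g1 s s1; have := g1 t t1; lra.
Qed.

(** The Riemann sums of int_0^T e^(-alpha s) B_s ds on the dyadic grid. *)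
Definition wsum_B (T m : nat) (w : Omega) : R :=
  \sum_(0 <= i < T * 2 ^ m) (expR (- alpha * dy R m i) / 2 ^+ m) * B (dy R m i) w.

Lemma wsum_gaussian T m : gaussian_variable P (wsum_B T m).
Proof.
have := fbm_gaussian hB (m := (T * 2 ^ m)%N) (t := fun i => dy R m i)
  (fun i => expR (- alpha * dy R m i) / 2 ^+ m) (fun i => dy_ge0 _ _ _).
by congr gaussian_variable; apply/funext => w; rewrite /wsum_B big_mkord.
Qed.

Let hi m i : sqint P (B (dy R m i)). Proof. by apply: (B_sqint hB); exact: dy_ge0. Qed.

Lemma wsum_sqint T m : sqint P (wsum_B T m).
Proof. by apply: sqint_sum => i; apply: sqintZ; exact: hi. Qed.

(** Weights and covariances are nonnegative, so the terms with both times
    in [1, 2] alone bound the variance from below, independently of T and of the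
    mesh. *)
Lemma wsum_variance T m (a : R) : (2 <= T)%N ->
  2^-1 * expR (- alpha * 2) ^+ 2 <= EE P (fun w => (wsum_B T m w - a) ^+ 2).
Proof.
move=> T2; have hs := wsum_sqint T m; have iz1 := sqint_intg hs; have [_ iz2] := hs.
have -> : (fun w => (wsum_B T m w - a) ^+ 2) =
    (fun w => wsum_B T m w ^+ 2 + (-2 * a * wsum_B T m w + a ^+ 2)).
  by apply/funext => w; ring.
have iz : intg P (fun w => -2 * a * wsum_B T m w) by exact: intgZ.
rewrite EED//; last by apply: intgD => //; exact: intg_cst.
rewrite EED//; last exact: intg_cst.
have ib i : intg P (fun w => (expR (- alpha * dy R m i) / 2 ^+ m) * B (dy R m i) w).
  by apply: intgZ; exact: sqint_intg.
rewrite EEZ// EE_cst [EE P (wsum_B T m)]EE_sum//.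
rewrite [X in _ + (_ * X + _)]big1 => [|i _]; last first.
  by rewrite EEZ ?(B_mean hB) ?mulr0 ?dy_ge0//; exact: sqint_intg.
rewrite mulr0 add0r; apply: ler_wpDr; first exact: sqr_ge0.
rewrite EE_sqr_sum; last by move=> i; exact: hi.
have c0 i : 0 <= expR (- alpha * dy R m i) / 2 ^+ m :> R.
  by rewrite divr_ge0 ?expR_ge0// ltW// pow2_gt0.
have F0 i j : 0 <= expR (- alpha * dy R m i) / 2 ^+ m * (expR (- alpha * dy R m j) / 2 ^+ m) *
    EE P (fun w => B (dy R m i) w * B (dy R m j) w).
  rewrite (B_cov hB) ?dy_ge0// mulr_ge0 ?fbm_cov_ge0 ?dy_ge0//; exact: mulr_ge0.
have le1 : (1 * 2 ^ m <= 2 * 2 ^ m)%N by rewrite leq_mul2r orbT.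
have le2 : (2 * 2 ^ m <= T * 2 ^ m)%N by rewrite leq_mul2r T2 orbT.
apply: le_trans (ler_sum_subrange le1 le2 _); last by move=> i; apply: sumr_ge0.
have bd i : (1 * 2 ^ m <= i < 2 * 2 ^ m)%N -> 1 <= dy R m i <= 2 /\
    expR (- alpha * 2) / 2 ^+ m <= expR (- alpha * dy R m i) / 2 ^+ m.
  move=> h; have [h1 h2] := dy_itv R h; have h3 := le_trans (dy_leS R m i) h2.
  split; first by rewrite h1 h3.
  by rewrite ler_pM2r ?invr_gt0 ?pow2_gt0// ler_expR !mulNr lerN2 ler_pM2l.
pose e := expR (- alpha * 2) / 2 ^+ m.
have e0 : 0 <= e by rewrite divr_ge0 ?expR_ge0// ltW// pow2_gt0.
(* the cells that start in [1, 2[ are those with 2^m <= i < 2^(m + 1) *)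
apply: le_trans (_ : \sum_(1 * 2 ^ m <= i < 2 * 2 ^ m) \sum_(1 * 2 ^ m <= j < 2 * 2 ^ m) e * e * 2^-1 <= _).
  have cnt : ((2 * 2 ^ m - 1 * 2 ^ m)%N)%:R = (2 : R) ^+ m by rewrite -natrX mul1n mul2n -addnn addnK.
  rewrite sumr_const_nat sumr_const_nat -[leRHS]mulr_natr -[X in _ <= X * _]mulr_natr cnt /e.
  rewrite le_eqVlt; apply/predU1P; left; field.
  by rewrite gt_eqF// pow2_gt0.
apply: ler_sum_nat => i /bd[i12 ie].
apply: le_trans (ler_sum_subrange le1 le2 (F0 i)).
apply: ler_sum_nat => j /bd[j12 je].
rewrite (B_cov hB) ?dy_ge0//; apply: ler_pM => //; first exact: mulr_ge0.
  exact: ler_pM.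
exact: fbm_cov_ge_half.
Qed.

Let b w (t : R) := B t w.

Lemma eta_split w T : cont0 (b w) ->
  eta alpha L (b w) T%:R = \I_[0, T%:R] (fun s => expR (- alpha * s) * B s w)
    + \I_[0, T%:R] (fun s => expR (- alpha * s) * \I_[0, s] L).
Proof.
move=> cb; rewrite /eta -IID//.
- by apply: II_eq => s _; rewrite /forcing mulrDr.
- by apply: cont0_lbm; apply: cont0M => //; exact: cont0_expR.
- by apply: cont0_lbm; apply: cont0M; [exact: cont0_expR|exact: II_cont].
Qed.

(** The drift shifts eta by a constant D, and small balls around 0 become
    small balls around - D: this is why the bound is uniform over centres. *)
Lemma eta_small_ball : exists2 C : R, 0 < C & forall T, (2 <= T)%N -> forall e : R, 0 < e ->
  Ele P (fun w => ((`|eta alpha L (b w) T%:R| < e)%R)%:R) (C * e).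
Proof.
have v0 : 0 < 2^-1 * expR (- alpha * 2) ^+ 2 :> R.
  by rewrite mulr_gt0// exprn_gt0// expR_gt0.
have [C C0 HC] := gaussian_small_ball P v0; exists C => // T T2 e e0.
pose D := \I_[0, T%:R] (fun s => expR (- alpha * s) * \I_[0, s] L).
have h m : Ele P (fun w => ((`|wsum_B T m w - - D| < e)%R)%:R) (C * e).
  apply: HC => //; first exact: wsum_gaussian.
    exact: wsum_sqint.
  by move=> a; exact: wsum_variance.
apply: (Ele_fatou h); apply: filterS (B_path hB) => w cb r r0.
have := riemann_cvg (leq0n T) (cont0M (@cont0_expR R (- alpha)) cb).
move=> rc.
case: (ltP `|_| e) => he; last first.
  by apply: nearW => m; rewrite addr_ge0// ltW.
have gap : 0 < e - `|eta alpha L (b w) T%:R| by rewrite subr_gt0.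
have /cvgrPdist_lt/(_ _ gap) := rc.
apply: filterS => m hm.
suff -> : `|wsum_B T m w - - D| < e by rewrite lerDl ltW.
have -> : wsum_B T m w - - D = eta alpha L (b w) T%:R -
   (\I_[0, T%:R] (fun s => expR (- alpha * s) * B s w) - wsum_B T m w).
  by rewrite eta_split// -/D; ring.
apply: le_lt_trans (ler_normB _ _) _; rewrite addrC -ltrBrDr.
apply: le_lt_trans hm; rewrite le_eqVlt; apply/predU1P; left; congr `|_ - _|.
by rewrite /wsum_B; apply: eq_bigr => i _; rewrite mulrAC.
Qed.

Lemma eta_limit_neq0 : {ae P, forall w, cvgn (fun n => eta alpha L (b w) n%:R)} ->
  {ae P, forall w, limn (fun n => eta alpha L (b w) n%:R) != 0}.
Proof.
move=> hc; pose l w := limn (fun n => eta alpha L (b w) n%:R).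
have [C C0 HC] := eta_small_ball.
have h e : 0 < e -> Ele P (fun w => ((`|l w| < e)%R)%:R) (C * e).
  move=> e0; apply: (Ele_fatou (fun m => HC m.+2 isT e e0)).
  apply: filterS hc => w cw r r0.
  case: (ltP `|l w| e) => he; last by apply: nearW => m; rewrite addr_ge0// ltW.
  have gap : 0 < e - `|l w| by rewrite subr_gt0.
  have /cvgrPdist_lt/(_ _ gap)[N _ HN] := cw.
  exists N => // m /= Nm; have := HN m.+2 (leq_trans Nm (leq_trans (leqnSn _) (leqnSn _))).
  move=> /= hm; suff -> : `|eta alpha L (b w) m.+2%:R| < e by rewrite lerDl ltW.
  have -> : eta alpha L (b w) m.+2%:R = l w - (l w - eta alpha L (b w) m.+2%:R) by ring.
  by apply: le_lt_trans (ler_normB _ _) _; rewrite addrC -ltrBrDr.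
have n0 : {ae P, forall w, ((l w == 0)%:R : R) = 0}.
  apply: Ele_null => // e e0.
  have eC : 0 < e / C by rewrite divr_gt0.
  have := h _ eC; rewrite mulrCA mulfV ?gt_eqF// mulr1.
  apply: Ele_le => //; apply: aeW => w; case: eqP => // ->; rewrite normr0 eC//.
apply: filterS n0 => w; case: eqP => // _ /eqP; by rewrite oner_eq0.
Qed.

End NonDegenerate.

(** * The noise terms *)

Section Periodic.
Variable R : realType.
Local Notation mu := (@lebesgue_measure R).

Definition translate (a : R) : R -> measurableTypeR R := fun x => x + a.

Lemma measurable_translate a : measurable_fun [set: R] (translate a).
Proof. exact: measurable_funD. Qed.

Lemma translate_itv a (x y : R) : translate a @^-1` `]x, y] = `](x - a), (y - a)]%classic.
Proof. by apply/seteqP; split => z /=; rewrite /translate !in_itv/= ltrBlDr lerBrDr. Qed.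

Lemma lebesgue_measure_translate (a : R) (A : set R) : measurable A ->
  pushforward mu (translate a) A = mu A.
Proof.
move=> mA; apply/esym/lebesgue_measure_unique => //=; first exact: measurable_translate.
move=> mt _ [[x y]] _ <-; rewrite /pushforward translate_itv !lebesgue_measure_itv/= !lte_fin ltrD2r.
by rewrite -!EFinB; case: ifP => // _; congr EFin; ring.
Qed.

(** Change of variables for a merely measurable integrand, through the image of
    Lebesgue measure under a translation. *)
Lemma II_translate (f : R -> R) (a x y : R) : measurable_fun [set: R] f ->
  lebesgue_measure.-integrable `[x, y] (EFin \o (fun s => f (s + a))) ->
  \I_[x + a, y + a] f = \I_[x, y] (fun s => f (s + a)).
Proof.
move=> mf intf; rewrite /Rintegral; congr fine.
have pre : translate a @^-1` `[x + a, y + a]%classic = `[x, y]%classic.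
  by apply/seteqP; split => z /=; rewrite /translate !in_itv/= !lerD2r.
transitivity (\int[pushforward mu (translate a)]_(z in `[(x + a)%R, (y + a)%R]) (f z)%:E)%E.
  apply: eq_measure_integral; first exact: measurable_translate.
  by move=> mt A mA _; exact/esym/lebesgue_measure_translate.
rewrite integral_pushforward//= ?pre//.
- exact: measurable_translate.
- exact/measurable_EFinP.
Qed.

Lemma II_periodic (f : R -> R) (M : R) (n : nat) : measurable_fun [set: R] f ->
  (forall t, `|f t| <= M) -> periodic f 1 -> \I_[0, n%:R] f = n%:R * \I_[0, 1] f.
Proof.
move=> mf bf pf; have lf := lbm_bounded mf bf.
have E j : \I_[j%:R, j.+1%:R] f = \I_[0, 1] f.
  have fj s : f (s + j%:R) = f s by have := periodicn pf j s.
  have ej : (fun s => f (s + j%:R)) = f by apply/funext.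
  rewrite -[in LHS](add0r j%:R) -[j.+1%:R]natr1 [j%:R + 1]addrC II_translate// ej//.
  exact: lbm_integrable.
by rewrite (II_nat (leq0n n) lf) (eq_bigr _ (fun j _ => E j)) sumr_const_nat subn0 mulr_natl.
Qed.

End Periodic.

Section Noise.
Context (R : realType) (d : measure_display) (Omega : measurableType d).
Variables (P : probability Omega R) (H alpha : R) (p : nat) (mu : 'rV[R]_p).
Variables (phi : 'I_p -> R -> R) (M : R) (B X : R -> {RV P >-> R}) (F : R -> set (set Omega)).
Hypotheses (hH : 2^-1 <= H < 1) (alpha0 : 0 < alpha).
Hypothesis mphi : forall i, measurable_fun [set: R] (phi i).
Hypothesis bphi : forall i t, `|phi i t| <= M.
Hypotheses (hB : fractional_brownian_motion H B) (hX : is_solution mu alpha phi B X).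

Let x w (t : R) := X t w.
Let b w (t : R) := B t w.
Let dr w := drift mu alpha phi (x w).
Let K := mean_sup mu M.

Lemma drift_path_lbm : {ae P, forall w, lbm (dr w)}.
Proof. by apply: filterS hX => w [_ cx _]; exact: (drift_lbm _ _ mphi bphi cx). Qed.

Lemma M2_ge0 : 0 <= M ^+ 2. Proof. exact: sqr_ge0. Qed.

(** The noise of an integral with respect to X. At n = 0 nothing is known
    about the integral; setting the noise to 0 there keeps the sequence
    amenable to the strong law. *)
Definition dnoise (I : nat -> Omega -> R) (Y : R -> Omega -> R) (n : nat) (w : Omega) : R :=
  if n is 0 then 0 else I n w - \I_[0, n%:R] (fun s => Y s w * dr w s).

Lemma young_noise_phi (k : 'I_p) (I : nat -> Omega -> R) : H != 2^-1 ->
  (forall n, (0 < n)%N ->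
     is_integral_dX H mu alpha phi F B X n%:R (fun t _ => phi k t) (I n)) ->
  {ae P, forall w, (fun n => dnoise I (fun t _ => phi k t) n w / n%:R) @ \oo --> (0 : R)}.
Proof.
move=> H2 hI; set S := dnoise I _.
have hS : {ae P, forall w, forall n, (fun m => stieltjes_sum m 0 n (phi k) (b w)) @ \oo --> S n w}.
  have hI' n : {ae P, forall w, (0 < n)%N -> is_young_integral n%:R (phi k) (x w) (I n w)}.
    case: n => [|n]; first exact: aeW.
    by have := hI n.+1 isT; rewrite /is_integral_dX (negPf H2); apply: filterS.
  apply: filterS3 (ae_foralln hI') hX drift_path_lbm => w h1 [_ cx eqn] ld [|n].
    rewrite /S/=; apply: cvg_near_cst; apply: nearW => m.
    by rewrite /stieltjes_sum big_geq.
  by have := young_noise ld eqn (h1 n.+1 isT); exact.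
have M0 := M2_ge0.
apply: (strong_law (C := M ^+ 2) (r := 2 * H)) => //.
- exact: H2_lt2 hH.
- move=> n; apply: (Ele_cvg (F := fun m w => stieltjes_sum m 0 n (phi k) (b w) ^+ 2)).
    move=> m; apply: Ele_le (weighted_incr hH hB m (leq0n (n * 2 ^ m)) (fun i => bphi k (dy R m i))).
      exact: aeW.
    by rewrite dy_nat /dy mul0r subr0.
  apply: filterS hS => w /(_ n) h; have h2 := cvgM h h.
  exact: h2.
- move=> n; apply: (Ele_cvg (F := fun m w => stieltjes_sum m n n.+1 (phi k) (b w) ^+ 2)).
    move=> m; have le : (n * 2 ^ m <= n.+1 * 2 ^ m)%N by rewrite leq_mul2r leqnSn orbT.
    apply: Ele_le (weighted_incr hH hB m le (fun i => bphi k (dy R m i))).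
      exact: aeW.
    by rewrite !dy_nat -[n.+1%:R]natr1 addrAC subrr add0r powR1 mulr1.
  apply: filterS hS => w h.
  have -> : (fun m => stieltjes_sum m n n.+1 (phi k) (b w) ^+ 2) =
    (fun m => (stieltjes_sum m 0 n.+1 (phi k) (b w) - stieltjes_sum m 0 n (phi k) (b w)) *
              (stieltjes_sum m 0 n.+1 (phi k) (b w) - stieltjes_sum m 0 n (phi k) (b w))).
    apply/funext => m; rewrite -expr2; congr (_ ^+ 2).
    have le : (n * 2 ^ m <= n.+1 * 2 ^ m)%N by rewrite leq_mul2r leqnSn orbT.
    by rewrite /stieltjes_sum [in X in _ = X - _](big_cat_nat (leq0n _) le)//= addrAC subrr add0r.
  by rewrite expr2; apply: cvgM; apply: cvgB; exact: h.
Qed.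

Lemma ito_noise_phi (k : 'I_p) (I : nat -> Omega -> R) : H = 2^-1 -> brownian_filtration B F ->
  (forall n, (0 < n)%N ->
     is_integral_dX H mu alpha phi F B X n%:R (fun t _ => phi k t) (I n)) ->
  {ae P, forall w, (fun n => dnoise I (fun t _ => phi k t) n w / n%:R) @ \oo --> (0 : R)}.
Proof.
move=> H2 hF hI; have hB' : fractional_brownian_motion 2^-1 B by rewrite -H2.
have hJ n : exists J : {RV P >-> R}, is_ito_integral F B n.+1%:R (fun t _ => phi k t) J /\
    {ae P, forall w, dnoise I (fun t _ => phi k t) n.+1 w = J w}.
  have := hI n.+1 isT; rewrite /is_integral_dX H2 eqxx => -[J hJ hw]; exists J; split => //.
  by apply: filterS hw => w; rewrite /dnoise => ->; rewrite addrAC subrr add0r.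
have {hJ}[J hJ] := choice hJ.
pose S n w := if n is n'.+1 then J n' w : R else 0.
have lphi := phi_lbm mphi bphi k.
have EJ n : Ele P (fun w => J n w ^+ 2) (6 + 4 * (M ^+ 2 * n.+1%:R)).
  have [hJn _] := hJ n; apply: (ito_L2 hB' hF hJn); first exact: aeW.
  have n0 : 0 <= n.+1%:R :> R by [].
  apply: Ele_le (Ele_cst P (mulr_ge0 M2_ge0 n0)) => //.
  apply: aeW => w; rewrite -[X in _ <= _ * X]subr0 -II_cst//.
  apply: II_le => //; [exact: lbmX2|exact: lbm_cst|move=> s _].
  by rewrite -real_normK ?num_real// lerXn2r ?nnegrE// (le_trans _ (bphi k 0)).
have M0 := M2_ge0.
have hS : {ae P, forall w, (fun n => S n w / n%:R) @ \oo --> (0 : R)}.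
  apply: (strong_law (C := 16 + 4 * M ^+ 2) (r := 1)).
  - by lra.
  - by lra.
  - case=> [|n]; last first.
      rewrite powRr1//; apply: Ele_le (EJ n); first exact: aeW.
      have : 1 <= n.+1%:R :> R by rewrite ler1n.
      by move: (n.+1%:R : R) => y y1; nra.
    apply: Ele_le (Ele_cst P (lexx 0)); first by apply: aeW => w; rewrite expr0n.
    by rewrite mulr_ge0 ?powR_ge0//; lra.
  - case=> [|n]; last first.
      by have [h1 _] := hJ n; have [h2 _] := hJ n.+1; have := ito_increment hB' hF lphi (bphi k) h1 h2; exact.
    apply: Ele_le (EJ 0%N); first by apply: aeW => w; rewrite /S subr0.
    by rewrite mulr1; lra.
have hall := ae_foralln (fun n => (hJ n).2).
apply: filterS2 hall hS => w h.
have -> // : (fun n => dnoise I (fun t _ => phi k t) n w / n%:R) = (fun n => S n w / n%:R).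
by apply/funext => -[|n] //; rewrite h.
Qed.

(** The pathwise energy bound, averaged: E bsq(j) is at most quadratic in j. *)
Lemma sqint_path : exists2 V : R, 0 <= V &
  forall n, Ele P (fun w => \I_[0, n%:R] (fun s => x w s ^+ 2)) (V * expR (alpha * n%:R) ^+ 2).
Proof.
have [C C0 HC] := bsq_Ele hH hB; have [W W0 HW] := sum_sqr_expN alpha0.
have K2 : 0 <= K ^+ 2 by exact: sqr_ge0.
have lL := mean_lbm mu mphi bphi; have LK := mean_bound mu bphi.
pose D := 2 * C + 2 * K ^+ 2.
have D0 : 0 <= D by rewrite /D; lra.
exists (3 * (D * W)) => [|n]; first by rewrite !mulr_ge0// ltW.
have hQ : {ae P, forall w, Qsum alpha (mean_fun mu phi) (b w) n <=
   \sum_(0 <= j < n) expR (- alpha * j%:R) * (2 * bsq (b w) j + 2 * K ^+ 2 * j.+1%:R ^+ 2)}.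
  apply: filterS (B_path hB) => w cb; apply: ler_sum_nat => j _.
  by rewrite ler_wpM2l ?expR_ge0//; exact: csq_le lL LK cb j.
have EQ : Ele P (fun w => Qsum alpha (mean_fun mu phi) (b w) n) (D * W).
  have h j : Ele P (fun w => expR (- alpha * j%:R) * (2 * bsq (b w) j + 2 * K ^+ 2 * j.+1%:R ^+ 2))
      (D * (expR (- alpha * j%:R) * j.+1%:R ^+ 2)).
    have j0 : 0 <= 2 * K ^+ 2 * j.+1%:R ^+ 2 by rewrite mulr_ge0 ?sqr_ge0// mulr_ge0.
    apply: Ele_le (EleZ (expR_ge0 (- alpha * j%:R))
      (EleD (EleZ (c := 2) (ler0n _ _) (HC j)) (Ele_cst P j0))); first exact: aeW.
    by rewrite le_eqVlt; apply/predU1P; left; rewrite /D; ring.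
  apply: Ele_le hQ _ (Ele_sum (index_iota 0 n) h).
  by rewrite -mulr_sumr ler_wpM2l.
apply: Ele_le (EleZ (c := 3 * expR (alpha * n%:R) ^+ 2) _ EQ).
- by apply: filterS2 hX (B_path hB) => w [_ cx eqn] cb; exact: Ix2_le.
- by rewrite le_eqVlt; apply/predU1P; left; ring.
- by rewrite mulr_ge0// sqr_ge0.
Qed.

(** The variance of the noise is O(e^(2 alpha n)); dividing by
    n e^(alpha n) leaves a summable O(1 / n^2). *)
Lemma ito_noise_x (I : nat -> Omega -> R) : H = 2^-1 -> brownian_filtration B F ->
  (forall n, (0 < n)%N ->
     is_integral_dX H mu alpha phi F B X n%:R (fun t w => X t w) (I n)) ->
  {ae P, forall w, negl alpha (fun n => dnoise I (fun t w => X t w) n w)}.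
Proof.
move=> H2 hF hI; have hB' : fractional_brownian_motion 2^-1 B by rewrite -H2.
have hJ n : exists J : {RV P >-> R}, is_ito_integral F B n.+1%:R (fun t w => X t w) J /\
    {ae P, forall w, dnoise I (fun t w => X t w) n.+1 w = J w}.
  have := hI n.+1 isT; rewrite /is_integral_dX H2 eqxx => -[J hJ hw]; exists J; split => //.
  by apply: filterS hw => w; rewrite /dnoise => ->; rewrite addrAC subrr add0r.
have {hJ}[J hJ] := choice hJ.
have [V V0 HV] := sqint_path.
pose q n := n.+1%:R * expR (alpha * n.+1%:R).
have q0 n : 0 < q n by rewrite mulr_gt0// expR_gt0.
have EJ n : Ele P (fun w => (J n w / q n) ^+ 2) ((6 + 4 * V) * (n.+1%:R ^+ 2)^-1).
  have lX : {ae P, forall w, lbm (fun s => X s w)}.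
    by apply: filterS hX => w [_ cx _]; exact: cont0_lbm.
  have h := ito_L2 hB' hF (hJ n).1 lX (HV n.+1).
  have i0 : 0 <= (q n ^+ 2)^-1 by rewrite invr_ge0 sqr_ge0.
  apply: Ele_le (EleZ i0 h).
    by apply: aeW => w; rewrite expr_div_n mulrC.
  have e1 : 1 <= expR (alpha * n.+1%:R) ^+ 2.
    by apply: exprn_ege1; rewrite -expR0 ler_expR mulr_ge0// ltW.
  rewrite /q exprMn invfM -mulrA [leRHS]mulrC ler_wpM2l ?invr_ge0 ?sqr_ge0//.
  rewrite ler_pdivrMl; last by apply: lt_le_trans e1.
  by move: (expR _ ^+ 2) e1 => y y1; nra.
have bd N : \sum_(0 <= n < N) (6 + 4 * V) * (n.+1%:R ^+ 2)^-1 <= (6 + 4 * V) * 2.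
  by rewrite -mulr_sumr ler_wpM2l ?sum_inv_sqr//; lra.
have hs := Ele_series EJ (fun n w => sqr_ge0 _) bd.
have hall := ae_foralln (fun n => (hJ n).2).
apply: filterS2 hs hall => w hc hw.
rewrite /= in hw; rewrite /negl -cvg_shiftS/=.
apply/cvgrPdist_le => e e0; have e2 : 0 < e ^+ 2 by rewrite exprn_gt0.
have /cvgrPdist_le/(_ _ e2) := hc; apply: filterS => n.
rewrite !sub0r !normrN hw (ger0_norm (sqr_ge0 _)) -[X in X <= _]real_normK ?num_real//.
by rewrite ler_pXn2r// nnegrE ltW.
Qed.

Lemma young_noise_x (I : nat -> Omega -> R) : H != 2^-1 ->
  (forall n, (0 < n)%N ->
     is_integral_dX H mu alpha phi F B X n%:R (fun t w => X t w) (I n)) ->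
  {ae P, forall w, negl alpha (fun n => dnoise I (fun t w => X t w) n w)}.
Proof.
move=> H2 hI.
have hI' n : {ae P, forall w, (0 < n)%N -> is_young_integral n%:R (x w) (x w) (I n w)}.
  case: n => [|n]; first exact: aeW.
  by have := hI n.+1 isT; rewrite /is_integral_dX (negPf H2); apply: filterS.
have lL := mean_lbm mu mphi bphi; have LK := mean_bound mu bphi.
apply: filterS3 (ae_foralln hI') hX (filterI (B_path hB) (filterI (bsq_cvg0 hH hB) (B_strong_law hH hB))).
move=> w h1 [x0 cx eqn] [cb [hW hb]].
have ld : lbm (dr w) := drift_lbm mu alpha mphi bphi cx.
apply: negl_le (path_remainder alpha0 lL LK cx cb eqn hW hb) => -[|n].
  rewrite /dnoise normr0; apply: addr_ge0; last by apply: II_ge0 => s _; rewrite mulr_ge0.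
  by apply: addr_ge0; [exact: mulr_ge0|rewrite mulr_ge0// sqr_ge0].
rewrite /dnoise (young_self_noise cb ld eqn x0 (h1 n.+1 isT)).
apply: le_trans (ler_normB _ _) _; apply: lerD.
  apply: le_trans (ler_normD _ _) _; rewrite normrM lerD2l ger0_norm//.
  by rewrite mulr_ge0// sqr_ge0.
have lb := cont0_lbm cb.
apply: le_trans (II_norm _ (lexx 0) (lbmM lb ld)) _; rewrite le_eqVlt; apply/predU1P; left.
by apply: II_eq => s _; rewrite normrM.
Qed.

End Noise.

(** * Consistency *)

Section Family.
Variables (R : realType) (p : nat) (phi : 'I_p -> R -> R).

Lemma uniform_bound : (forall i, exists M : R, forall t, `|phi i t| <= M) ->
  exists M : R, forall i t, `|phi i t| <= M.
Proof.
move=> /choice[M HM]; exists (\sum_i `|M i|) => i t.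
rewrite (bigD1 i)//=; apply: le_trans (HM i t) _; apply: le_trans (ler_norm _) _.
by rewrite lerDl sumr_ge0.
Qed.

(** Periodicity carries orthonormality on [0, 1] to orthogonality on [0, n]. *)
Lemma orthonormal_nat : (forall i, measurable_fun [set: R] (phi i)) ->
  (exists M : R, forall i t, `|phi i t| <= M) -> (forall i, periodic (phi i) 1) ->
  orthonormal_family phi ->
  forall (n : nat) i j, \I_[0, n%:R] (fun s => phi i s * phi j s) = n%:R * (i == j)%:R.
Proof.
move=> mphi [M HM] pphi ophi n i j; rewrite -ophi.
apply: (@II_periodic _ _ (M * M)).
- exact: measurable_funM.
- by move=> t; rewrite normrM ler_pM.
- by move=> t; rewrite !pphi.
Qed.

End Family.

Theorem theorem3p1 (R : realType) (d : measure_display)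
    (Omega : measurableType d) (P : probability Omega R)
    (H alpha : R) (p : nat) (mu : 'rV[R]_p) (phi : 'I_p -> R -> R)
    (B X : R -> {RV P >-> R}) (F : R -> set (set Omega))
    (Iphi : nat -> 'I_p -> Omega -> R) (IX : nat -> Omega -> R)
    (hH : 2^-1 <= H < 1) (halpha : 0 < alpha)
    (phi_measurable : forall i, measurable_fun [set: R] (phi i))
    (phi_bounded : forall i, exists M : R, forall t, `|phi i t| <= M)
    (phi_periodic : forall i, periodic (phi i) 1)
    (phi_orthonormal : orthonormal_family phi)
    (hB : fractional_brownian_motion H B)
    (hF : H = 2^-1 -> brownian_filtration B F)
    (hX : is_solution mu alpha phi B X)
    (hIphi : forall n i, (0 < n)%N ->
      is_integral_dX H mu alpha phi F B X n%:R (fun t _ => phi i t) (Iphi n i))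
    (hIX : forall n, (0 < n)%N ->
      is_integral_dX H mu alpha phi F B X n%:R (fun t w => X t w) (IX n)) :
  {ae P, forall w,
    (fun n => theta_hat phi n (fun t => X t w) (fun i => Iphi n i w) (IX n w))
      @ \oo --> (mu, alpha)}.
Proof.
have [M bphi] := uniform_bound phi_bounded.
have ortho := orthonormal_nat phi_measurable (ex_intro _ M bphi) phi_periodic phi_orthonormal.
have lL := mean_lbm mu phi_measurable bphi; have LK := mean_bound mu bphi.
have hphi : {ae P, forall w, forall k,
    (fun n => noise_phi mu alpha phi (fun t => X t w) (fun n k => Iphi n k w) n k / n%:R)
      @ \oo --> (0 : R)}.
  have h k : {ae P, forall w,
      (fun n => dnoise alpha mu phi X (fun n => Iphi n k) (fun t _ => phi k t) n w / n%:R) @ \oo --> (0 : R)}.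
    have hk n : (0 < n)%N -> is_integral_dX H mu alpha phi F B X n%:R (fun t _ => phi k t) (Iphi n k).
      exact: hIphi.
    have [H2|H2] := eqVneq H 2^-1.
      exact: (ito_noise_phi phi_measurable bphi hB H2 (hF H2) hk).
    exact: (young_noise_phi hH phi_measurable bphi hB hX H2 hk).
  have h' := filter_forall (ae_filter_ringOfSetsType P) h.
  apply: filterS h' => w hw k.
  have -> // : (fun n => noise_phi mu alpha phi (fun t => X t w) (fun n k => Iphi n k w) n k / n%:R) =
    (fun n => dnoise alpha mu phi X (fun n => Iphi n k) (fun t _ => phi k t) n w / n%:R).
  by apply/funext => -[|n]//; rewrite invr0 !mulr0.
have hx : {ae P, forall w, negl alpha (noise_x mu alpha phi (fun t => X t w) (fun n => IX n w))}.
  have h : {ae P, forall w, negl alpha (fun n => dnoise alpha mu phi X IX (fun t w => X t w) n w)}.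
    have [H2|H2] := eqVneq H 2^-1.
      exact: (ito_noise_x hH halpha phi_measurable bphi hB hX H2 (hF H2) hIX).
    exact: (young_noise_x hH halpha phi_measurable bphi hB hX H2 hIX).
  apply: filterS h => w; rewrite /negl.
  have -> // : (fun n => noise_x mu alpha phi (fun t => X t w) (fun n => IX n w) n /
      (n%:R * expR (alpha * n%:R))) = (fun n => dnoise alpha mu phi X IX (fun t w => X t w) n w /
      (n%:R * expR (alpha * n%:R))).
  by apply/funext => -[|n]//; rewrite mul0r invr0 !mulr0.
have heta : {ae P, forall w, cvgn (fun n => eta alpha (mean_fun mu phi) (fun t => B t w) n%:R)}.
  by apply: filterS2 (B_path hB) (bsq_cvg0 hH hB) => w cb hW; exact: eta_cvg halpha lL LK cb hW.
have heta0 := eta_limit_neq0 hH hB halpha lL heta.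
apply: filterS3 hX (filterI hphi hx) (filterI (filterI (B_path hB) (bsq_cvg0 hH hB)) (filterI heta heta0)).
move=> w [x0 cx eqn] [hN hM] [[cb hW] [hc l0]].
have := estimator_cvg halpha phi_measurable bphi ortho cx cb eqn hW hN hM hc l0; exact.
Qed.
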